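(* Let $(\Phi,\Pi)$ be a based root system in a quadratic space $(V,\langle -,-\rangle)$ with associated Coxeter system $(W,S)$, where $V$ is finite dimensional, $\langle -,-\rangle$ is non-singular and $\Pi$ is finite. Let $\mathcal{Z}$ be the imaginary cone and $\mathcal{X}$ the Tits cone of $W$, and let $\mathcal{W}$ be the set of special facial subgroups of $W$, ordered by inclusion. Then: (a) $P=(\mathcal{Z},\mathcal{X})$ is a dual pair of cones (with respect to $\langle -,-\rangle$). (b) The map $W'\mapsto\mathcal{Z}_{W'}$ induces an isomorphism of complete lattices $\mathcal{W}\to\mathrm{Ext}_{\neq\emptyset}(\mathcal{Z})$. (c) The map $W'\mapsto\mathcal{X}(W')$ induces an isomorphism of complete lattices $\mathcal{W}\to\mathrm{Ext}_{\neq\emptyset}(\mathcal{X})^{\mathrm{op}}$, where $\mathrm{op}$ indicates the opposite poset. (d) For $W'\in\mathcal{W}$, $\mathcal{Z}_{W'}^{\dag}=\mathcal{X}(W')$ and $\mathcal{X}(W')^{\#}=\mathcal{Z}_{W'}$.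
   Context: Root systems. $V$ is a real vector space with a symmetric $\mathbb{R}$-bilinear form $\langle -,-\rangle$ (a quadratic space). For $A\subseteq V$, $\mathbb{R}_{\geq 0}A$ is the set of all finite non-negative real linear combinations of elements of $A$ (so $\mathbb{R}_{\ge 0}\emptyset=\{0\}$), and $A^\perp=\{v\in V\mid\langle v,a\rangle=0\ \forall a\in A\}$. For $\langle\alpha,\alpha\rangle\neq 0$, $s_\alpha(v)=v-\frac{2\langle v,\alpha\rangle}{\langle\alpha,\alpha\rangle}\alpha$. A based root system $(\Phi,\Pi)$ consists of: a subset $\Pi\subseteq V$ such that no linear combination with strictly positive coefficients of the elements of a non-empty finite subset of $\Pi$ is zero, $\langle\alpha,\alpha\rangle=1$ for $\alpha\in\Pi$, and for distinct $\alpha,\beta\in\Pi$ either $\langle\alpha,\beta\rangle=-\cos\frac{\pi}{m}$ for some integer $m\geq 2$ or $\langle\alpha,\beta\rangle\leq -1$; one sets $S=\{s_\alpha\mid\alpha\in\Pi\}$, $W=\langle S\rangle\subseteq \mathrm{GL}(V)$, $\Phi=\{w\alpha\mid w\in W,\alpha\in\Pi\}$. Then $(W,S)$ is a Coxeter system, with length function $l$. Put $\Phi_+=\Phi\cap\mathbb{R}_{\geq 0}\Pi$, $T=\{wsw^{-1}\mid w\in W,s\in S\}$. Reflection subgroups. A reflection subgroup is a subgroup $W'$ with $W'=\langle W'\cap T\rangle$. With $N(w)=\{t\in T\mid l(tw)<l(w)\}$, its canonical Coxeter generators are $\chi(W')=\{t\in T\mid N(t)\cap W'=\{t\}\}$ and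 its simple roots are $\Pi_{W'}=\{\alpha\in\Phi_+\mid s_\alpha\in\chi(W')\}$. The irreducible components of $W'$ are those of the Coxeter system $(W',\chi(W'))$. Cones. For a reflection subgroup $W'$: $\mathcal{C}_{W'}=\{v\in V\mid\langle v,\alpha\rangle\geq 0\ \forall\alpha\in\Pi_{W'}\}$, $\mathcal{K}_{W'}=\mathbb{R}_{\geq 0}\Pi_{W'}\cap(-\mathcal{C}_{W'})$, and $\mathcal{Z}_{W'}=\bigcup_{w\in W'}w(\mathcal{K}_{W'})$ is the imaginary cone of $W'$. Put $\mathcal{C}=\mathcal{C}_W$, $\mathcal{Z}=\mathcal{Z}_W$; the Tits cone is $\mathcal{X}=\bigcup_{w\in W}w(\mathcal{C})$. For a reflection subgroup $W'$ put $\mathcal{X}(W')=\mathcal{X}\cap\Pi_{W'}^{\perp}$. Facial subgroups. A subset $\Pi'$ of $\Pi$ is facial if $\Pi'=\Pi\cap v^\perp$ for some $v\in\mathcal{C}$; then $\langle s_\alpha\mid\alpha\in\Pi'\rangle$ is a standard facial subgroup. A facial subgroup is a $W$-conjugate of a standard facial subgroup; it is special if it has no finite irreducible component. Galois connection. For $A\subseteq\mathcal{Z}$, $A^{\dag}=\mathcal{X}\cap A^\perp$; for $B\subseteq\mathcal{X}$, $B^{\#}=\mathcal{Z}\cap B^\perp$. Faces and dual pairs. A cone is a convex subset closed under multiplication by positive scalars; it is pointed if it contains $0$. A face of a convex set $\mathcal{Y}$ is a convex subset $F\subseteq\mathcal{Y}$ such that if $y_1,y_2\in\mathcal{Y}$,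 $t\in(0,1)$ and $ty_1+(1-t)y_2\in F$, then $y_1,y_2\in F$. $\mathrm{Ext}_{\neq\emptyset}(\mathcal{Y})$ is the set of non-empty faces of $\mathcal{Y}$ ordered by inclusion (a complete lattice when $\mathcal{Y}$ is a pointed cone). For $A\subseteq V$ let $A^*=\{v\in V\mid\langle v,a\rangle\geq 0\ \forall a\in A\}$. A pair $(\mathcal{Y}_1,\mathcal{Y}_2)$ of pointed cones in $V$ with $\langle y_1,y_2\rangle\geq 0$ for all $y_i\in\mathcal{Y}_i$ is a semidual pair. For $\{i,j\}=\{1,2\}$, an exposed face of $\mathcal{Y}_i$ is a subset equal to $\mathcal{Y}_i$ or of the form $\mathcal{Y}_i\cap z^\perp$ with $z\in\mathcal{Y}_j$; a semi-exposed face of $\mathcal{Y}_i$ is an arbitrary intersection of exposed faces of $\mathcal{Y}_i$. The semidual pair is a dual pair of cones if (i) $\mathcal{Y}_1^*=\mathcal{Y}_2^{**}$ and (ii) for $i=1,2$, the set of non-empty faces of $\mathcal{Y}_i$ equals the set of its semi-exposed faces. *)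

(* Defs.v *)
From HB Require Import structures.
From mathcomp Require Import all_boot all_order all_algebra finmap.
From mathcomp Require Import sesquilinear.
From mathcomp Require Import all_classical all_reals all_analysis.
From mathcomp Require Import ring.
From Stdlib Require Import Relation_Operators.

Set Implicit Arguments.
Unset Strict Implicit.
Unset Printing Implicit Defensive.

Import Order.TTheory GRing.Theory Num.Theory.
Local Open Scope classical_set_scope.
Local Open Scope ring_scope.

Definition is_lub (X : Type) (P : set X) (le : X -> X -> Prop) (A : set X)
    (x : X) : Prop :=
  [/\ P x, forall a, A a -> le a x &
      forall y, P y -> (forall a, A a -> le a y) -> le x y].

Definition is_glb (X : Type) (P : set X) (le : X -> X -> Prop) (A : set X)
    (x : X) : Prop :=
  is_lub P (fun y z => le z y) A x.

(* Bounds are taken inside P and A may be empty, so P has a least and a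
   greatest element. *)
Definition complete_lattice (X : Type) (P : set X) (le : X -> X -> Prop) :
    Prop :=
  [/\ forall x, P x -> le x x,
      forall x y, P x -> P y -> le x y -> le y x -> x = y,
      forall x y z, P x -> P y -> P z -> le x y -> le y z -> le x z &
      forall A, A `<=` P ->
        (exists x, is_lub P le A x) /\ (exists x, is_glb P le A x)].

Definition complete_lattice_iso (T U : Type) (P : set T) (leP : T -> T -> Prop)
    (Q : set U) (leQ : U -> U -> Prop) (f : T -> U) : Prop :=
  [/\ complete_lattice P leP, complete_lattice Q leQ, set_bij P Q f,
      forall x y, P x -> P y -> (leP x y <-> leQ (f x) (f y)) &
      forall A x, A `<=` P ->
        (is_lub P leP A x -> is_lub Q leQ (f @` A) (f x)) /\
        (is_glb P leP A x -> is_glb Q leQ (f @` A) (f x))].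

Section GroupsWithGenerators.
Local Open Scope group_scope.
Context {G : groupType}.
Implicit Types (S H : set G) (s t w : G).

Definition generated S : set G :=
  smallest [set H : set G | group_closed (mem H)] S.

(* S is closed under inversion in all uses, so words in S suffice. *)
Definition is_word S w (n : nat) : Prop :=
  exists s : seq G, [/\ size s = n, forall x, x \in s -> S x &
                        w = \prod_(x <- s) x].

(* The value 0 off the subgroup generated by S is a dummy. *)
Definition coxlen S w : nat :=
  xget 0%N [set n | is_word S w n /\ forall m, is_word S w m -> (n <= m)%N].

Definition reflections S : set G :=
  [set w * s * w^-1 | w in generated S & s in S].

Definition inversions S w : set G :=
  [set t | reflections S t /\ (coxlen S (t * w) < coxlen S w)%N].

Definition canonical_generators S H : set G :=
  [set t | reflections S t /\ inversions S t `&` H = [set t]].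

(* Distinct Coxeter generators s, t are joined in the Coxeter graph iff
   m(s, t) >= 3, i.e. iff they do not commute. *)
Definition coxeter_edge S s t : Prop := [/\ S s, S t & ~ commute s t].

Definition irreducible_components S : set (set G) :=
  [set generated [set t | clos_refl_trans G (coxeter_edge S) s t] | s in S].

Definition conjugate_subgroup w H : set G := [set w * h * w^-1 | h in H].

End GroupsWithGenerators.

Section GeneralLinearGroup.
Context {R : realType} {V : vectType R}.

Record GL : Type := MkGL {
  GLfun :> 'End(V);
  GL_lker0 : lker GLfun == 0%VS
}.

HB.instance Definition _ := [isSub for GLfun].
HB.instance Definition _ := [Choice of GL by <:].

Lemma lker0_id : lker (\1%VF : 'End(V)) == 0%VS.
Proof. by apply/lker0P => x y; rewrite !lfunE. Qed.

Lemma lker0_comp (f g : GL) : lker (GLfun f \o GLfun g)%VF == 0%VS.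
Proof.
apply/lker0P => x y; rewrite !comp_lfunE => /(lker0P (GL_lker0 f)).
exact: (lker0P (GL_lker0 g)).
Qed.

Lemma lker0_inv (f : GL) : lker (GLfun f)^-1%VF == 0%VS.
Proof. by apply/lker0P; apply: can_inj (lker0_lfunVK (GL_lker0 f)). Qed.

Definition GLone : GL := MkGL lker0_id.
Definition GLmul (f g : GL) : GL := MkGL (lker0_comp f g).
Definition GLinv (f : GL) : GL := MkGL (lker0_inv f).

Lemma GLmulA : associative GLmul.
Proof. by move=> f g h; apply/val_inj; exact: comp_lfunA. Qed.
Lemma GLmul1g : left_id GLone GLmul.
Proof. by move=> f; apply/val_inj; exact: comp_lfun1l. Qed.
Lemma GLmulg1 : right_id GLone GLmul.
Proof. by move=> f; apply/val_inj; exact: comp_lfun1r. Qed.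
Lemma GLmulVg : left_inverse GLone GLinv GLmul.
Proof. by move=> f; apply/val_inj; exact: lker0_compVf (GL_lker0 f). Qed.
Lemma GLmulgV : right_inverse GLone GLinv GLmul.
Proof. by move=> f; apply/val_inj; exact: lker0_compfV (GL_lker0 f). Qed.

HB.instance Definition _ :=
  isGroup.Build GL GLmulA GLmul1g GLmulg1 GLmulVg GLmulgV.

End GeneralLinearGroup.
Arguments GL {R} V.

Section QuadraticSpace.
Context {R : realType} {V : vectType R}.
Variable B : {symmetric V}.
Implicit Types (A F : set V) (a v : V).

(* If B a a = 0 then division by 0 yields the identity, so that refl is
   invertible for every a. *)
Definition refl_fun a v : V := v - (2 * B v a / B a a) *: a.

Lemma refl_fun_linear a : linear (refl_fun a).
Proof.
move=> k u v; rewrite /refl_fun.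
have -> : B (k *: u + v) a = k * B u a + B v a by rewrite linearPl.
rewrite scalerBr scalerA addrACA -opprD -scalerDl; congr (_ - _ *: _).
by rewrite mulrDr mulrDl mulrCA !mulrA.
Qed.
HB.instance Definition _ a :=
  GRing.isLinear.Build R V V _ (refl_fun a) (refl_fun_linear a).

Lemma refl_funK a : involutive (refl_fun a).
Proof.
move=> v; have [a0|a0] := eqVneq (B a a) 0.
  by rewrite /refl_fun a0 invr0 !mulr0 !scale0r !subr0.
rewrite /refl_fun; set x := 2 * B v a / B a a.
have -> : B (v - x *: a) a = B v a - x * B a a.
  by rewrite linearBl /= linearZl_LR.
rewrite -addrA -opprD -scalerDl (_ : x + _ = 0) ?scale0r ?subr0 //.
by rewrite /x; field.
Qed.

Lemma refl_lker0 a : lker (linfun (refl_fun a)) == 0%VS.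
Proof.
by apply/lker0P => x y; rewrite !lfunE /=; exact: (can_inj (refl_funK a)).
Qed.

Definition refl a : GL V := MkGL (refl_lker0 a).

Lemma reflE a v : refl a v = v - (2 * B v a / B a a) *: a.
Proof. by rewrite lfunE. Qed.

Definition cone_hull A : set V :=
  [set v | exists (I : {fset V}) (c : V -> R),
    [/\ [set` I] `<=` A, forall a, a \in I -> 0 <= c a &
        v = \sum_(a <- I) c a *: a]].

Definition perp A : set V := [set v | forall a, A a -> B v a = 0].

Definition dual_cone A : set V := [set v | forall a, A a -> 0 <= B v a].

Definition pointed_cone A : Prop :=
  [/\ @convex_set R V A, forall (c : R) v, 0 < c -> A v -> A (c *: v) & A 0].

Definition is_face (Y F : set V) : Prop :=
  [/\ F `<=` Y, @convex_set R V F &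
      forall y1 y2 (t : R), Y y1 -> Y y2 -> 0 < t < 1 ->
        F (t *: y1 + (1 - t) *: y2) -> F y1 /\ F y2].

Definition nonempty_faces (Y : set V) : set (set V) :=
  [set F | is_face Y F /\ F !=set0].

Definition semidual_pair (Y1 Y2 : set V) : Prop :=
  [/\ pointed_cone Y1, pointed_cone Y2 &
      forall y1 y2, Y1 y1 -> Y2 y2 -> 0 <= B y1 y2].

Definition exposed_faces (Y Y' : set V) : set (set V) :=
  [set F | F = Y \/ exists2 z, Y' z & F = Y `&` perp [set z]].

Definition semi_exposed_faces (Y Y' : set V) : set (set V) :=
  [set F | exists2 E : set (set V), E `<=` exposed_faces Y Y' &
             F = Y `&` \bigcap_(G in E) G].

Definition dual_pair (Y1 Y2 : set V) : Prop :=
  [/\ semidual_pair Y1 Y2,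
      dual_cone Y1 = dual_cone (dual_cone Y2),
      nonempty_faces Y1 = semi_exposed_faces Y1 Y2 &
      nonempty_faces Y2 = semi_exposed_faces Y2 Y1].

Section RootSystem.
Variable Pi : set V.

Definition based_root_system : Prop :=
  [/\ forall (I : {fset V}) (c : V -> R), [set` I] `<=` Pi -> I != fset0 ->
        (forall a, a \in I -> 0 < c a) -> \sum_(a <- I) c a *: a <> 0,
      forall a, Pi a -> B a a = 1 &
      forall a b, Pi a -> Pi b -> a <> b ->
        (exists2 m : nat, (2 <= m)%N & B a b = - cos (pi / m%:R)) \/
        B a b <= -1].

Definition simple_reflections : set (GL V) := refl @` Pi.

Definition weyl_group : set (GL V) := generated simple_reflections.

Definition roots : set V := [set w a | w in weyl_group & a in Pi].

Definition positive_roots : set V := roots `&` cone_hull Pi.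

Definition simple_roots (W' : set (GL V)) : set V :=
  [set a | positive_roots a /\
           canonical_generators simple_reflections W' (refl a)].

Definition chamber (W' : set (GL V)) : set V :=
  [set v | forall a, simple_roots W' a -> 0 <= B v a].

Definition kcone (W' : set (GL V)) : set V :=
  cone_hull (simple_roots W') `&` [set v | chamber W' (- v)].

Definition imaginary_cone (W' : set (GL V)) : set V :=
  \bigcup_(w in W') [set w v | v in kcone W'].

Definition tits_cone : set V :=
  \bigcup_(w in weyl_group) [set w v | v in chamber weyl_group].

Definition tits_part (W' : set (GL V)) : set V := tits_cone `&` perp (simple_roots W').

Definition facial_subset (Pi' : set V) : Prop :=
  exists2 v, chamber weyl_group v & Pi' = Pi `&` perp [set v].

Definition standard_facial (W' : set (GL V)) : Prop :=
  exists2 Pi', facial_subset Pi' & W' = generated (refl @` Pi').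

Definition facial (W' : set (GL V)) : Prop :=
  exists w W1, [/\ weyl_group w, standard_facial W1 &
                   W' = conjugate_subgroup w W1].

Definition special_facial : set (set (GL V)) :=
  [set W' | facial W' /\
     forall J, irreducible_components
                 (canonical_generators simple_reflections W') J ->
       ~ finite_set J].

Definition dagger A : set V := tits_cone `&` perp A.

Definition sharp A : set V := imaginary_cone weyl_group `&` perp A.

End RootSystem.
End QuadraticSpace.

(* Main.v *)
Require Import Defs.
From mathcomp Require Import all_boot all_order all_algebra.
From mathcomp Require Import sesquilinear finmap.
From mathcomp Require Import all_classical all_reals all_analysis.
From mathcomp Require Import ring lra zify.
From Stdlib Require Import Relation_Operators.

(* Let C be the chamber and K the cone of nonnegative combinations of simple roots in
   -C. Since k lies below all its translates w k, Z = -X /\ X^*, and the Tits cone X is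
   the set of vectors that are negative on finitely many positive roots; so both are
   convex cones.

   A Farkas argument splits the simple roots into the finite components, on which the
   form has a positive vector d with B(d,a) > 0, and the others, which are exactly the
   support of a single element of K. Hence W_I has no finite component iff some element
   of K is a combination of the elements of I with positive coefficients.

   Z^* = X^**: for v in X^* and a suitable b in K, the orbit of v + e b stays in the
   cone of the simple roots while its height tends to infinity along the indefinite
   components, so a vector of minimal height exists, lies in K, and v + e b is in Z.
   Affine components act trivially on v, and finite ones have finite orbits.

   Faces: a nonempty face F of a cone Y has a relative interior point p, and then F is
   the set of the z in Y with p - e z in Y for small e > 0. For Y = Z one may take p in
   K; its maximal support I is facial and special, is cut out by some c in C, and F is
   the set of z in Z orthogonal to c, which is Z_{W_I}. The point is that,
   apart from affine components of I, the elements of I orthogonal to p generate a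
   finite group. For Y = X one may take p in C, and F is the set of x in X orthogonal to
   the infinite components of the stabilizer of p. Thus all faces are exposed and
   correspond to the special facial subgroups. *)

Set Implicit Arguments.
Unset Strict Implicit.
Unset Printing Implicit Defensive.

Import Order.TTheory GRing.Theory Num.Theory.
Local Open Scope classical_set_scope.
Local Open Scope ring_scope.

(** The simple roots are only positively independent, so a vector of their cone has many coefficient
    families and no support of its own. Coordinates are never compared. Instead, a nonnegative
    relation is trivial, and pairing a relation with a simple root controls the sign of its
    coefficient there, because distinct simple roots have nonpositive product. Non-singularity of
    the form turns the linear forms of Farkas' lemma into vectors.

    Finiteness rests on a vector [rho] whose product with each simple root is at least 1: positive
    roots then have height at least 1, and the height of a strictly negative vector grows linearly
    along reduced words.

    The canonical generators of a facial subgroup are accessible because the conjugator can be taken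
    of minimal length in its coset, where it keeps the relevant simple roots positive. *)

Section FiniteRootSystem.
Context {R : realType} {V : vectType R} (B : {symmetric V}).
Variable P : seq V.
Hypothesis uP : uniq P.
Hypothesis brs : based_root_system B [set` P].
Hypothesis ndB : nondegenerate B.

(** * The form, isometries and words in simple reflections *)

Lemma form_sym x y : B x y = B y x.
Proof. by rewrite hermC expr0 mul1r. Qed.

Lemma formDl x y z : B (x + y) z = B x z + B y z.
Proof. by rewrite linearDl. Qed.

Lemma formDr x y z : B z (x + y) = B z x + B z y.
Proof. by rewrite linearDr. Qed.

Lemma formZl k x z : B (k *: x) z = k * B x z.
Proof. by rewrite linearZl_LR. Qed.

Lemma formZr k x z : B z (k *: x) = k * B z x.
Proof. by rewrite linearZr_LR. Qed.

Lemma formNl x z : B (- x) z = - B x z.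
Proof. by rewrite linearNl. Qed.

Lemma formNr x z : B z (- x) = - B z x.
Proof. by rewrite linearNr. Qed.

Lemma form0l z : B 0 z = 0.
Proof. by rewrite linear0l. Qed.

Lemma form0r z : B z 0 = 0.
Proof. by rewrite linear0r. Qed.

Lemma form_suml (s : seq V) (F : V -> V) y :
  B (\sum_(a <- s) F a) y = \sum_(a <- s) B (F a) y.
Proof.
by apply: (big_morph (fun x => B x y)) => [u v|]; [exact: formDl|exact: form0l].
Qed.

Lemma form_sumr (s : seq V) (F : V -> V) y :
  B y (\sum_(a <- s) F a) = \sum_(a <- s) B y (F a).
Proof.
by apply: (big_morph (B y)) => [u v|]; [exact: formDr|exact: form0r].
Qed.

Lemma form_nondegenerate x : (forall y, B x y = 0) -> x = 0.
Proof.
move: ndB; rewrite /nondegenerate => /eqP h k.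
by apply/eqP; rewrite -memv0 -h; apply/mem_orthovP => v _.
Qed.

Definition formE := (formDl, formDr, formZl, formZr, formNl, formNr).

Lemma GL_mulE (f g : GL V) v : (f * g)%g v = f (g v).
Proof. by rewrite /= comp_lfunE. Qed.

Lemma GL_oneE v : (1%g : GL V) v = v.
Proof. by rewrite /= id_lfunE. Qed.

Lemma GL_ext (f g : GL V) : (forall v, f v = g v) -> f = g.
Proof. by move=> h; apply/val_inj/lfunP. Qed.

Lemma GL_linD (f : GL V) u v : f (u + v) = f u + f v.
Proof. exact: linearD. Qed.

Lemma GL_linB (f : GL V) u v : f (u - v) = f u - f v.
Proof. exact: linearB. Qed.

Lemma GL_linZ (f : GL V) k v : f (k *: v) = k *: f v.
Proof. exact: linearZ. Qed.

Lemma GL_linN (f : GL V) v : f (- v) = - f v.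
Proof. exact: linearN. Qed.

Lemma GL_lin0 (f : GL V) : f 0 = 0.
Proof. exact: linear0. Qed.

Definition GL_linE := (GL_linD, GL_linN, GL_linZ).

Lemma GL_invK (f : GL V) v : (f^-1)%g (f v) = v.
Proof. by rewrite -GL_mulE mulVg GL_oneE. Qed.

Lemma GL_Kinv (f : GL V) v : f ((f^-1)%g v) = v.
Proof. by rewrite -GL_mulE mulgV GL_oneE. Qed.

Lemma reflK a : (refl B a * refl B a = 1)%g.
Proof. by apply: GL_ext => v; rewrite GL_mulE GL_oneE /= !lfunE /= refl_funK. Qed.

Lemma reflV a : ((refl B a)^-1 = refl B a)%g.
Proof. by apply: (mulgI (refl B a)); rewrite mulgV reflK. Qed.

Lemma refl_id a v : B v a = 0 -> refl B a v = v.
Proof. by move=> h; rewrite reflE h mulr0 mul0r scale0r subr0. Qed.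

Lemma refl_isom a x y : B (refl B a x) (refl B a y) = B x y.
Proof.
rewrite !reflE; have [a0|a0] := eqVneq (B a a) 0.
  by rewrite a0 invr0 !mulr0 !scale0r !subr0.
by rewrite !formE (form_sym a y); field.
Qed.

Definition isom (w : GL V) := forall x y, B (w x) (w y) = B x y.

Lemma isom1 : isom 1%g.
Proof. by move=> x y; rewrite !GL_oneE. Qed.

Lemma isomM f g : isom f -> isom g -> isom (f * g)%g.
Proof. by move=> hf hg x y; rewrite !GL_mulE hf hg. Qed.

Lemma isomV f : isom f -> isom f^-1%g.
Proof. by move=> hf x y; rewrite -hf !GL_Kinv. Qed.

Lemma isom_adjoint w x y : isom w -> B (w x) y = B x (w^-1%g y).
Proof. by move=> hw; rewrite -[in RHS]hw GL_Kinv. Qed.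

Lemma refl_conj w a : isom w -> refl B (w a) = (w * refl B a * w^-1)%g.
Proof.
move=> hw; apply: GL_ext => v; rewrite !GL_mulE !reflE hw GL_linB GL_linZ.
by rewrite GL_Kinv (isom_adjoint v a (isomV hw)) invgK.
Qed.

Definition gprod (s : seq V) : GL V := (\prod_(a <- s) refl B a)%g.

Lemma gprod_nil : gprod [::] = 1%g.
Proof. by rewrite /gprod big_nil. Qed.

Lemma gprod_cons a s : gprod (a :: s) = (refl B a * gprod s)%g.
Proof. by rewrite /gprod big_cons. Qed.

Lemma gprod_cat s t : gprod (s ++ t) = (gprod s * gprod t)%g.
Proof. by rewrite /gprod big_cat. Qed.

Lemma gprod1 a : gprod [:: a] = refl B a.
Proof. by rewrite gprod_cons gprod_nil mulg1. Qed.

Lemma gprod_rcons s a : gprod (rcons s a) = (gprod s * refl B a)%g.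
Proof. by rewrite -cats1 gprod_cat gprod1. Qed.

Lemma gprod_rev s : gprod (rev s) = (gprod s)^-1%g.
Proof.
elim: s => [|a s IH]; first by rewrite gprod_nil invg1.
by rewrite rev_cons gprod_rcons gprod_cons IH invgM reflV.
Qed.

Lemma isom_gprod s : isom (gprod s).
Proof.
elim: s => [|a s IH]; first by rewrite gprod_nil; exact: isom1.
by rewrite gprod_cons; apply: isomM => // x y; exact: refl_isom.
Qed.

(* The simple roots are the elements of [P]; a parabolic subgroup is given by an
   arbitrary set [I] of vectors, of which only the part inside [P] matters. *)
Definition word (I : set V) (s : seq V) := forall a, a \in s -> a \in P /\ I a.

Definition Wg (I : set V) (w : GL V) := exists2 s, word I s & w = gprod s.

Lemma word_cons I a s : a \in P -> I a -> word I s -> word I (a :: s).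
Proof. by move=> aP aI hs b; rewrite inE => /orP[/eqP->|/hs]. Qed.

Lemma word_consP I a s : word I (a :: s) -> [/\ a \in P, I a & word I s].
Proof.
move=> h; have [aP aI] := h a (mem_head _ _); split=> // b bs.
by apply: h; rewrite inE bs orbT.
Qed.

Lemma word_cat I s t : word I s -> word I t -> word I (s ++ t).
Proof. by move=> hs ht a; rewrite mem_cat => /orP[/hs|/ht]. Qed.

Lemma word_catP I s t : word I (s ++ t) -> word I s /\ word I t.
Proof. by move=> h; split=> a ha; apply: h; rewrite mem_cat ha ?orbT. Qed.

Lemma word_rev I s : word I s -> word I (rev s).
Proof. by move=> h a; rewrite mem_rev => /h. Qed.

Lemma word_sub I J s : I `<=` J -> word I s -> word J s.
Proof. by move=> IJ h a /h[aP /IJ]. Qed.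

Lemma Wg1 I : Wg I 1%g.
Proof. by exists [::] => //; rewrite gprod_nil. Qed.

Lemma WgM I f g : Wg I f -> Wg I g -> Wg I (f * g)%g.
Proof.
move=> [s hs ->] [t ht ->]; exists (s ++ t); first exact: word_cat.
by rewrite gprod_cat.
Qed.

Lemma WgV I f : Wg I f -> Wg I f^-1%g.
Proof.
by move=> [s hs ->]; exists (rev s); [exact: word_rev|rewrite gprod_rev].
Qed.

Lemma Wg_refl I a : a \in P -> I a -> Wg I (refl B a).
Proof.
by move=> aP Ia; exists [:: a]; [exact: word_cons|rewrite gprod1].
Qed.

Lemma Wg_sub I J w : I `<=` J -> Wg I w -> Wg J w.
Proof. by move=> IJ [s hs ->]; exists s => //; exact: word_sub hs. Qed.

Lemma Wg_isom I w : Wg I w -> isom w.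
Proof. by move=> [s _ ->]; exact: isom_gprod. Qed.

Lemma Wg_fix I w v : Wg I w -> (forall a, a \in P -> I a -> B v a = 0) -> w v = v.
Proof.
move=> [s hs ->] h; elim: s hs => [|a s IH]; first by rewrite gprod_nil GL_oneE.
move=> /word_consP[aP aI hs]; rewrite gprod_cons GL_mulE IH // refl_id //.
exact: h.
Qed.

(** * Linear combinations and cones of simple roots *)

Definition lc (c : V -> R) : V := \sum_(a <- P) c a *: a.

(** The condition also concerns points outside [P], which [lc] does not see; hence the truncations
    [if x \in P] in later proofs. *)
Definition supp_in (I : set V) (c : V -> R) := forall a, c a != 0 -> I a.

Definition nonneg (c : V -> R) := forall a, 0 <= c a.

Definition cone (I : set V) : set V :=
  [set v | exists c, [/\ nonneg c, supp_in I c & v = lc c]].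

Definition spanI (I : set V) : set V :=
  [set v | exists2 c, supp_in I c & v = lc c].

Definition dlt (a b : V) : R := (b == a)%:R.

Lemma lc_dlt a : a \in P -> lc (dlt a) = a.
Proof.
move=> aP; rewrite /lc (bigD1_seq a) //= ?uP // /dlt eqxx scale1r big1 ?addr0 //.
by move=> b /negbTE ->; rewrite scale0r.
Qed.

Lemma lcD c d : lc c + lc d = lc (fun a => c a + d a).
Proof. by rewrite /lc -big_split; apply: eq_bigr => a _; rewrite scalerDl. Qed.

Lemma lcZ k c : k *: lc c = lc (fun a => k * c a).
Proof. by rewrite /lc scaler_sumr; apply: eq_bigr => a _; rewrite scalerA. Qed.

Lemma lcN c : - lc c = lc (fun a => - c a).
Proof. by rewrite /lc -sumrN; apply: eq_bigr => a _; rewrite scaleNr. Qed.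

Lemma lcB c d : lc c - lc d = lc (fun a => c a - d a).
Proof. by rewrite lcN lcD. Qed.

Lemma lc0 : lc (fun=> 0) = 0.
Proof. by rewrite /lc big1 // => a _; rewrite scale0r. Qed.

Lemma eq_lc c d : {in P, c =1 d} -> lc c = lc d.
Proof.
by move=> h; rewrite /lc big_seq [RHS]big_seq; apply: eq_bigr => a /h ->.
Qed.

Lemma form_lcl c y : B (lc c) y = \sum_(a <- P) c a * B a y.
Proof. by rewrite form_suml; apply: eq_bigr => a _; rewrite formZl. Qed.

Lemma form_lcr c y : B y (lc c) = \sum_(a <- P) c a * B y a.
Proof. by rewrite form_sumr; apply: eq_bigr => a _; rewrite formZr. Qed.

Lemma coneD I u v : cone I u -> cone I v -> cone I (u + v).
Proof.
move=> [c [c0 cI ->]] [d [d0 dI ->]]; exists (fun a => c a + d a).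
split; last by rewrite lcD.
  by move=> a; rewrite addr_ge0.
move=> a h; case: (eqVneq (c a) 0) => [ca|/cI//].
by apply: dI; move: h; rewrite ca add0r.
Qed.

Lemma coneZ I k u : 0 <= k -> cone I u -> cone I (k *: u).
Proof.
move=> k0 [c [c0 cI ->]]; exists (fun a => k * c a); split; last by rewrite lcZ.
  by move=> a; rewrite mulr_ge0.
by move=> a; rewrite mulf_eq0 negb_or => /andP[_ /cI].
Qed.

Lemma cone0 I : cone I 0.
Proof. by exists (fun=> 0); split => // [a|]; rewrite ?eqxx ?lc0. Qed.

Lemma cone_gen I a : a \in P -> I a -> cone I a.
Proof.
move=> aP Ia; exists (dlt a); split; last by rewrite lc_dlt.
  by move=> b; rewrite /dlt ler0n.
by move=> b; rewrite /dlt; have [->|_] := eqVneq b a => //; rewrite eqxx.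
Qed.

Lemma cone_sub I J : I `<=` J -> cone I `<=` cone J.
Proof. by move=> IJ v [c [c0 cI ->]]; exists c; split => // a /cI /IJ. Qed.

Lemma cone_span I v : cone I v -> spanI I v.
Proof. by move=> [c [c0 cI ->]]; exists c. Qed.

Lemma spanID I u v : spanI I u -> spanI I v -> spanI I (u + v).
Proof.
move=> [c cI ->] [d dI ->]; exists (fun a => c a + d a); last by rewrite lcD.
move=> a h; case: (eqVneq (c a) 0) => [ca|/cI//].
by apply: dI; move: h; rewrite ca add0r.
Qed.

Lemma spanIZ I k u : spanI I u -> spanI I (k *: u).
Proof.
move=> [c cI ->]; exists (fun a => k * c a); last by rewrite lcZ.
by move=> a; rewrite mulf_eq0 negb_or => /andP[_ /cI].
Qed.

Lemma spanI_refl I a v : a \in P -> I a -> spanI I v -> spanI I (refl B a v).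
Proof.
move=> aP Ia hv; rewrite reflE -scaleNr; apply: spanID => //.
by apply/spanIZ/cone_span/cone_gen.
Qed.

Lemma spanI_Wg I w v : Wg I w -> spanI I v -> spanI I (w v).
Proof.
move=> [s hs ->] hv; elim: s hs => [|a s IH]; first by rewrite gprod_nil GL_oneE.
by move=> /word_consP[aP aI hs]; rewrite gprod_cons GL_mulE; apply: spanI_refl (IH hs).
Qed.

Lemma form_span0 I v y : (forall a, a \in P -> I a -> B a y = 0) ->
  spanI I v -> B v y = 0.
Proof.
move=> h [c cI ->]; rewrite form_lcl big_seq big1 // => a aP.
by case: (eqVneq (c a) 0) => [->|/cI Ia]; rewrite ?mul0r // h // mulr0.
Qed.

Lemma form_cone_ge0 I v y : (forall a, a \in P -> I a -> 0 <= B a y) ->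
  cone I v -> 0 <= B v y.
Proof.
move=> h [c [c0 cI ->]]; rewrite form_lcl big_seq sumr_ge0 // => a aP.
by case: (eqVneq (c a) 0) => [->|/cI Ia]; rewrite ?mul0r // mulr_ge0 // h.
Qed.

Lemma form_cone_le0 I v y : (forall a, a \in P -> I a -> B a y <= 0) ->
  cone I v -> B v y <= 0.
Proof.
move=> h hv; rewrite -oppr_ge0 -formNr; apply: form_cone_ge0 hv => a aP aI.
by rewrite formNr oppr_ge0 h.
Qed.

Lemma cone_hullE I : cone_hull (I `&` [set` P]) = cone I.
Proof.
rewrite eqEsubset; split=> v.
  move=> [F [c [FI c0 ->]]].
  exists (fun a => if a \in F then c a else 0); split.
  - by move=> a; case: ifP => // /c0.
  - by move=> a; case: ifP => [aF _|]; [case: (FI a aF)|rewrite eqxx].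
  rewrite /lc [RHS](bigID [in F]) /= [X in _ + X]big1 ?addr0; last first.
    by move=> a /negbTE ->; rewrite scale0r.
  rewrite -[RHS]big_filter; rewrite (perm_big [seq a <- P | a \in F]) /=; last first.
    apply: uniq_perm; rewrite ?fset_uniq ?filter_uniq ?uP // => a.
    rewrite mem_filter; case: (boolP (a \in F)) => //= aF.
    by case: (FI a aF).
  by apply: eq_big_seq => a; rewrite mem_filter => /andP[-> _].
move=> [c [c0 cI ->]].
exists [fset a in P | c a != 0]%fset, c; split => //.
- by move=> a /=; rewrite !inE /= => /andP[aP /cI].
- rewrite /lc [LHS](bigID (fun a => c a != 0)) /= [X in _ + X]big1 ?addr0; last first.
    by move=> a; rewrite negbK => /eqP ->; rewrite scale0r.
  rewrite -[LHS]big_filter; apply: perm_big; apply: uniq_perm.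
  + by rewrite filter_uniq ?uP.
  + exact: fset_uniq.
  by move=> a; rewrite !inE mem_filter andbC.
Qed.

(** * Reduced words and positive roots *)

Lemma unit_root a : a \in P -> B a a = 1.
Proof. by move=> aP; case: brs => _ h _; exact: h. Qed.

Lemma dihedral_form a b : a \in P -> b \in P -> a != b ->
  (exists2 m : nat, (2 <= m)%N & B a b = - cos (pi / m%:R)) \/ B a b <= -1.
Proof. by move=> aP bP /eqP ab; case: brs => _ _ h; exact: h. Qed.

Lemma form_le0 a b : a \in P -> b \in P -> a != b -> B a b <= 0.
Proof.
move=> aP bP ab; case: (dihedral_form aP bP ab) => [[m m2 ->]|h]; last lra.
have m0 : (0 : R) < m%:R by rewrite ltr0n; lia.
rewrite oppr_le0; apply: cos_ge0_pihalf; apply/andP; split.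
  by rewrite (@le_trans _ _ 0) // ?oppr_le0 divr_ge0 ?pi_ge0 // ltW.
by rewrite ler_pM2l ?pi_gt0 // lef_pV2 ?posrE // ler_nat.
Qed.

Lemma pos_indep c : nonneg c -> lc c = 0 -> forall a, a \in P -> c a = 0.
Proof.
move=> c0 clc0 a aP; apply/eqP/negPn/negP => ca.
have [h _ _] := brs; apply: (h [fset x in P | c x != 0]%fset c).
- by move=> x /=; rewrite !inE => /andP[].
- by apply/fset0Pn; exists a; rewrite !inE aP.
- by move=> x; rewrite !inE => /andP[_ cx]; rewrite lt_neqAle eq_sym cx c0.
rewrite -[RHS]clc0 /lc [RHS](bigID (fun a => c a != 0)) /= [X in _ + X]big1 ?addr0.
    rewrite -[RHS]big_filter; apply: perm_big; apply: uniq_perm.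
  + exact: fset_uniq.
  + by rewrite filter_uniq ?uP.
  by move=> x; rewrite !inE mem_filter andbC.
by move=> x; rewrite negbK => /eqP ->; rewrite scale0r.
Qed.

Lemma cone_antisym I v : cone I v -> cone I (- v) -> v = 0.
Proof.
move=> [c [c0 cI cv]] [d [d0 dI dv]].
have h : lc (fun a => c a + d a) = 0 by rewrite -lcD -cv -dv subrr.
rewrite cv -lc0; apply: eq_lc => a aP.
have := pos_indep (c := fun a => c a + d a) _ h aP.
by move=> /(_ _)/eqP; rewrite paddr_eq0 // => /(_ _)/andP[] => [x|/eqP//]; exact: addr_ge0.
Qed.

(** The parity test fixes the last letter instead of the first: non-empty alternating words end in
    [b], and shorter ones are suffixes of longer ones. *)
Fixpoint alt (a b : V) (k : nat) : seq V :=
  if k is k'.+1 then (if odd k' then a else b) :: alt a b k' else [::].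

Lemma size_alt a b k : size (alt a b k) = k.
Proof. by elim: k => //= k ->. Qed.

Lemma alt_cat a b k j : (j <= k)%N -> exists2 p, alt a b k = p ++ alt a b j & size p = (k - j)%N.
Proof.
move=> jk; rewrite -(subnK jk); elim: (k - j)%N => [|i [p hp sp]].
  by exists [::] => //; rewrite add0n subnn.
exists ((if odd (i + j) then a else b) :: p); first by rewrite addSn /= hp.
by rewrite /= sp; lia.
Qed.

(* A word in two letters that is not alternating, or ends in [a], can be shortened
   modulo right multiplication by the reflection in [a]. *)
Lemma word2_alt a b t : (forall x, x \in t -> x = a \/ x = b) ->
  [\/ t = alt a b (size t),
      exists t' : seq V, [/\ {subset t' <= t}, (size t' < size t)%N & gprod t' = gprod t] |
      exists t' : seq V, [/\ {subset t' <= t}, (size t' < size t)%N &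
                     gprod t' = (gprod t * refl B a)%g]].
Proof.
elim: t => [|x t IH] h; first by constructor 1.
have sub s : {subset s <= t} -> {subset x :: s <= x :: t}.
  by move=> hs y; rewrite !inE => /orP[->//|/hs ->]; rewrite orbT.
case: IH => [y yt|ht|[t' [s1 s2 s3]]|[t' [s1 s2 s3]]].
- by apply: h; rewrite inE yt orbT.
- have [xE|xE] : x = (if odd (size t) then a else b) \/ x = (if odd (size t) then b else a).
    by case: (h x (mem_head _ _)) => ->; case: odd; [left|right|right|left].
  + by constructor 1; rewrite /= -xE -ht.
  + case E: (size t) ht xE => [|k] ht xE.
      constructor 3; exists [::]; split => //; rewrite ht gprod1 gprod_nil.
      by rewrite xE /= reflK.
    constructor 2; exists (alt a b k); split.
    * by move=> y yk; rewrite ht /= !inE yk !orbT.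
    * by rewrite size_alt /= E; lia.
    * rewrite ht /= !gprod_cons xE /=.
      by case: (odd k); rewrite mulgA reflK mul1g.
- constructor 2; exists (x :: t'); split; [exact: sub|by rewrite ltnS|].
  by rewrite !gprod_cons s3.
- constructor 3; exists (x :: t'); split; [exact: sub|by rewrite ltnS|].
  by rewrite !gprod_cons s3 mulgA.
Qed.

(** The Chebyshev polynomials of the second kind U_k and U_(k-1) at [C], with U_(-1) = 0. At
    [- B a b] they are the coefficients of the image of [a] under an alternating word. *)
Fixpoint chebU (C : R) (k : nat) : R * R :=
  if k is k'.+1 then ((2 * C) * (chebU C k').1 - (chebU C k').2, (chebU C k').1)
  else (1, 0).

Lemma alt_act a b k : B a a = 1 -> B b b = 1 ->
  let u := chebU (- B a b) k in
  gprod (alt a b k) a = if odd k then u.2 *: a + u.1 *: b else u.1 *: a + u.2 *: b.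
Proof.
move=> a1 b1; elim: k => [|k] /=.
  by rewrite gprod_nil GL_oneE scale1r scale0r addr0.
rewrite gprod_cons GL_mulE => ->; case: (odd k) => /=; rewrite reflE !formE ?(form_sym b a) ?a1 ?b1 divr1.
  rewrite addrAC; congr (_ + _); rewrite -scalerBl; congr (_ *: _); ring.
rewrite -addrA; congr (_ + _); rewrite -scalerBl; congr (_ *: _); ring.
Qed.

Lemma chebU_ge C k : 1 <= C -> 0 <= (chebU C k).2 <= (chebU C k).1.
Proof.
move=> C1; elim: k => [|k /andP[h1 h2]] /=; first by rewrite lexx ler01.
by apply/andP; split; nra.
Qed.

Lemma chebU_sin (t : R) k : sin t != 0 ->
  chebU (cos t) k = (sin (k.+1%:R * t) / sin t, sin (k%:R * t) / sin t).
Proof.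
move=> t0; elim: k => [|k /= ->] /=; first by rewrite mul1r divff // mul0r sin0 mul0r.
have e j : j.+1%:R * t = j%:R * t + t by rewrite -natr1 mulrDl mul1r.
congr pair; rewrite !e [sin (_ + t + t)]sinD !sinD cosD.
move: (cos2Dsin2 t) t0; move: (sin t) (cos t) (sin (k%:R * t)) (cos (k%:R * t)).
move=> s c x y h s0.
have -> : (x * c + y * s) * c + (y * c - x * s) * s
   = 2 * c * (x * c + y * s) - x * (c ^+ 2 + s ^+ 2) by ring.
by rewrite h; field.
Qed.

(** Minimality leaves only alternating words [alt a b k]. If [B a b] is [- cos (pi / m)], the
    coefficients are quotients of sines, nonnegative while [k < m]; for [k >= m] the braid relation
    shortens the product with the reflection in [a]. If [B a b <= -1], the Chebyshev values are
    nonnegative for every [k]. *)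
Lemma dihedral_pos a b t : a \in P -> b \in P -> a != b ->
  (forall x, x \in t -> x = a \/ x = b) ->
  (forall t' : seq V, {subset t' <= t} -> gprod t' = gprod t -> (size t <= size t')%N) ->
  (forall t' : seq V, {subset t' <= t} -> gprod t' = (gprod t * refl B a)%g ->
     (size t <= size t')%N) ->
  exists x y, [/\ 0 <= x, 0 <= y & gprod t a = x *: a + y *: b].
Proof.
move=> aP bP ab tab min1 min2.
have a1 := unit_root aP; have b1 := unit_root bP.
case: (word2_alt tab) => [tE|[t' [s1 s2 s3]]|[t' [s1 s2 s3]]]; last 2 first.
- by have := min1 _ s1 s3; lia.
- by have := min2 _ s1 s3; lia.
move: (size t) tE => k tE; subst t; rewrite alt_act //.
have fin : forall p q : R, 0 <= p -> 0 <= q -> exists x y : R,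
    [/\ 0 <= x, 0 <= y & (if odd k then q *: a + p *: b else p *: a + q *: b)
                      = x *: a + y *: b].
  by move=> p q p0 q0; case: odd; [exists q, p|exists p, q].
case: (dihedral_form aP bP ab) => [[m m2 Bab]|Bab]; last first.
  have /andP[h1 h2] : 0 <= (chebU (- B a b) k).2 <= (chebU (- B a b) k).1.
    by apply: chebU_ge; lra.
  by apply: fin => //; apply: le_trans h2.
have m0 : (0 : R) < m%:R by rewrite ltr0n; lia.
have th0 : (0 : R) < pi / m%:R by rewrite divr_gt0 // pi_gt0.
have thpi : (pi : R) / m%:R < pi.
  by rewrite gtr_pMr ?pi_gt0 // invf_lt1 // ltr1n.
have s0 : 0 < sin (pi / m%:R : R) by apply: sin_gt0_pi; rewrite th0 thpi.
have sN : sin (pi / m%:R : R) != 0 by rewrite gt_eqF.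
have sj j : (j <= m)%N -> 0 <= sin (j%:R * (pi / m%:R) : R).
  move=> jm; apply: sin_ge0_pi; apply/andP; split.
    by rewrite mulr_ge0 // ltW.
  rewrite mulrCA -[leRHS]mulr1 ler_pM2l ?pi_gt0 //.
  by rewrite ler_pdivrMr // mul1r ler_nat.
rewrite Bab opprK; case: (ltnP k m) => km.
  by rewrite chebU_sin //; apply: fin; apply: divr_ge0; (try exact: ltW); apply: sj => //; apply: ltnW.
case: m m2 m0 Bab th0 thpi s0 sN sj km => // m m2 m0 Bab th0 thpi s0 sN sj km; exfalso.
(* The order is now [m.+1]. The word of length [m] sends [a] to the first letter of [alt a b m.+1],
   so the longer word equals the shorter one times the reflection in [a]. *)
have am : gprod (alt a b m) a = if odd m then a else b.
  rewrite alt_act // Bab opprK chebU_sin //=.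
  have -> : m.+1%:R * (pi / m.+1%:R) = pi :> R by field; rewrite gt_eqF.
  have -> : m%:R * (pi / m.+1%:R) = pi - pi / m.+1%:R :> R.
    by rewrite -[X in _ = X - _](divfK (lt0r_neq0 m0)) -natr1; field; rewrite natr1 gt_eqF.
  rewrite sinpi sinB sinpi cospi !mul0r.
  rewrite sub0r mulN1r opprK divff //.
  by case: odd; rewrite !scale0r !scale1r ?addr0 ?add0r.
have eqm : (gprod (alt a b m.+1) * refl B a)%g = gprod (alt a b m).
  rewrite /= gprod_cons -am refl_conj; last exact: isom_gprod.
  by rewrite mulgVK -mulgA reflK mulg1.
have [p pE sp] := alt_cat a b km.
have : (size (alt a b k) <= size (p ++ alt a b m))%N.
  apply: min2; last by rewrite pE !gprod_cat -mulgA eqm.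
  by move=> x; rewrite pE !mem_cat /= inE => /orP[->|->]; rewrite ?orbT.
by rewrite size_cat sp !size_alt; lia.
Qed.

Definition reduced (I : set V) (s : seq V) :=
  word I s /\ forall t, word I t -> gprod t = gprod s -> (size s <= size t)%N.

Lemma reduced_ex I w : Wg I w -> exists2 s, reduced I s & w = gprod s.
Proof.
move=> [s hs wE].
have ex : exists n, `[< exists t, [/\ word I t, gprod t = w & size t = n] >].
  by exists (size s); apply/asboolP; exists s.
case: (ex_minnP ex) => n /asboolP[t [ht tw tn]] nmin.
exists t => //; split=> // t' ht' e; rewrite tn; apply: nmin.
by apply/asboolP; exists t'; rewrite e.
Qed.

Lemma reduced_cat I s t : reduced I (s ++ t) -> reduced I s /\ reduced I t.
Proof.
move=> [/word_catP[hs ht] h]; split; split=> // u hu e.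
  have /(_ (word_cat hu ht)) := h (u ++ t).
  by rewrite !gprod_cat e => /(_ erefl); rewrite !size_cat leq_add2r.
have /(_ (word_cat hs hu)) := h (s ++ u).
by rewrite !gprod_cat e => /(_ erefl); rewrite !size_cat leq_add2l.
Qed.

Lemma reduced_eq I s t :
  reduced I s -> word I t -> gprod t = gprod s -> size t = size s -> reduced I t.
Proof. by move=> [_ h] ht e se; split=> // u hu eu; rewrite se h // eu. Qed.

Lemma reduced_pos I s a : reduced I s -> a \in P -> I a ->
  (forall t, word I t -> gprod t = (gprod s * refl B a)%g -> (size s <= size t)%N) ->
  cone I (gprod s a).
Proof.
elim/ltn_ind: {s}(size s) {-2}s (erefl (size s)) a => n IH s sn a rs aP Ia mina.
case/lastP: s sn rs mina => [|s b] sn rs mina.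
  by rewrite gprod_nil GL_oneE; exact: cone_gen.
have [ws _] := rs.
have [bP Ib] : b \in P /\ I b by apply: ws; rewrite mem_rcons mem_head.
have ab : a != b.
  apply/negP => /eqP ab; have : (size (rcons s b) <= size s)%N.
    apply: mina; first by move=> x xs; apply: ws; rewrite mem_rcons inE xs orbT.
    by rewrite gprod_rcons -ab -mulgA reflK mulg1.
  by rewrite size_rcons ltnn.
pose dec k := `[< exists v t : seq V, [/\ word I v, (forall x, x \in t -> x = a \/ x = b),
  gprod (v ++ t) = gprod (rcons s b), (size v + size t = n)%N & size t = k] >].
have dec1 : dec 1%N.
  apply/asboolP; exists s, [:: b]; split=> //.
  - by move=> x xs; apply: ws; rewrite mem_rcons inE xs orbT.
  - by move=> x; rewrite inE => /eqP; right.
  - by rewrite cats1.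
  - by rewrite -sn size_rcons addn1.
have decn k : dec k -> (k <= n)%N.
  by move=> /asboolP[v [t [_ _ _ <- <-]]]; rewrite leq_addl.
case: (ex_maxnP (ex_intro _ 1%N dec1) decn) => k /asboolP[v [t [wv tab vt svt tk]]] kmax.
have k1 := kmax _ dec1.
have wt : word I t by move=> x /tab[->|->].
have rvt : reduced I (v ++ t).
  by apply: reduced_eq rs _ vt _; [exact: word_cat|rewrite size_cat svt].
have [rv _] := reduced_cat rvt.
have step c : c = a \/ c = b -> cone I (gprod v c).
  move=> cab; have [cP Ic] : c \in P /\ I c by case: cab => ->.
  apply: (IH (size v)) => //; first by rewrite -svt; lia.
  move=> u wu gu; rewrite leqNgt; apply/negP => lt.
  have e : gprod (u ++ c :: t) = gprod (v ++ t).
    by rewrite !gprod_cat gprod_cons gu -!mulgA (mulgA (refl B c)) reflK mul1g.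
  have wct : word I (c :: t) by exact: word_cons.
  have := rvt.2 _ (word_cat wu wct) e; rewrite !size_cat /= => le.
  have : dec k.+1.
    apply/asboolP; exists u, (c :: t); split=> //=; last by rewrite tk.
    - by move=> x; rewrite inE => /orP[/eqP ->|/tab].
    - by rewrite e.
    - lia.
  by move/kmax; rewrite ltnn.
have subw t' : {subset t' <= t} -> word I t' by move=> h x /h /wt.
have [x [y [x0 y0 E]]] : exists x y, [/\ 0 <= x, 0 <= y & gprod t a = x *: a + y *: b].
  apply: dihedral_pos => //.
  - move=> t' tt e; have := rvt.2 (v ++ t') (word_cat wv (subw _ tt)).
    by rewrite !gprod_cat e => /(_ erefl); rewrite !size_cat leq_add2l.
  - move=> t' tt e; have := mina (v ++ t') (word_cat wv (subw _ tt)).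
    rewrite -vt !gprod_cat e mulgA => /(_ erefl).
    by rewrite size_cat sn -svt leq_add2l.
rewrite -vt gprod_cat GL_mulE E !GL_linE.
by apply: coneD; apply: coneZ => //; apply: step; [left|right].
Qed.

Lemma reduced_prefix_pos I s a t : reduced I (s ++ a :: t) -> cone I (gprod s a).
Proof.
rewrite -cat_rcons => /reduced_cat[r _].
have [w m] := r; have [aP Ia] : a \in P /\ I a by apply: w; rewrite mem_rcons mem_head.
apply: reduced_pos => //; first by have /reduced_cat[] : reduced I (s ++ [:: a]) by rewrite cats1.
move=> u wu gu; have := m u wu; rewrite gprod_rcons gu size_rcons => /(_ erefl); exact: ltnW.
Qed.

Definition root (I : set V) (g : V) := exists w a, [/\ Wg I w, a \in P, I a & g = w a].

Lemma root_unit I g : root I g -> B g g = 1.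
Proof. by move=> [w [a [hw aP _ ->]]]; rewrite (Wg_isom hw) unit_root. Qed.

Lemma root_sub I J g : I `<=` J -> root I g -> root J g.
Proof.
by move=> IJ [w [a [hw aP /IJ Ia ->]]]; exists w, a; split=> //; exact: Wg_sub hw.
Qed.

Lemma root_Wg I w g : Wg I w -> root I g -> root I (w g).
Proof.
move=> hw [u [a [hu aP Ia ->]]]; exists (w * u)%g, a; split=> //; first exact: WgM.
by rewrite GL_mulE.
Qed.

Lemma root_gen I a : a \in P -> I a -> root I a.
Proof. by move=> aP Ia; exists 1%g, a; rewrite GL_oneE; split=> //; exact: Wg1. Qed.

Lemma refl_self a : a \in P -> refl B a a = - a.
Proof.
by move=> aP; rewrite reflE unit_root // divr1 mulr1 scaler_nat mulr2n opprD addrA subrr add0r.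
Qed.

Lemma root_sign I g : root I g -> cone I g \/ cone I (- g).
Proof.
move=> [w [a [hw aP Ia ->]]]; have [s rs ->] := reduced_ex hw.
have [min|] := pselect (forall t, word I t -> gprod t = (gprod s * refl B a)%g ->
  (size s <= size t)%N); first by left; exact: reduced_pos.
move=> /existsNP[t /not_implyP[wt /not_implyP[gt /negP]]]; rewrite -ltnNge => lt.
right.
have [u ru gu] := reduced_ex (ex_intro2 _ _ t wt erefl : Wg I (gprod t)).
have -> : - gprod s a = gprod u a.
  by rewrite -gu gt GL_mulE refl_self // GL_linE.
have ut : (size u <= size t)%N by apply: ru.2.
apply: reduced_pos => // v wv gv.
suff : (size s <= size v)%N by move: lt ut; lia.
by apply: rs.2 => //; rewrite gv -gu gt -mulgA reflK mulg1.
Qed.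

Lemma root_sign_excl I J g : B g g = 1 -> cone I g -> cone J (- g) -> False.
Proof.
move=> g1 hI hJ; have /eqP := @cone_antisym setT g (cone_sub (@subsetT _ _) hI)
  (cone_sub (@subsetT _ _) hJ).
by move=> /eqP g0; move: g1; rewrite g0 form0l => /esym/eqP; rewrite oner_eq0.
Qed.

(** The two expansions add up to a relation whose only coefficient of unknown sign is [r], at [a].
    If [0 <= r] it is trivial and [g] is a multiple of [a]; if [r < 0], pairing with [a] makes [r]
    equal to a nonnegative number. *)
Lemma refl_neg_simple g a : B g g = 1 -> cone setT g -> a \in P ->
  cone setT (- refl B a g) -> g = a.
Proof.
move=> g1 [c [c0 _ gc]] aP [d [d0 _]]; rewrite reflE unit_root // divr1.
set x := 2 * _ => e.
pose r := c a + d a - x.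
pose f b := if b == a then r else c b + d b.
have f0 : lc f = 0.
  have -> : lc f = g + lc d - x *: a.
    rewrite -[X in x *: X](lc_dlt aP) gc lcD lcZ lcB; apply: eq_lc => b _.
    by rewrite /f /dlt; case: eqP => [->|_]; rewrite /r ?mulr1 ?mulr0 ?subr0.
  by rewrite -e opprB addrCA subrr addr0 subrr.
have [r0|r0] := leP 0 r.
  have fn : nonneg f by move=> b; rewrite /f; case: ifP => // _; rewrite addr_ge0.
  have h := pos_indep fn f0.
  have gE : g = c a *: a.
    rewrite gc -[X in _ *: X](lc_dlt aP) lcZ; apply: eq_lc => b bP; rewrite /dlt.
    have [->|ba] := eqVneq b a; first by rewrite mulr1.
    rewrite mulr0.
    have := h b bP; rewrite /f (negbTE ba) => /eqP; rewrite paddr_eq0 //.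
    by case/andP => /eqP.
  move: g1; rewrite gE formZl formZr unit_root // mulr1 => /eqP.
  rewrite -expr2 sqrf_eq1 => /orP[/eqP ->|/eqP ca]; first by rewrite scale1r.
  by have := c0 a; rewrite ca oppr_ge0 ler10.
have := form_lcl f a; rewrite f0 form0l => /esym.
rewrite (bigD1_seq a) ?uP //= {1}/f eqxx unit_root // mulr1 => /eqP.
rewrite addr_eq0 => /eqP rE; exfalso.
have : \sum_(i <- P | i != a) f i * B i a <= 0.
  rewrite big_seq_cond; apply: sumr_le0 => b /andP[bP ba].
  by rewrite mulr_ge0_le0 ?form_le0 // /f (negbTE ba) addr_ge0.
by lra.
Qed.

(** As letters are peeled off, the root turns negative at some letter and by [refl_neg_simple]
    equals that letter there. This is the exchange condition for roots, and the word need not be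
    reduced. *)
Lemma crossing I s g : word I s -> root setT g -> cone setT g ->
  cone setT (- (gprod s)^-1%g g) ->
  exists u a v, s = u ++ a :: v /\ g = gprod u a.
Proof.
elim: s g => [|a s IH] g.
  rewrite gprod_nil invg1 GL_oneE => _ rg h1 h2.
  by case: (root_sign_excl (root_unit rg) h1 h2).
move=> /word_consP[aP Ia ws] rg pg; rewrite gprod_cons invgM reflV GL_mulE => ng.
have rg' : root setT (refl B a g) by apply: root_Wg rg; exact: Wg_refl.
case: (root_sign rg') => h.
  have [u [b [v [sE gE]]]] := IH _ ws rg' h ng.
  exists (a :: u), b, v; split; first by rewrite sE.
  by rewrite gprod_cons GL_mulE -gE -GL_mulE reflK GL_oneE.
exists [::], a, s; split => //; rewrite gprod_nil GL_oneE.
exact: refl_neg_simple (root_unit rg) pg aP h.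
Qed.

Lemma Wg_weyl I w : generated (refl B @` (I `&` [set` P])) w <-> Wg I w.
Proof.
split.
  move=> h; apply: (h [set w | Wg I w]); split.
    split; first by rewrite inE; exact: Wg1.
    by move=> x y; rewrite !inE => hx hy; apply: WgM => //; exact: WgV.
  by move=> _ [a [Ia aP] <-]; exact: Wg_refl.
move=> [s hs ->] H [[H1 HD] HS].
have HM x y : H x -> H y -> H (x * y)%g.
  move=> hx hy; have /HD : (1%g : GL V) \in mem H by [].
  move=> /(_ y); rewrite !inE => /(_ hy) hy1.
  by have := HD x (1 / y)%g; rewrite !inE div1g invgK; apply=> //; rewrite -div1g.
elim: s hs => [|a s IH]; first by move: H1; rewrite gprod_nil inE.
move=> /word_consP[aP Ia ws]; rewrite gprod_cons; apply: HM; last exact: IH.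
by apply: HS; exists a.
Qed.

Lemma is_wordE I w n : is_word (refl B @` (I `&` [set` P])) w n <->
  exists s, [/\ word I s, gprod s = w & size s = n].
Proof.
split.
  move=> [l [<- hl ->]].
  elim: l hl => [|x l IH] hl.
    by exists [::]; split => //; rewrite gprod_nil big_nil.
  have [|s [ws gs ss]] := IH; first by move=> y yl; apply: hl; rewrite inE yl orbT.
  have [a [Ia aP] xa] := hl x (mem_head _ _).
  exists (a :: s); split=> /=; last by rewrite ss.
    exact: word_cons.
  by rewrite gprod_cons gs big_cons xa.
move=> [s [ws <- <-]]; exists (map (refl B) s); split; first by rewrite size_map.
  by move=> x /mapP[a /ws[aP Ia] ->]; exists a.
by rewrite /gprod big_map.
Qed.

Lemma coxlen_reduced I s : reduced I s ->
  coxlen (refl B @` (I `&` [set` P])) (gprod s) = size s.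
Proof.
move=> [ws ms]; rewrite /coxlen.
have min m : is_word (refl B @` (I `&` [set` P])) (gprod s) m -> (size s <= m)%N.
  by move=> /is_wordE[t [wt gt <-]]; exact: ms.
case: xgetP => [n -> [hn mn]|/(_ (size s))[]].
  apply/eqP; rewrite eqn_leq min // mn //.
  by apply/is_wordE; exists s.
by split=> //; apply/is_wordE; exists s.
Qed.


(** * Length and inversions *)

Local Notation S := (refl B @` [set` P]).
Local Notation len := (coxlen S).

Lemma len_reduced s : reduced setT s -> len (gprod s) = size s.
Proof. by move=> /coxlen_reduced; rewrite setTI. Qed.

Lemma len_word s : word setT s -> (len (gprod s) <= size s)%N.
Proof.
move=> ws; have [t rt e] := reduced_ex (ex_intro2 _ _ s ws erefl : Wg setT (gprod s)).
by rewrite e len_reduced //; apply: rt.2.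
Qed.

Lemma len_refl_lt w g : Wg setT w -> root setT g -> cone setT g ->
  cone setT (- w^-1%g g) -> (len (refl B g * w)%g < len w)%N.
Proof.
move=> hw rg pg ng; have [s rs ws] := reduced_ex hw; rewrite ws in ng *.
have [u [a [v [sE gE]]]] := crossing rs.1 rg pg ng.
have -> : (refl B g * gprod s)%g = gprod (u ++ v).
  rewrite gE refl_conj; last exact: isom_gprod.
  by rewrite sE !gprod_cat gprod_cons !mulgA mulgVK -(mulgA (gprod u)) reflK mulg1.
rewrite (len_reduced rs) (@leq_ltn_trans (size (u ++ v))) //.
  apply: len_word.
  move: rs.1; rewrite sE => /word_catP[wu /word_consP[_ _ wv]]; exact: word_cat.
by rewrite sE !size_cat /=; lia.
Qed.

(** Turns the length condition in [inversions] into a sign. If the image of [g] under [w^-1] were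
    positive, [len_refl_lt] for [refl B g * w] would reverse the inequality. *)
Lemma len_reflE w g : Wg setT w -> root setT g -> cone setT g ->
  (len (refl B g * w)%g < len w)%N <-> cone setT (- w^-1%g g).
Proof.
move=> hw rg pg; split; last exact: len_refl_lt.
have hr : root setT (w^-1%g g) by apply: root_Wg rg; exact: WgV.
case: (root_sign hr) => // h lt.
have hg : Wg setT (refl B g).
  case: rg => [u [a [hu aP _ ->]]]; rewrite refl_conj; last exact: Wg_isom hu.
  by apply: WgM; [apply: WgM => //; exact: Wg_refl|exact: WgV].
have := @len_refl_lt (refl B g * w)%g g (WgM hg hw) rg pg.
rewrite mulgA reflK mul1g => h2; have : (len w < len w)%N; last by rewrite ltnn.
apply: ltn_trans lt; apply: h2; rewrite invgM reflV GL_mulE.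
suff -> : refl B g g = - g by rewrite GL_linE opprK.
by rewrite reflE (root_unit rg) divr1 mulr1 scaler_nat mulr2n opprD addrA subrr add0r.
Qed.

(** * Farkas' lemma and the finite components *)

Definition linform (F : lmodType R) (f : F -> R) :=
  forall k u v, f (k *: u + v) = k * f u + f v.

(** Stated over any module because it serves both for [V] and for spaces of coefficient
    functions. *)
Lemma farkas (F : lmodType R) (T : eqType) (s : seq T) (a : T -> F -> R) (b : F -> R) :
  uniq s -> (forall t, linform (a t)) -> linform b ->
  (exists c : T -> R, (forall t, t \in s -> 0 <= c t) /\
     forall f, b f = \sum_(t <- s) c t * a t f) \/
  (exists f, (forall t, t \in s -> 0 <= a t f) /\ b f < 0).
Proof.
elim: s a b => [|t0 s IH] a b.
  move=> _ _ hb; have [h|/existsNP[f /eqP h]] := pselect (forall f, b f = 0).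
    by left; exists (fun=> 0); split => // f; rewrite big_nil h.
  right; have [bf|bf] := ltP (b f) 0; first by exists f.
  exists (- f); split => //.
  have b0 : b 0 = 0 by have := hb (-1) 0 0; rewrite scaler0 addr0; lra.
  have := hb (-1) f 0; rewrite addr0 b0 addr0 scaleN1r mulN1r => ->.
  by rewrite oppr_lt0 lt_neqAle eq_sym h bf.
move=> /andP[t0s us] ha hb; case: (IH a b us ha hb) => [[c [c0 hc]]|[f [fs bf]]].
  left; exists (fun t => if t == t0 then 0 else c t); split.
    by move=> t; rewrite inE; case: eqP => //= _ /c0.
  move=> f; rewrite big_cons eqxx mul0r add0r hc; apply: eq_big_seq => t ts.
  by case: eqP => // E; move: t0s; rewrite -E ts.
have [af|af] := leP 0 (a t0 f).
  by right; exists f; split => // t; rewrite inE => /orP[/eqP ->|/fs].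
have afN : a t0 f != 0 by rewrite lt_eqF.
(* These multiples of [a t0] make the corrected forms vanish at [f], so a later witness can be moved
   along [f] into the kernel of [a t0]. They are nonnegative, so a certificate for the corrected
   forms unwinds to one for the original forms. *)
pose la t := - a t f / a t0 f; pose mu := b f / a t0 f.
have la0 t : t \in s -> 0 <= la t.
  by move=> /fs h; rewrite /la mulNr oppr_ge0 mulr_ge0_le0 // invr_le0 ltW.
have mu0 : 0 <= mu by rewrite /mu mulr_le0 ?invr_le0 // ltW.
pose a' t g := a t g + la t * a t0 g; pose b' g := b g - mu * a t0 g.
have ha' t : linform (a' t) by move=> k u v; rewrite /a' !ha; ring.
have hb' : linform b' by move=> k u v; rewrite /b' ha hb; ring.
case: (IH a' b' us ha' hb') => [[c [c0 hc]]|[g [gs bg]]]; [left|right].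
  exists (fun t => if t == t0 then \sum_(t <- s) c t * la t + mu else c t); split.
    move=> t; rewrite inE; case: eqP => //= _; last exact: c0.
    move=> _; rewrite addr_ge0 // big_seq sumr_ge0 // => u us'.
    by rewrite mulr_ge0 ?c0 ?la0.
  move=> g; rewrite big_cons eqxx.
  have -> : \sum_(j <- s) (if j == t0 then \sum_(t <- s) c t * la t + mu else c j) * a j g
     = \sum_(j <- s) c j * a j g.
    by apply: eq_big_seq => t ts; case: eqP => // E; move: t0s; rewrite -E ts.
  have := hc g; rewrite /b' /a' => e.
  have {e} -> : b g = \sum_(t <- s) c t * (a t g + la t * a t0 g) + mu * a t0 g.
    by rewrite -e subrK.
  have -> : \sum_(t <- s) c t * (a t g + la t * a t0 g) =
      \sum_(t <- s) c t * a t g + (\sum_(t <- s) c t * la t) * a t0 g.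
    by rewrite mulr_suml -big_split; apply: eq_bigr => t _ /=; ring.
  by ring.
pose k := a t0 g / a t0 f.
have fE h : linform h -> h (g - k *: f) = h g - k * h f.
  by move=> hl; rewrite -scaleNr addrC hl; ring.
exists (g - k *: f); split.
  move=> t; rewrite inE fE // => /orP[/eqP ->|ts]; first by rewrite /k divfK // subrr.
  by have := gs t ts; rewrite /a' /la /k; congr (0 <= _); field.
by rewrite fE //; move: bg; rewrite /b' /mu /k; congr (_ < 0); field.
Qed.

Lemma combine (E : nmodType) (T : eqType) (s : seq T) (Q : E -> Prop) (f : T -> E -> R) :
  Q 0 -> (forall u v, Q u -> Q v -> Q (u + v)) ->
  (forall a u v, f a (u + v) = f a u + f a v) ->
  (forall a u, a \in s -> Q u -> 0 <= f a u) ->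
  (forall a, a \in s -> exists2 u, Q u & 0 < f a u) ->
  exists2 u, Q u & forall a, a \in s -> 0 < f a u.
Proof.
move=> Q0 QD fD; elim: s => [|a s IH] fge ex; first by exists 0.
have [u Qu us] : exists2 u, Q u & forall a, a \in s -> 0 < f a u.
  by apply: IH => [b v bs|b bs]; [apply: fge|apply: ex]; rewrite inE bs orbT.
have [v Qv va] := ex a (mem_head _ _).
exists (u + v); first exact: QD.
move=> b; rewrite inE fD => /orP[/eqP ->|bs].
  by rewrite ltr_wpDl // fge // mem_head.
by rewrite ltr_pwDl ?us // fge // inE bs orbT.
Qed.

Lemma finite_lb (T : eqType) (s : seq T) (g : T -> R) :
  (forall a, a \in s -> 0 < g a) -> exists2 e, 0 < e & forall a, a \in s -> e <= g a.
Proof.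
elim: s => [|a s IH] h; first by exists 1.
have [b bs|e e0 he] := IH; first by apply: h; rewrite inE bs orbT.
exists (Num.min e (g a)); first by rewrite lt_min e0 h ?mem_head.
move=> b; rewrite inE ge_min => /orP[/eqP ->|/he ->//]; by rewrite lexx orbT.
Qed.

Lemma linform_form x : linform (B x).
Proof. by move=> k u v; rewrite !formE. Qed.

Lemma dual_chamber v :
  (forall c, (forall a, a \in P -> 0 <= B a c) -> 0 <= B v c) -> cone setT v.
Proof.
move=> h; have [[c [c0 vc]]|[f [f0 vf]]] :=
    farkas uP linform_form (linform_form v); last first.
  by have := h f f0; rewrite leNgt vf.
exists (fun a => if a \in P then c a else 0); split => //.
  by move=> a; case: ifP => // /c0.
apply/eqP; rewrite -subr_eq0; apply/eqP/form_nondegenerate => y.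
rewrite formDl formNl vc form_lcl; apply/eqP; rewrite subr_eq0; apply/eqP.
by apply: eq_big_seq => a ->.
Qed.

Lemma interior_ex : exists rho, forall a, a \in P -> 1 <= B rho a.
Proof.
have [rho h0 h] : exists2 rho, (forall a, a \in P -> 0 <= B a rho) &
    forall a, a \in P -> 0 < B a rho.
  apply: (combine (Q := fun c => forall a, a \in P -> 0 <= B a c)).
  - by move=> a _; rewrite form0r.
  - by move=> u v hu hv a aP; rewrite formDr addr_ge0 ?hu ?hv.
  - by move=> a u v; rewrite formDr.
  - by move=> a u aP; apply.
  move=> a aP; have [[c [c0 vc]]|[f [f0 vf]]] :=
    farkas uP linform_form (linform_form (- a)); last first.
    by exists f => //; move: vf; rewrite formNl oppr_lt0.
  (* Adding [a] to the certificate for [- a] gives a nonnegative relation with coefficient at least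
     1 at [a]. *)
  exfalso; pose d x := if x \in P then c x + dlt a x else 0.
  have d0 : nonneg d.
    by move=> x; rewrite /d; case: ifP => // /c0 cx; rewrite addr_ge0 // ler0n.
  have e : lc d = 0.
    apply/form_nondegenerate => y.
    have -> : lc d = lc c + a.
      rewrite -[X in _ + X](lc_dlt aP) lcD; apply: eq_lc => x xP.
      by rewrite /d xP.
    rewrite formDl form_lcl -vc formNl addrC subrr //.
  have := pos_indep d0 e aP; rewrite /d aP /dlt eqxx => /eqP.
  by rewrite paddr_eq0 ?c0 // oner_eq0 andbF.
have [e e0 he] := finite_lb h.
exists (e^-1 *: rho) => a aP; rewrite formZl mulrC ler_pdivlMr // mul1r form_sym.
exact: he.
Qed.

(** * The cones K of parabolic subgroups and the splitting into components *)

Definition Kc (I : set V) : set V :=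
  [set k | cone I k /\ forall a, a \in P -> I a -> B k a <= 0].

Lemma form_cone_off I k a : cone I k -> a \in P -> ~ I a -> B k a <= 0.
Proof.
move=> h aP Ia; apply: form_cone_le0 h => b bP Ib; apply: form_le0 => //.
by apply/negP => /eqP e; apply: Ia; rewrite -e.
Qed.

Lemma Kc_le0 I k a : Kc I k -> a \in P -> B k a <= 0.
Proof.
move=> [h1 h2] aP; have [|Ia] := pselect (I a); first exact: h2.
exact: form_cone_off h1 aP Ia.
Qed.

Lemma Kc_sub I J k : I `<=` J -> Kc I k -> Kc J k.
Proof.
move=> IJ hk; split; first by case: hk => h _; exact: cone_sub h.
by move=> a aP _; exact: Kc_le0 hk aP.
Qed.

Lemma KcD I u v : Kc I u -> Kc I v -> Kc I (u + v).
Proof.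
move=> [u1 u2] [v1 v2]; split; first exact: coneD.
by move=> a aP Ia; rewrite formDl -[leRHS]addr0 lerD ?u2 ?v2.
Qed.

Lemma KcZ I k u : 0 <= k -> Kc I u -> Kc I (k *: u).
Proof.
move=> k0 [u1 u2]; split; first exact: coneZ.
by move=> a aP Ia; rewrite formZl mulr_ge0_le0 ?u2.
Qed.

Lemma Kc0 I : Kc I 0.
Proof. by split; [exact: cone0|move=> a _ _; rewrite form0l]. Qed.

(* [infI I] is the set of all simple roots that occur in an element of [Kc I]: the
   union of the infinite irreducible components of the Coxeter graph of [I]. *)
Definition infI (I : set V) : set V :=
  [set a | a \in P /\ exists c, [/\ nonneg c, supp_in I c, Kc I (lc c) & 0 < c a]].

Lemma infI_sub I : infI I `<=` I.
Proof. by move=> a [_ [c [_ cI _ ca]]]; apply: cI; rewrite gt_eqF. Qed.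

Lemma infI_supp I c : nonneg c -> supp_in I c -> Kc I (lc c) -> 
  (forall a, c a != 0 -> a \in P) -> supp_in (infI I) c.
Proof.
move=> c0 cI ck cP a ca; split; first exact: cP.
by exists c; split => //; rewrite lt_neqAle eq_sym ca c0.
Qed.

Definition fsupp (I : set V) (c : V -> R) :=
  [/\ nonneg c, supp_in I c & forall a, a \in P -> I a -> 0 < c a].

Lemma infI_full I : exists2 c, fsupp (infI I) c & Kc I (lc c).
Proof.
pose L := [seq a <- P | `[< infI I a >]].
have LP a : (a \in L) = (a \in P) && `[< infI I a >] by rewrite mem_filter andbC.
pose Q (c : V -> R) := [/\ nonneg c, supp_in (infI I) c & Kc I (lc c)].
have [||//|||c [c0 cI ck] h] := @combine (V -> R) V L Q (fun a c => c a).
- split => //; first by move=> a; rewrite eqxx.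
  have -> : lc 0 = 0 by exact: lc0.
  exact: Kc0.
- move=> u v [u0 uI uk] [v0 vI vk]; split.
  + by move=> a; rewrite addr_ge0.
  + move=> a h; case: (eqVneq (u a) 0) => [e|/uI//].
    by apply: vI; move: h; rewrite (_ : (u + v) a = v a) // -[RHS]add0r -e.
  + have -> : lc (u + v) = lc u + lc v by rewrite lcD.
    exact: KcD.
- by move=> a u _ [].
- move=> a; rewrite LP => /andP[aP /asboolP[_ [c [c0 cI ck ca]]]].
  exists (fun x => if x \in P then c x else 0); last by rewrite aP.
  have e : lc (fun x => if x \in P then c x else 0) = lc c by apply: eq_lc => x ->.
  have n0 : nonneg (fun x => if x \in P then c x else 0) by move=> x; case: ifP.
  split => //; last by rewrite e.
  apply: infI_supp => //; last by move=> x; case: ifP => //; rewrite eqxx.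
    by move=> x; case: ifP => [_ /cI//|]; rewrite eqxx.
  by rewrite e.
exists c => //; split => // a aP aI; apply: h; rewrite LP aP; exact/asboolP.
Qed.

(** Otherwise an element of K with full support on the infinite part is strictly negative on [a].
    Adding the multiple of [a] that makes this product zero keeps it in K and brings [a] into its
    support. *)
Lemma infI_perp I a j : a \in P -> I a -> ~ infI I a -> j \in P -> infI I j ->
  B a j = 0.
Proof.
move=> aP Ia na jP Ij; apply/eqP/negPn/negP => aj.
have neq x : x \in P -> infI I x -> a != x.
  by move=> _ hx; apply/negP => /eqP e; apply: na; rewrite e.
have [c [c0 cI cp] ck] := infI_full I.
have ca : B (lc c) a < 0.
  rewrite form_lcl (bigD1_seq j) ?uP //=.
  have jneg : c j * B j a < 0.
    rewrite pmulr_rlt0 ?cp // form_sym lt_neqAle aj form_le0 //; exact: neq.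
  apply: ltr_wnDr jneg; rewrite big_seq_cond sumr_le0 // => x /andP[xP _].
  case: (eqVneq (c x) 0) => [->|/cI hx]; first by rewrite mul0r.
  by rewrite mulr_ge0_le0 // form_sym form_le0 // neq.
pose e := - B (lc c) a; have e0 : 0 < e by rewrite oppr_gt0.
apply: na; split => //; exists (fun x => c x + e * dlt a x); split.
- by move=> x; rewrite addr_ge0 // mulr_ge0 ?ler0n // ltW.
- move=> x; rewrite /dlt; have [->//|xa] := eqVneq x a.
  by rewrite mulr0 addr0 => /cI /infI_sub.
- have -> : lc (fun x => c x + e * dlt a x) = lc c + e *: a.
    by rewrite -lcD -lcZ lc_dlt.
  split.
    apply: coneD; first by case: ck.
    by apply: coneZ; [exact: ltW|exact: cone_gen].
  move=> x xP Ix; rewrite formDl formZl.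
  have [->|xa] := eqVneq x a; first by rewrite unit_root // mulr1 /e subrr.
  have h1 := Kc_le0 ck xP; have h2 : B a x <= 0 by rewrite form_le0 // eq_sym.
  by nra.
- by rewrite /dlt eqxx mulr1 ltr_wpDl.
Qed.

(** Farkas' lemma is applied to coefficient functions for each [j] in the complement: if no
    nonnegative [d] supported there has nonnegative products with it and a positive one with [j],
    the certificate is an element of K with [j] in its support. Positive products force positive
    coefficients, since off-diagonal products are nonpositive. *)
Lemma infI_compl I : exists2 d, fsupp (I `\` infI I) d &
  forall a, a \in P -> I a -> ~ infI I a -> 0 < B (lc d) a.
Proof.
pose D := I `\` infI I.
pose L := [seq a <- P | `[< D a >]].
have LP a : (a \in L) = (a \in P) && `[< D a >] by rewrite mem_filter andbC.
have uL : uniq L by rewrite filter_uniq ?uP.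
have cutE (f : V -> R) a : B (lc (fun x => if x \in L then f x else 0)) a
    = \sum_(x <- L) f x * B x a.
  rewrite form_lcl big_filter [RHS]big_mkcond; apply: eq_big_seq => x xP.
  by rewrite LP xP /=; case: ifP; rewrite ?mul0r.
pose Q (d : V -> R) := [/\ nonneg d, supp_in D d, forall a, d a != 0 -> a \in P &
  forall a, a \in L -> 0 <= B (lc d) a].
have [||||j jL|d [d0 dD dP _] h] := @combine (V -> R) V L Q (fun a c => B (lc c) a).
- split => // a; rewrite ?eqxx //.
  have -> : lc 0 = 0 by exact: lc0.
  by rewrite form0l.
- move=> u v [u0 uI uP' uk] [v0 vI vP' vk]; split.
  + by move=> a; rewrite addr_ge0.
  + move=> a h; case: (eqVneq (u a) 0) => [e|/uI//].
    by apply: vI; move: h; rewrite (_ : (u + v) a = v a) // -[RHS]add0r -e.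
  + move=> a h; case: (eqVneq (u a) 0) => [e|/uP'//].
    by apply: vP'; move: h; rewrite (_ : (u + v) a = v a) // -[RHS]add0r -e.
  + move=> a aL; have -> : lc (u + v) = lc u + lc v by rewrite lcD.
    by rewrite formDl addr_ge0 ?uk ?vk.
- move=> a u v; have -> : lc (u + v) = lc u + lc v by rewrite lcD.
  exact: formDl.
- by move=> a u aL [_ _ _]; apply.
- have /andP[jP /asboolP Dj] : (j \in P) && `[< D j >] by rewrite -LP.
  pose A a (f : V -> R^o) : R := \sum_(x <- L) f x * B x a.
  (* The left copy of [V] indexes the constraints on coefficients, the right copy those on
     products. *)
  pose aa (t : V + V) (f : V -> R^o) : R :=
    match t with inl x => f x | inr x => A x f end.
  have hA x : linform (A x).
    move=> k u v; rewrite /A mulr_sumr -big_split; apply: eq_bigr => y _ /=.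
    by rewrite mulrDl -mulrA.
  have haa t : linform (aa t) by case: t.
  have hb : linform (fun f => - A j f) by move=> k u v; rewrite hA; ring.
  pose s : seq (V + V) := map inl L ++ map inr L.
  have us : uniq s.
    rewrite cat_uniq !map_inj_uniq ?uL //=; try by move=> x y [].
    by rewrite andbT; apply/hasPn => _ /mapP[x _ ->]; apply/negP => /mapP[].
  case: (farkas us haa hb) => [[q [q0 hq]]|[f [f0 fj]]].
    exfalso.
    (* The multipliers of the product constraints, plus one at [j], give an element whose products
       on [L] are minus the multipliers of the coefficient constraints. *)
    pose e x := if x \in L then q (inr x) + dlt j x else 0.
    have e0 : nonneg e.
      move=> x; rewrite /e; case: ifP => // xL; rewrite addr_ge0 ?ler0n //.
      by apply: q0; rewrite mem_cat map_f ?orbT.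
    have eD : supp_in D e.
      move=> x; rewrite /e LP; case: ifP; last by rewrite eqxx.
      by move=> /andP[_ /asboolP].
    have eL y : y \in L -> B (lc e) y <= 0.
      move=> yL; have := hq (dlt y : V -> R^o).
      have pick (h : V -> R) : \sum_(x <- L) dlt y x * h x = h y.
        rewrite (bigD1_seq y) //= big1 ?addr0 /dlt ?eqxx ?mul1r // => x /negbTE ->.
        by rewrite mul0r.
      rewrite /s big_cat !big_map /=.
      have -> : A j (dlt y : V -> R^o) = B y j by rewrite /A pick.
      have -> : \sum_(x <- L) q (inl x) * dlt y x = q (inl y).
        by rewrite -(pick (fun x => q (inl x))); apply: eq_bigr => x _; rewrite mulrC.
      have -> : \sum_(x <- L) q (inr x) * A x (dlt y : V -> R^o) =
                \sum_(x <- L) q (inr x) * B x y.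
        by apply: eq_bigr => x _; rewrite /A pick form_sym.
      rewrite cutE => E.
      have -> : \sum_(x <- L) (q (inr x) + dlt j x) * B x y =
         \sum_(x <- L) q (inr x) * B x y + B y j.
        rewrite [B y j]form_sym.
        have <- : \sum_(x <- L) dlt j x * B x y = B j y.
          rewrite (bigD1_seq j) //= big1 ?addr0 /dlt ?eqxx ?mul1r // => x /negbTE ->.
          by rewrite mul0r.
        by rewrite -big_split; apply: eq_bigr => x _; rewrite mulrDl.
      have : 0 <= q (inl y) by apply: q0; rewrite mem_cat map_f.
      by move: E; lra.
    apply: Dj.2; split => //; exists e; split => //.
    - by move=> x /eD[].
    - split; first by exists e; split => // x /eD[].
      move=> y yP Iy; have [hy|hy] := pselect (infI I y).
        have : cone D (lc e) by exists e.
        by move=> /form_cone_off; apply=> // -[].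
      by apply: eL; rewrite LP yP; apply/asboolP.
    - rewrite /e jL /dlt eqxx ltr_wpDl // q0 // mem_cat map_f ?orbT //.
  pose d x := if x \in L then f x else 0.
  exists d; last by rewrite cutE -oppr_lt0.
  split.
  - by move=> x; rewrite /d; case: ifP => // xL; apply: (f0 (inl x)); rewrite mem_cat map_f.
  - move=> x; rewrite /d LP; case: ifP; last by rewrite eqxx.
    by move=> /andP[_ /asboolP].
  - move=> x; rewrite /d LP; case: ifP; last by rewrite eqxx.
    by move=> /andP[].
  - by move=> x xL; rewrite cutE; apply: (f0 (inr x)); rewrite mem_cat map_f ?orbT.
have hD a : a \in P -> D a -> 0 < B (lc d) a.
  by move=> aP Da; apply: h; rewrite LP aP; apply/asboolP.
exists d; last by move=> a aP Ia na; apply: hD.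
split => // a aP Da; have := hD a aP Da.
rewrite form_lcl (bigD1_seq a) ?uP //= unit_root // mulr1.
have : \sum_(i <- P | i != a) d i * B i a <= 0.
  rewrite big_seq_cond sumr_le0 // => x /andP[xP xa].
  by rewrite mulr_ge0_le0 // form_le0.
by lra.
Qed.

Lemma form_lc_le c a : nonneg c -> a \in P -> B (lc c) a <= c a.
Proof.
move=> c0 aP; rewrite form_lcl (bigD1_seq a) ?uP //= unit_root // mulr1.
rewrite -[leRHS]addr0 lerD2l big_seq_cond sumr_le0 // => x /andP[xP xa].
by rewrite mulr_ge0_le0 // form_le0.
Qed.

Definition height_fun (rho : V) := forall a, a \in P -> 1 <= B rho a.

(** Let [S] be the coefficient sum. The product of [g] with a simple root is at most its
    coefficient, hence at most [S], so [B g g = 1] gives [1 <= S * S]. This uniform bound replaces a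
    discreteness argument for the roots. *)
Lemma root_height rho g : height_fun rho -> root setT g -> cone setT g -> 1 <= B rho g.
Proof.
move=> hr rg [c [c0 _ gE]]; have g1 := root_unit rg.
pose S := \sum_(a <- P) c a.
have S0 : 0 <= S by apply: sumr_ge0 => a _; exact: c0.
have cS a : a \in P -> c a <= S.
  move=> aP; rewrite /S (bigD1_seq a) ?uP //= lerDl sumr_ge0 // => x _; exact: c0.
have S1 : 1 <= S.
  have : B g g <= S * S.
    rewrite {1}gE form_lcl {1}/S mulr_suml big_seq [leRHS]big_seq.
    apply: ler_sum => a aP; rewrite ler_wpM2l // form_sym gE.
    by apply: le_trans (form_lc_le c0 aP) (cS a aP).
  by rewrite g1; nra.
apply: le_trans S1 _; rewrite gE form_lcr /S big_seq [leRHS]big_seq.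
by apply: ler_sum => a aP; rewrite ler_peMr ?c0 ?hr.
Qed.

Lemma height_cone_ge0 rho I v : height_fun rho -> cone I v -> 0 <= B rho v.
Proof.
move=> hr hv; rewrite form_sym; apply: form_cone_ge0 hv => a aP _.
by rewrite form_sym (le_trans _ (hr a aP)).
Qed.

(** The sum telescopes: each letter [a] adds [- 2 * B k a] times its image under the prefix before
    it, which is positive in a reduced word. *)
Lemma reduced_sub_cone I s k : reduced I s ->
  (forall a, a \in P -> I a -> B k a <= 0) -> cone I (gprod s k - k).
Proof.
move=> rs hk; elim/last_ind: s rs => [|s a IH] rs.
  by rewrite gprod_nil GL_oneE subrr; exact: cone0.
have [aP Ia] : a \in P /\ I a by apply: rs.1; rewrite mem_rcons mem_head.
have pos : cone I (gprod s a).
  by apply: (@reduced_prefix_pos I s a [::]); rewrite cats1.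
have [rs' _] : reduced I s /\ reduced I [:: a].
  by apply: reduced_cat; rewrite cats1.
rewrite gprod_rcons GL_mulE reflE GL_linB GL_linZ unit_root // divr1 addrAC -scaleNr.
apply: coneD; first exact: IH.
by apply: coneZ pos; rewrite -mulrN mulr_ge0 // oppr_ge0 hk.
Qed.

Lemma reduced_growth rho c0 I s k : height_fun rho -> reduced I s -> 0 <= c0 ->
  (forall a, a \in P -> I a -> B k a <= - c0) ->
  B rho k + 2 * c0 * (size s)%:R <= B rho (gprod s k).
Proof.
move=> hr + c00 hk; elim/last_ind: s => [|s a IH] rs.
  by rewrite gprod_nil GL_oneE mulr0 addr0.
have [aP Ia] : a \in P /\ I a by apply: rs.1; rewrite mem_rcons mem_head.
have pos : cone I (gprod s a).
  by apply: (@reduced_prefix_pos I s a [::]); rewrite cats1.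
have [rs' _] : reduced I s /\ reduced I [:: a].
  by apply: reduced_cat; rewrite cats1.
have h1 : 1 <= B rho (gprod s a).
  apply: root_height => //; last exact: cone_sub pos.
  apply: root_Wg; last exact: root_gen.
  by exists s => //; apply: word_sub rs'.1.
rewrite gprod_rcons GL_mulE reflE GL_linB GL_linZ unit_root // divr1 !formE size_rcons.
have h2 : c0 <= - B k a * B rho (gprod s a) by have := hk a aP Ia; nra.
by have := IH rs'; rewrite -natr1; lra.
Qed.

(** * Minimal heights and finite parabolic subgroups *)

Lemma words_upto I n : exists L : seq (GL V),
  forall s, word I s -> (size s <= n)%N -> gprod s \in L.
Proof.
elim: n => [|n [L hL]].
  by exists [:: 1%g] => -[|//] _ _; rewrite gprod_nil mem_head.
exists (1%g :: [seq (refl B a * w)%g | a <- P, w <- L]) => -[|a s] ws sn.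
  by rewrite gprod_nil mem_head.
move: ws => /word_consP[aP _ ws]; rewrite inE gprod_cons; apply/orP; right.
by apply: allpairs_f => //; exact: hL.
Qed.

Lemma seq_argmin (T : eqType) (L : seq T) (Q : T -> Prop) (f : T -> R) w0 :
  w0 \in L -> Q w0 -> exists w, [/\ w \in L, Q w & forall u, u \in L -> Q u -> f w <= f u].
Proof.
elim: L w0 => // x L IH w0; have [[w1 w1L Qw1]|no] := pselect (exists2 w1, w1 \in L & Q w1).
  have [w [wL Qw wm]] := IH w1 w1L Qw1; move=> _ _.
  have [[Qx fx]|no] := pselect (Q x /\ f x <= f w).
    exists x; split => //; first exact: mem_head.
    move=> u; rewrite inE => /orP[/eqP ->//|uL Qu]; exact: le_trans fx (wm u uL Qu).
  exists w; split => //; first by rewrite inE wL orbT.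
  move=> u; rewrite inE => /orP[/eqP -> Qx|]; last exact: wm.
  by rewrite leNgt; apply/negP => lt; apply: no; split => //; exact: ltW.
rewrite inE => /orP[/eqP -> Qx|w0L Qw0]; last by case: no; exists w0.
exists x; split => //; first exact: mem_head.
by move=> u; rewrite inE => /orP[/eqP ->//|uL Qu]; case: no; exists u.
Qed.

Lemma height_refl rho w y a : height_fun rho -> a \in P ->
  B rho ((refl B a * w)%g y) = B rho (w y) - 2 * B (w y) a * B rho a.
Proof. by move=> _ aP; rewrite GL_mulE reflE unit_root // divr1 !formE. Qed.

(** The summand [e *: kappa] of [y] gains height linearly in the length, and the rest is bounded
    below by [M], so only finitely many group elements do not raise the height of [y]. At a minimum
    no product with [G] is positive, since reflecting would lower the height. *)
Lemma growth_min rho c0 M e G kappa y : height_fun rho -> 0 < c0 -> 0 < e ->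
  (forall a, a \in P -> G a -> B kappa a <= - c0) ->
  (forall w, Wg G w -> M <= B rho (w (y - e *: kappa))) ->
  exists2 w, Wg G w & forall a, a \in P -> G a -> B (w y) a <= 0.
Proof.
move=> hr c00 e0 hk hM.
pose A := M + e * B rho kappa; pose N := Num.bound ((B rho y - A) / (2 * e * c0)).
have fN s : reduced G s -> B rho (gprod s y) <= B rho y -> (size s <= N)%N.
  move=> rs le.
  have h1 := reduced_growth hr rs (ltW c00) hk.
  have h2 : M <= B rho (gprod s (y - e *: kappa)).
    by apply: hM; exists s => //; exact: rs.1.
  rewrite !GL_linE !formE in h2.
  have ec : 0 < 2 * e * c0 by rewrite !mulr_gt0.
  rewrite -(ler_nat R); apply/ltW.
  have : (size s)%:R <= (B rho y - A) / (2 * e * c0).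
    rewrite ler_pdivlMr // /A.
    move: h1 h2 le; move: (B rho (gprod s kappa)) (B rho (gprod s y)) => p q.
    move: (B rho kappa) (B rho y) (size s)%:R => p' q' n h1 h2 h3.
    have : e * (p' + 2 * c0 * n) <= e * p by rewrite ler_pM2l.
    by lra.
  move=> h; apply: (le_lt_trans h); apply: archi_boundP.
  by apply: (le_trans _ h); rewrite ler0n.
have [L hL] := words_upto G N.
have hL' w : Wg G w -> B rho (w y) <= B rho y -> w \in L.
  move=> hw le; have [s rs ws] := reduced_ex hw; rewrite ws in le *.
  by apply: hL (fN s rs le); exact: rs.1.
have [||w [wL Gw wmin]] := @seq_argmin _ L (Wg G) (fun w => B rho (w y)) 1%g.
- by apply: hL'; [exact: Wg1|rewrite GL_oneE].
- exact: Wg1.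
exists w => // a aP Ga; rewrite leNgt; apply/negP => lt.
have hra := hr a aP.
have lt2 : B rho ((refl B a * w)%g y) < B rho (w y).
  rewrite height_refl // ltrBlDr ltrDl mulr_gt0 ?mulr_gt0 //.
  exact: lt_le_trans hra.
have Gaw : Wg G (refl B a * w)%g by apply: WgM => //; exact: Wg_refl.
have : B rho (w y) <= B rho ((refl B a * w)%g y).
  apply: (wmin _ _ Gaw); apply: (hL' _ Gaw); apply: le_trans (ltW lt2) _.
  rewrite -[X in _ <= B rho X](GL_oneE y); apply: (wmin _ _ (Wg1 _)).
  by apply: hL'; [exact: Wg1|rewrite GL_oneE].
by rewrite leNgt lt2.
Qed.

Definition Wfin (I : set V) := exists L : seq (GL V), forall w, Wg I w -> w \in L.

Lemma Wfin_finite I : Wfin I <-> finite_set [set w | Wg I w].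
Proof.
split.
  by move=> [L hL]; apply: (@sub_finite_set _ _ [set` L]).
move=> /finite_seqP[L hL]; exists L => w hw.
by have : [set w | Wg I w] w by []; rewrite hL.
Qed.

Lemma Wfin_descent I y : Wfin I ->
  exists2 w, Wg I w & forall a, a \in P -> I a -> B (w y) a <= 0.
Proof.
move=> [L hL]; have [rho hr] := interior_ex.
have [||w [wL Iw wmin]] := @seq_argmin _ L (Wg I) (fun w => B rho (w y)) 1%g.
- by apply: hL; exact: Wg1.
- exact: Wg1.
exists w => // a aP Ia; rewrite leNgt; apply/negP => lt.
have Iaw : Wg I (refl B a * w)%g by apply: WgM => //; exact: Wg_refl.
have := wmin _ (hL _ Iaw) Iaw; rewrite height_refl // leNgt ltrBlDr ltrDl.
rewrite mulr_gt0 ?mulr_gt0 //; exact: lt_le_trans (hr a aP).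
Qed.

(* For the symmetric matrix [(B a b)] with nonpositive off-diagonal entries and a
   positive vector [c]: B(x,x) - \sum_a (x_a^2 / c_a) B(c,a) is the sum over pairs of
   -1/2 B(a,b) c_a c_b (x_a / c_a - x_b / c_b)^2. *)
Lemma form_quad_ge I c x : fsupp I c -> supp_in I x ->
  \sum_(a <- P) (x a) ^+ 2 / c a * B (lc c) a <= B (lc x) (lc x).
Proof.
move=> [c0 cI cp] xI.
pose T a b := x a * x b * B a b.
pose U a b := (x a) ^+ 2 / c a * c b * B a b.
have e1 : B (lc x) (lc x) = \sum_(a <- P) \sum_(b <- P) T a b.
  rewrite form_lcl; apply: eq_bigr => a _; rewrite form_lcr mulr_sumr.
  by apply: eq_bigr => b _; rewrite /T mulrA.
have e2 : \sum_(a <- P) (x a) ^+ 2 / c a * B (lc c) a =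
          \sum_(a <- P) \sum_(b <- P) U a b.
  apply: eq_bigr => a _; rewrite form_lcl mulr_sumr.
  by apply: eq_bigr => b _; rewrite /U form_sym !mulrA.
have e3 : \sum_(a <- P) \sum_(b <- P) U a b = \sum_(a <- P) \sum_(b <- P) U b a.
  by rewrite exchange_big.
have : \sum_(a <- P) \sum_(b <- P) (U a b + U b a) <=
       \sum_(a <- P) \sum_(b <- P) (T a b + T a b).
  rewrite big_seq [leRHS]big_seq; apply: ler_sum => a aP.
  rewrite big_seq [leRHS]big_seq; apply: ler_sum => b bP.
  have z y : ~ I y -> x y = 0 /\ c y = 0.
    by move=> ny; split; apply/eqP/negPn/negP; [move/xI|move/cI].
  have [Ia|/z[xa ca]] := pselect (I a); last first.
    by rewrite /U /T xa ca !(expr0n, mul0r, mulr0) !addr0.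
  have [Ib|/z[xb cb]] := pselect (I b); last first.
    by rewrite /U /T xb cb !(expr0n, mul0r, mulr0) !addr0.
  have ca := cp a aP Ia; have cb := cp b bP Ib.
  rewrite /U /T (form_sym b a) -subr_ge0.
  have [->|ab] := eqVneq a b.
    by rewrite divfK ?gt_eqF // -expr2 subrr.
  have -> : x a * x b * B a b + x a * x b * B a b -
      (x a ^+ 2 / c a * c b * B a b + x b ^+ 2 / c b * c a * B a b) =
      - B a b * (c a * c b) * (x a / c a - x b / c b) ^+ 2.
    by field; rewrite !gt_eqF.
  by rewrite mulr_ge0 ?sqr_ge0 // mulr_ge0 ?oppr_ge0 ?form_le0 // mulr_ge0 // ltW.
rewrite e2 e1.
have sp (F G : V -> V -> R) : \sum_(a <- P) \sum_(b <- P) (F a b + G a b) =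
   \sum_(a <- P) \sum_(b <- P) F a b + \sum_(a <- P) \sum_(b <- P) G a b.
  by rewrite -big_split; apply: eq_bigr => a _; rewrite -big_split.
by rewrite !sp -e3; lra.
Qed.

(** The invariant norm bounds the coordinates of the orbit of [D] through [form_quad_ge], hence its
    heights from below. By [reduced_growth] for [- D] these heights fall linearly with the length,
    so lengths are bounded. *)
Lemma Wfin_of_pos I d : fsupp I d -> (forall a, a \in P -> I a -> 0 < B (lc d) a) ->
  Wfin I.
Proof.
move=> fd hd; have [d0 dI dp] := fd; have [rho hr] := interior_ex.
pose D := lc d; pose Q := B D D.
have [c0 c00 hc] : exists2 c0, 0 < c0 & forall a, a \in P -> I a -> c0 <= B D a.
  have [e e0 he] := @finite_lb _ [seq a <- P | `[< I a >]] (fun a => B D a)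
    (fun a => ltac:(by rewrite mem_filter => /andP[/asboolP Ia aP]; exact: hd)).
  by exists e => // a aP Ia; apply: he; rewrite mem_filter aP andbT; apply/asboolP.
(* The norm gives [x a ^+ 2 <= Q * d a / B D a]; the added 1 turns this into a bound for [- x a]
   without square roots. *)
pose H := \sum_(a <- P) (1 + Q * d a / B D a) * B rho a.
have bound w : Wg I w -> - H <= B rho (w D).
  move=> hw; have [x xI wx] : spanI I (w D).
    by apply: spanI_Wg => //; exists d.
  have hQ : \sum_(a <- P) (x a) ^+ 2 / d a * B D a <= Q.
    have -> : Q = B (lc x) (lc x) by rewrite -wx (Wg_isom hw).
    exact: (form_quad_ge fd xI).
  rewrite wx form_lcr /H -sumrN big_seq [leRHS]big_seq; apply: ler_sum => a aP.
  rewrite -mulNr ler_wpM2r //; first exact: le_trans (hr a aP).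
  have [Ia|Ia] := pselect (I a); last first.
    have -> : x a = 0 by apply/eqP/negPn/negP => /xI.
    have -> : d a = 0 by apply/eqP/negPn/negP => /dI.
    by rewrite mulr0 mul0r addr0 oppr_le0 ler01.
  have da := dp a aP Ia; have Da := hd a aP Ia.
  have : (x a) ^+ 2 / d a * B D a <= Q.
    apply: le_trans hQ; rewrite (bigD1_seq a) ?uP //= lerDl big_seq_cond.
    apply: sumr_ge0 => b /andP[bP _].
    have [Ib|Ib] := pselect (I b); last first.
      have -> : x b = 0 by apply/eqP/negPn/negP => /xI.
      by rewrite expr0n mul0r mul0r.
    by rewrite mulr_ge0 ?divr_ge0 ?sqr_ge0 // ltW // hd.
  rewrite -ler_pdivlMr // ler_pdivrMr // => h.
  have e : Q / B D a * d a = Q * d a / B D a by rewrite mulrAC.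
  by rewrite e in h; nra.
pose N := Num.bound ((H + B rho D) / (2 * c0)).
have [L hL] := words_upto I N; exists L => w hw.
have [s rs ws] := reduced_ex hw; rewrite ws.
apply: hL; first exact: rs.1.
have hk a : a \in P -> I a -> B (- D) a <= - c0.
  by move=> aP Ia; rewrite formNl lerN2 hc.
have := reduced_growth hr rs (ltW c00) hk; have := bound _ hw.
rewrite ws GL_linN !formNr => h1 h2.
rewrite -(ler_nat R); apply/ltW.
have c2 : 0 < 2 * c0 by rewrite mulr_gt0.
have h : (size s)%:R <= (H + B rho D) / (2 * c0).
  by rewrite ler_pdivlMr // mulrC; lra.
apply: (le_lt_trans h); apply: archi_boundP.
by apply: (le_trans _ h); rewrite ler0n.
Qed.

Lemma Wfin_compl I : Wfin (I `\` infI I).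
Proof.
have [d fd hd] := infI_compl I; apply: Wfin_of_pos fd _ => a aP [Ia na]; exact: hd.
Qed.

(** * The Tits cone and the imaginary cone *)

(* [Cc], [Xc], [Zc] and [Kc] are the cones C, X, Z and K of the text, for the parabolic
   subgroup of [I] in the case of [Cc], [Zc] and [Kc]. *)
Definition Cc (I : set V) : set V := [set v | forall a, a \in P -> I a -> 0 <= B v a].

Definition Xc : set V :=
  [set v | exists w c, [/\ Wg setT w, Cc setT c & v = w c]].

Definition Zc (I : set V) : set V :=
  [set v | exists w k, [/\ Wg I w, Kc I k & v = w k]].

Definition Nfin (v : V) := exists l : seq V,
  forall g, root setT g -> cone setT g -> B v g < 0 -> g \in l.

Lemma Cc_cone c g : Cc setT c -> cone setT g -> 0 <= B c g.
Proof.
by move=> hc; rewrite form_sym; apply: form_cone_ge0 => a aP _; rewrite form_sym hc.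
Qed.

(** A positive root that is negative on [w c] is made negative by [w^-1], so by [crossing] it is one
    of the finitely many roots read off a word of [w]. *)
Lemma Xc_Nfin v : Xc v -> Nfin v.
Proof.
move=> [w [c [hw hc ->]]]; have [s ws wE] := hw.
exists [seq gprod (take i s) (nth 0 s i) | i <- iota 0 (size s)].
move=> g rg pg; rewrite (isom_adjoint _ _ (Wg_isom hw)) => neg.
have rg' : root setT (w^-1%g g) by apply: root_Wg rg; exact: WgV.
have ng : cone setT (- w^-1%g g).
  by case: (root_sign rg') => // h; move: neg; rewrite ltNge Cc_cone.
rewrite wE in ng; have [u [a [t [sE ->]]]] := crossing ws rg pg ng.
apply/mapP; exists (size u).
  by rewrite mem_iota sE size_cat /= add0n; lia.
by rewrite sE take_size_cat // nth_cat ltnn subnn.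
Qed.

(** The reflection in a simple root [a] with negative product permutes the other positive roots, so
    the list shrinks by one. Only reflections of [I] are used, so the descent stays in its parabolic
    subgroup. *)
Lemma Nfin_descent I v : Nfin v -> exists2 w, Wg I w & Cc I (w v).
Proof.
move=> [l hl]; elim: {l}(size l) {-2}l (leqnn (size l)) v hl => [|n IH] l ln v hl.
  exists 1%g; first exact: Wg1.
  move=> a aP Ia; rewrite GL_oneE leNgt; apply/negP => lt.
  have := hl a (root_gen aP (I := setT) Logic.I) (cone_gen aP (I := setT) Logic.I) lt.
  by rewrite (size0nil (_ : size l = 0%N)) //; lia.
have [h|] := pselect (Cc I v).
  by exists 1%g; [exact: Wg1|rewrite GL_oneE].
move=> /existsNP[a /not_implyP[aP /not_implyP[Ia /negP]]]; rewrite -ltNge => lt.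
have al : a \in l by apply: hl => //; [exact: root_gen|exact: cone_gen].
have Ba g : B (refl B a v) g = B v (refl B a g).
  by rewrite -{1}(GL_Kinv (refl B a) g) refl_isom reflV.
have [||w hw hc] := IH [seq refl B a x | x <- rem a l] _ (refl B a v).
- by rewrite size_map size_rem // -subn1 leq_subLR add1n.
- move=> g rg pg; rewrite Ba => neg.
  have rg' : root setT (refl B a g) by apply: root_Wg rg; exact: Wg_refl.
  have ga : g != a.
    apply/negP => /eqP e; move: neg; rewrite e refl_self // formNr; move: lt; lra.
  have pg' : cone setT (refl B a g).
    case: (root_sign rg') => // h; case/eqP: ga.
    exact: refl_neg_simple (root_unit rg) pg aP h.
  apply/mapP; exists (refl B a g); last by rewrite -GL_mulE reflK GL_oneE.
  have gl := hl _ rg' pg' neg.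
  have ne : refl B a g != a.
    apply/negP => /eqP e; move: (pg); rewrite -[g]GL_oneE -(reflK a) GL_mulE e refl_self //.
    move=> h; apply: (root_sign_excl (unit_root aP) (cone_gen aP (I := setT) Logic.I) h).
  by move: gl; rewrite (perm_mem (perm_to_rem al)) inE (negbTE ne).
exists (w * refl B a)%g; first by apply: WgM => //; exact: Wg_refl.
by move=> b bP Ib; rewrite GL_mulE; exact: hc.
Qed.

Lemma Nfin_Xc v : Nfin v -> Xc v.
Proof.
move=> /(@Nfin_descent setT)[w hw hc]; exists (w^-1)%g, (w v); rewrite GL_invK.
by split => //; exact: WgV.
Qed.

Lemma XcD u v : Xc u -> Xc v -> Xc (u + v).
Proof.
move=> /Xc_Nfin[l hl] /Xc_Nfin[l' hl']; apply: Nfin_Xc; exists (l ++ l').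
move=> g rg pg; rewrite formDl mem_cat => lt.
have [h|h] := ltP (B u g) 0; first by rewrite hl.
have h' : B v g < 0 by move: lt; lra.
by rewrite [X in _ || X]hl' // orbT.
Qed.

Lemma CcZ I k c : 0 <= k -> Cc I c -> Cc I (k *: c).
Proof. by move=> k0 hc a aP Ia; rewrite formZl mulr_ge0 // hc. Qed.

Lemma XcZ k v : 0 <= k -> Xc v -> Xc (k *: v).
Proof.
move=> k0 [w [c [hw hc ->]]]; exists w, (k *: c); rewrite GL_linZ.
by split => //; exact: CcZ.
Qed.

Lemma Cc_Xc c : Cc setT c -> Xc c.
Proof. by move=> hc; exists 1%g, c; rewrite GL_oneE; split => //; exact: Wg1. Qed.

Lemma Xc0 : Xc 0.
Proof. by apply: Cc_Xc => a _ _; rewrite form0l. Qed.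

Lemma Xc_Wg w v : Wg setT w -> Xc v -> Xc (w v).
Proof.
move=> hw [u [c [hu hc ->]]]; exists (w * u)%g, c; rewrite GL_mulE.
by split => //; exact: WgM.
Qed.

Lemma Zc_Wg I w v : Wg I w -> Zc I v -> Zc I (w v).
Proof.
move=> hw [u [c [hu hc ->]]]; exists (w * u)%g, c; rewrite GL_mulE.
by split => //; exact: WgM.
Qed.

Lemma Kc_Zc I k : Kc I k -> Zc I k.
Proof. by move=> hk; exists 1%g, k; rewrite GL_oneE; split => //; exact: Wg1. Qed.

Lemma Kc_Wg_cone I w k : Wg I w -> Kc I k -> cone I (w k - k).
Proof.
move=> hw hk; have [s rs ->] := reduced_ex hw.
by apply: reduced_sub_cone => // a aP Ia; case: hk => _; exact.
Qed.

Lemma Zc_cone I z : Zc I z -> cone I z.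
Proof.
move=> [w [k [hw hk ->]]]; rewrite -[w k](subrK k); apply: coneD; last by case: hk.
exact: Kc_Wg_cone.
Qed.

Lemma Zc_sub I J : I `<=` J -> Zc I `<=` Zc J.
Proof.
move=> IJ v [w [k [hw hk ->]]]; exists w, k; split => //; first exact: Wg_sub hw.
exact: Kc_sub hk.
Qed.

Lemma Xdual_cone v : (forall x, Xc x -> 0 <= B v x) -> cone setT v.
Proof.
move=> h; apply: dual_chamber => c hc; apply/h/Cc_Xc => a aP _.
by rewrite form_sym hc.
Qed.

Lemma Xdual_Wg w v : Wg setT w -> (forall x, Xc x -> 0 <= B v x) ->
  forall x, Xc x -> 0 <= B (w v) x.
Proof.
move=> hw h x hx; rewrite (isom_adjoint _ _ (Wg_isom hw)); apply: h.
by apply: Xc_Wg hx; exact: WgV.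
Qed.

Lemma ZX_ge0 z x : Zc setT z -> Xc x -> 0 <= B z x.
Proof.
move=> hz [w [c [hw hc ->]]].
rewrite form_sym (isom_adjoint _ _ (Wg_isom hw)); apply: Cc_cone => //.
by apply/Zc_cone/Zc_Wg => //; exact: WgV.
Qed.

Lemma Zc_negX z : Zc setT z -> Xc (- z).
Proof.
move=> [w [k [hw hk ->]]]; exists w, (- k); rewrite GL_linN; split => // a aP _.
by rewrite formNl oppr_ge0; exact: Kc_le0 hk aP.
Qed.

(** Conversely, moving [- z] into the chamber moves [z] into [- C]. The image of [z] remains in the
    dual of X, hence in the dual of C, which is the cone of the simple roots; so it lies in K. *)
Lemma Zc_char z : Zc setT z <-> Xc (- z) /\ forall x, Xc x -> 0 <= B z x.
Proof.
split; first by move=> hz; split; [exact: Zc_negX|move=> x; exact: ZX_ge0].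
move=> [[w [c [hw hc zE]]] hX].
exists w, (- c); split => //; last by rewrite GL_linN -zE opprK.
split; last by move=> a aP _; rewrite formNl oppr_le0 hc.
have -> : - c = w^-1%g z by rewrite -[z]opprK zE GL_linN GL_invK.
by apply/Xdual_cone/Xdual_Wg => //; exact: WgV.
Qed.

Lemma ZcD u v : Zc setT u -> Zc setT v -> Zc setT (u + v).
Proof.
move=> /Zc_char[u1 u2] /Zc_char[v1 v2]; apply/Zc_char; split.
  by rewrite opprD; exact: XcD.
by move=> x hx; rewrite formDl addr_ge0 ?u2 ?v2.
Qed.

Lemma ZcZ k v : 0 <= k -> Zc setT v -> Zc setT (k *: v).
Proof.
move=> k0 [w [c [hw hc ->]]]; exists w, (k *: c); rewrite GL_linZ.
by split => //; exact: KcZ.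
Qed.

Lemma Zc0 I : Zc I 0.
Proof. exact/Kc_Zc/Kc0. Qed.

(* [negI] is the union of the indefinite components, and [affI] below is that of the
   affine ones. *)
Definition negI : set V := [set a | exists2 k, Kc setT k & B k a < 0].

Lemma strict_ex : exists c, [/\ fsupp (infI setT) c, Kc setT (lc c) &
  forall a, a \in P -> negI a -> B (lc c) a < 0].
Proof.
have [c [c0 cI cp] ck] := infI_full setT.
pose L := [seq a <- P | `[< negI a >]].
pose Q (d : V -> R) := [/\ nonneg d, supp_in (infI setT) d & Kc setT (lc d)].
have [|||||d [d0 dI dk] h] := @combine (V -> R) V L Q (fun a d => - B (lc d) a).
- split => //; first by move=> a; rewrite eqxx.
  have -> : lc 0 = 0 by exact: lc0.
  exact: Kc0.
- move=> u v [u0 uI uk] [v0 vI vk]; split.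
  + by move=> a; rewrite addr_ge0.
  + move=> a h; case: (eqVneq (u a) 0) => [e|/uI//].
    by apply: vI; move: h; rewrite (_ : (u + v) a = v a) // -[RHS]add0r -e.
  + have -> : lc (u + v) = lc u + lc v by rewrite lcD.
    exact: KcD.
- move=> a u v; have -> : lc (u + v) = lc u + lc v by rewrite lcD.
  by rewrite formDl opprD.
- move=> a u; rewrite mem_filter => /andP[_ aP] [_ _ h]; rewrite oppr_ge0.
  exact: Kc_le0 h aP.
- move=> a; rewrite mem_filter => /andP[/asboolP[k hk ka] aP].
  have [[d [d0 _ kd]] _] := hk.
  pose d' x := if x \in P then d x else 0.
  have e : lc d' = k by rewrite kd; apply: eq_lc => x xP; rewrite /d' xP.
  have n0 : nonneg d' by move=> x; rewrite /d'; case: ifP.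
  exists d'; last by rewrite e oppr_gt0.
  split => //; last by rewrite e.
  apply: infI_supp => //; first by rewrite e.
  by move=> x; rewrite /d'; case: ifP => //; rewrite eqxx.
exists (fun a => c a + d a); split.
- split.
  + by move=> a; rewrite addr_ge0.
  + move=> a h'; case: (eqVneq (c a) 0) => [e|/cI//].
    by apply: dI; move: h'; rewrite e add0r.
  + by move=> a aP Ia; rewrite ltr_pwDl ?cp.
- by rewrite -lcD; exact: KcD.
- move=> a aP na; rewrite -lcD formDl.
  have := h a; rewrite mem_filter aP andbT oppr_gt0 => /(_ (asboolT na)).
  have := Kc_le0 ck aP; lra.
Qed.

Definition affI : set V := infI setT `\` negI.

(** If [a] and [j] were not orthogonal, subtracting [B k j *: j] from the witness [k] for [j] would
    give an element of K that is negative on [a]. *)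
Lemma affI_perp_negI a j : a \in P -> affI a -> j \in P -> negI j -> B a j = 0.
Proof.
move=> aP [ia na] jP nj; apply/eqP/negPn/negP => aj.
have aj' : a != j by apply/negP => /eqP e; apply: na; rewrite e.
have [k hk kj] := nj; apply: na.
exists (k - B k j *: j).
  split; first apply: coneD; first by case: hk.
    by rewrite -scaleNr; apply: coneZ; [rewrite oppr_ge0 ltW|exact: cone_gen].
  move=> b bP _; rewrite formDl formNl formZl.
  have [->|bj] := eqVneq b j; first by rewrite unit_root // mulr1 subrr.
  have h1 := Kc_le0 hk bP; have h2 : B j b <= 0 by rewrite form_le0 // eq_sym.
  by nra.
rewrite formDl formNl formZl; have h1 := Kc_le0 hk aP.
have h2 : B j a < 0 by rewrite lt_neqAle form_sym aj form_le0.
by nra.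
Qed.

Lemma affI_perp a j : a \in P -> affI a -> j \in P -> ~ affI j -> B a j = 0.
Proof.
move=> aP ha jP nj; have [ij|ij] := pselect (infI setT j).
  by apply: affI_perp_negI => //; apply: contrapT => h; apply: nj.
by rewrite form_sym; apply: (infI_perp (I := setT)) => //; case: ha.
Qed.

Lemma affI_null : exists2 c, fsupp affI c & forall a, a \in P -> B (lc c) a = 0.
Proof.
have [c [[c0 cI cp] ck _]] := strict_ex.
pose d x := if `[< affI x >] then c x else 0.
have d0 : nonneg d by move=> x; rewrite /d; case: ifP.
have dI : supp_in affI d.
  by move=> x; rewrite /d; case: ifP => [/asboolP//|]; rewrite eqxx.
exists d.
  split => // a aP ha; rewrite /d asboolT //; apply: cp => //; by case: ha.
move=> a aP; have [ha|ha] := pselect (affI a); last first.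
  apply: (@form_span0 affI); last by exists d.
  by move=> b bP hb; exact: affI_perp.
have -> : B (lc d) a = B (lc c) a.
  apply/eqP; rewrite -subr_eq0 -formNl -formDl lcB; apply/eqP.
  apply: (@form_span0 [set b | ~ affI b]).
    by move=> b bP hb; rewrite form_sym; exact: affI_perp.
  exists (fun x => d x - c x) => // x /= h hx; move: h.
  by rewrite /d asboolT // subrr eqxx.
apply/eqP; rewrite eq_le (Kc_le0 ck) //= leNgt; apply/negP => lt.
by case: ha => _; apply; exists (lc c).
Qed.

Lemma affI_psd x : supp_in affI x -> 0 <= B (lc x) (lc x).
Proof.
move=> hx; have [c fc c0] := affI_null.
apply: le_trans (form_quad_ge fc hx); rewrite big_seq big1 // => a aP.
by rewrite c0 // mulr0.
Qed.

(* On an affine component the orbit of a vector of the dual of the Tits cone cannot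
   stay in the cone of the simple roots unless the vector is fixed: near-minimizers
   of the height on the orbit are almost orthogonal to the component, so their
   isotropic part, whose norm is invariant, has norm 0. *)
Lemma Xdual_affI v a : (forall x, Xc x -> 0 <= B v x) -> a \in P -> affI a ->
  B v a = 0.
Proof.
move=> hv aP ha; have [rho hr] := interior_ex.
have [c [c0 _ vc]] := Xdual_cone hv.
pose cut (f : V -> R) x := if `[< affI x >] then f x else 0.
have cutI f : supp_in affI (cut f).
  by move=> x; rewrite /cut; case: ifP => [/asboolP//|]; rewrite eqxx.
have cut_form f b : b \in P -> affI b -> B (lc f) b = B (lc (cut f)) b.
  move=> bP hb; apply/eqP; rewrite -subr_eq0 -formNl -formDl lcB; apply/eqP.
  apply: (@form_span0 [set x | ~ affI x]).
    by move=> x xP hx; rewrite form_sym; exact: affI_perp.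
  exists (fun x => f x - cut f x) => // x /= h hx; move: h.
  by rewrite /cut asboolT // subrr eqxx.
pose v0 := lc (cut c).
have v_v0 b : b \in P -> affI b -> B (v - v0) b = 0.
  by move=> bP hb; rewrite formDl formNl vc (cut_form _ b) // subrr.
pose A := [set t | exists2 w, Wg affI w & t = B rho (w v)].
have Wv w : Wg affI w -> cone setT (w v).
  move=> hw; apply/Xdual_cone/Xdual_Wg => //; exact: Wg_sub hw.
have hA : has_inf A.
  split; first by exists (B rho v), 1%g; [exact: Wg1|rewrite GL_oneE].
  by exists 0 => _ [w hw ->]; exact: height_cone_ge0 (Wv w hw).
pose m := inf A.
have mle w : Wg affI w -> m <= B rho (w v).
  by move=> hw; apply: inf_lbound; [case: hA|exists w].
have m0 : 0 <= m.
  apply: lb_le_inf; first by case: hA.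
  by move=> _ [w hw ->]; exact: height_cone_ge0 (Wv w hw).
have key e : 0 < e -> e <= 1 -> B v0 v0 <= (m + 1) * e.
  move=> e0 e1; have [_ [w hw ->] lt] := inf_adherent e0 hA.
  have [d [d0 _ ud]] := Wv w hw.
  (* With a larger product, the reflection in [b] would push the height below the infimum [m]. *)
  have uB b : b \in P -> affI b -> B (w v) b <= e.
    move=> bP hb; have := mle (refl B b * w)%g (WgM (Wg_refl bP hb) hw).
    by rewrite height_refl // => h; have := hr b bP; rewrite -/m in lt; nra.
  (* [u'] and [w v0] may differ as vectors, but both lie in the affine span and have equal products
     with it, hence equal norms. *)
  pose u' := lc (cut d).
  have wv0 : spanI affI (w v0) by apply: spanI_Wg => //; exists (cut c).
  have wvv0 : w v - w v0 = v - v0.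
    rewrite -GL_linB (Wg_fix hw) // => b bP hb; exact: v_v0.
  have u'b b : b \in P -> affI b -> B u' b = B (w v) b.
    by move=> bP hb; rewrite ud (cut_form d b).
  have u'wb b : b \in P -> affI b -> B u' b = B (w v0) b.
    move=> bP hb; rewrite u'b //; apply/eqP; rewrite -subr_eq0 -formNl -formDl.
    by rewrite wvv0 v_v0.
  have e2 y : spanI affI y -> B (u' - w v0) y = 0.
    rewrite form_sym; apply: form_span0 => b bP hb.
    by rewrite form_sym formDl formNl u'wb // subrr.
  have su' : spanI affI u' by exists (cut d).
  have -> : B v0 v0 = B u' u'.
    rewrite -(Wg_isom hw v0 v0).
    have h1 := e2 _ su'; have h2 := e2 _ wv0; rewrite !formDl !formNl in h1 h2.
    by rewrite (form_sym u' (w v0)) in h2; lra.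
  have -> : B u' u' = \sum_(x <- P) cut d x * B (w v) x.
    rewrite {1}/u' form_lcl big_seq [RHS]big_seq; apply: eq_bigr => x xP.
    rewrite /cut; case: ifP => [/asboolP hx|]; last by rewrite !mul0r.
    by rewrite form_sym u'b.
  apply: le_trans (_ : (\sum_(x <- P) d x) * e <= _).
    rewrite mulr_suml big_seq [leRHS]big_seq; apply: ler_sum => x xP.
    rewrite /cut; case: ifP => [/asboolP hx|_]; first by rewrite ler_wpM2l ?uB.
    by rewrite mul0r mulr_ge0 // ltW.
  rewrite ler_wpM2r ?(ltW e0) //; apply: ltW; apply: (@le_lt_trans _ _ (B rho (w v))).
    rewrite ud form_lcr big_seq [leRHS]big_seq; apply: ler_sum => x xP.
    by rewrite ler_peMr ?hr.
  by apply: lt_le_trans lt _; rewrite lerD2l.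
have v00 : B v0 v0 = 0.
  apply/eqP; rewrite eq_le affI_psd // andbT leNgt; apply/negP => gt.
  pose e := Num.min 1 (B v0 v0 / (2 * (m + 1))).
  have m1 : 0 < 2 * (m + 1) by lra.
  have e0 : 0 < e by rewrite lt_min ltr01 divr_gt0.
  have := key e e0; rewrite ge_min lexx => /(_ isT).
  have : e * (2 * (m + 1)) <= B v0 v0.
    by rewrite -ler_pdivlMr // ge_min lexx orbT.
  by lra.
have -> : B v a = B v0 a by rewrite vc (cut_form c a).
apply/eqP/negPn/negP => ne.
have q t : 0 <= 2 * t * B v0 a + t ^+ 2.
  have : 0 <= B (v0 + t *: a) (v0 + t *: a).
    rewrite /v0 -[X in _ *: X](lc_dlt aP) lcZ lcD; apply: affI_psd => x.
    rewrite /dlt; have [->//|_] := eqVneq x a; rewrite mulr0 addr0; exact: cutI.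
  rewrite !formE v00 unit_root // (form_sym a v0) => h.
  by move: h; congr (0 <= _); ring.
(* An isotropic vector of a semidefinite form lies in its radical: this value of [t] would make the
   polynomial negative. *)
have := q (- B v0 a); have : 0 < B v0 a ^+ 2 by rewrite exprn_even_gt0.
by nra.
Qed.

Lemma Xdual_approx : exists2 b, Zc setT b & forall v e,
  (forall x, Xc x -> 0 <= B v x) -> 0 < e -> Zc setT (v + e *: b).
Proof.
have [c [[c0 cI cp] ck cn]] := strict_ex; pose b := lc c.
have hb : Zc setT b by exact: Kc_Zc.
exists b => // v e hv e0; have [rho hr] := interior_ex.
pose y := v + e *: b.
have hy x : Xc x -> 0 <= B y x.
  by move=> hx; rewrite formDl formZl addr_ge0 ?hv // mulr_ge0 ?(ltW e0) ?ZX_ge0.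
have ba a : a \in P -> affI a -> B b a = 0.
  move=> aP [ia na]; apply/eqP; rewrite eq_le (Kc_le0 ck) //= leNgt; apply/negP => lt.
  by apply: na; exists b.
have ya a : a \in P -> affI a -> B y a = 0.
  by move=> aP ha; rewrite formDl formZl ba // mulr0 addr0; exact: Xdual_affI.
have [g g0 hg] : exists2 g, 0 < g & forall a, a \in P -> negI a -> B b a <= - g.
  have [g g0 hg] := @finite_lb _ [seq a <- P | `[< negI a >]] (fun a => - B b a)
    (fun a => ltac:(by rewrite mem_filter oppr_gt0 => /andP[/asboolP Ia aP]; exact: cn)).
  exists g => // a aP na; have := hg a; rewrite mem_filter aP asboolT //= lerNr; exact.
(* Here [y - e *: b] is [v], whose orbit stays in the cone of the simple roots, so 0 bounds its
   heights from below. *)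
have [|w hw wn] := @growth_min rho g 0 e negI b y hr g0 e0 hg.
  move=> w hw; rewrite /y addrK; apply: (@height_cone_ge0 rho setT) => //.
  by apply/Xdual_cone/Xdual_Wg => //; exact: Wg_sub hw.
have [u hu un] := Wfin_descent (w y) (Wfin_compl setT).
have hu' : Wg setT u by exact: Wg_sub hu.
have hw' : Wg setT w by exact: Wg_sub hw.
(* Components of different kinds are orthogonal, so [w] and [u] do not disturb products with each
   other's remaining components. *)
have adj f x a : Wg setT f -> f^-1%g a = a -> B (f x) a = B x a.
  by move=> hf fa; rewrite (isom_adjoint _ _ (Wg_isom hf)) fa.
have ufix a : a \in P -> infI setT a -> u^-1%g a = a.
  move=> aP ia; apply: (Wg_fix (WgV hu)) => x xP [_ nx].
  by rewrite form_sym; apply: (infI_perp (I := setT)).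
have uwy : forall a, a \in P -> B (u (w y)) a <= 0.
  move=> a aP; have [ia|ia] := pselect (infI setT a); last exact: un.
  rewrite adj // ?ufix //; have [na|na] := pselect (negI a); first exact: wn.
  rewrite adj // ?ya //; apply: (Wg_fix (WgV hw)) => x xP nx.
  exact: affI_perp_negI.
apply/Zc_char; split; last exact: hy.
exists (w^-1 * u^-1)%g, (- u (w y)); split.
- by apply: WgM; exact: WgV.
- by move=> a aP _; rewrite formNl oppr_ge0 uwy.
- by rewrite GL_linN GL_mulE !GL_invK.
Qed.

Lemma ZX_dual v : (forall x, Xc x -> 0 <= B v x) ->
  forall h, (forall z, Zc setT z -> 0 <= B h z) -> 0 <= B h v.
Proof.
move=> hv h hh; have [b hb ap] := Xdual_approx; rewrite leNgt; apply/negP => lt.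
have hb0 := hh b hb.
(* This keeps [e * B h b] below half of [- B h v]. *)
pose e := - B h v / (2 * (B h b + 1)).
have p : 0 < 2 * (B h b + 1) by lra.
have e0 : 0 < e by rewrite divr_gt0 // oppr_gt0.
have := hh _ (ap v e hv e0); rewrite formDr formZr.
have : e * (2 * (B h b + 1)) = - B h v by rewrite divfK // gt_eqF.
by nra.
Qed.

(** * Stabilizers, exposed faces and relative interiors *)

Lemma form_lc_eq0 d y : (forall a, a \in P -> 0 <= d a * B a y) -> B (lc d) y = 0 ->
  forall a, a \in P -> 0 < d a -> B a y = 0.
Proof.
move=> h; rewrite form_lcl => /eqP; rewrite big_seq psumr_eq0 // => /allP s0 a aP da.
have := s0 a aP; rewrite aP /= mulf_eq0 gt_eqF //= => /eqP; exact.
Qed.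

Lemma finite_small (T : eqType) (s : seq T) (f g : T -> R) :
  (forall a, a \in s -> 0 < f a) ->
  exists2 e, 0 < e & forall a, a \in s -> e * g a <= f a.
Proof.
move=> h; have [|e e0 he] := @finite_lb _ s (fun a => f a / (`|g a| + 1)).
  by move=> a /h fa; rewrite divr_gt0 // ltr_wpDl.
exists e => // a /he; rewrite ler_pdivlMr ?ltr_wpDl // => le.
apply: le_trans le; rewrite ler_wpM2l ?(ltW e0) //.
by apply: le_trans (ler_norm _) _; rewrite lerDl.
Qed.

Definition face_of (c : V) : set V := [set a | a \in P /\ B a c = 0].

Lemma reduced_rev I s : reduced I s -> reduced I (rev s).
Proof.
move=> [ws h]; split; first exact: word_rev.
move=> t wt e; rewrite size_rev -(size_rev t); apply: h; first exact: word_rev.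
by rewrite gprod_rev e gprod_rev invgK.
Qed.

(** The difference of [c] and its image is a sum of nonnegative multiples of positive roots, one for
    each letter. When it vanishes, so does the term of the last letter by [cone_antisym], and the
    prefix fixes [c] too. *)
Lemma stabilizer_word s c : reduced setT s -> Cc setT c -> gprod s c = c ->
  word (face_of c) s.
Proof.
move=> + hc; elim/last_ind: s => [|s a IH] rs; first by [].
have [aP _] : a \in P /\ setT a by apply: rs.1; rewrite mem_rcons mem_head.
have pos : cone setT (gprod s a).
  by apply: (@reduced_prefix_pos setT s a [::]); rewrite cats1.
have [rs' _] : reduced setT s /\ reduced setT [:: a].
  by apply: reduced_cat; rewrite cats1.
rewrite gprod_rcons GL_mulE reflE GL_linB GL_linZ unit_root // divr1 => e.
have h1 : cone setT (c - gprod s c).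
  have -> : c - gprod s c = gprod s (- c) - (- c) by rewrite GL_linN opprK addrC.
  by apply: reduced_sub_cone => // b bP _; rewrite formNl oppr_le0 hc.
have h2 : cone setT ((2 * B c a) *: gprod s a).
  by apply: coneZ pos; rewrite mulr_ge0 // hc.
have e' : - ((2 * B c a) *: gprod s a) = c - gprod s c.
  by apply: (addrI (gprod s c)); rewrite e addrCA subrr addr0.
have z : (2 * B c a) *: gprod s a = 0.
  by apply: cone_antisym h2 _; rewrite e'; exact: h1.
have /eqP := e'; rewrite z oppr0 eq_sym subr_eq0 => /eqP cE.
have wsc := IH rs' (esym cE).
have ca : B a c = 0.
  have : B ((2 * B c a) *: gprod s a) (gprod s a) = 0 by rewrite z form0l.
  rewrite formZl isom_gprod unit_root // mulr1 form_sym => /eqP.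
  by rewrite mulf_eq0 pnatr_eq0 /= => /eqP.
by move=> b; rewrite mem_rcons inE => /orP[/eqP ->|/wsc].
Qed.

Lemma stabilizer c w : Cc setT c -> Wg setT w -> w c = c -> Wg (face_of c) w.
Proof.
move=> hc hw; have [s rs ->] := reduced_ex hw => e.
by exists s => //; exact: stabilizer_word.
Qed.

Lemma face_fix c w : Wg (face_of c) w -> w c = c.
Proof. by move=> hw; apply: (Wg_fix hw) => a aP [_]; rewrite form_sym. Qed.

Lemma cone_face c v : Cc setT c -> cone setT v -> B v c = 0 -> cone (face_of c) v.
Proof.
move=> hc [d [d0 _ ->]] e.
have h : forall a, a \in P -> 0 < d a -> B a c = 0.
  by apply: form_lc_eq0 e => a aP; rewrite mulr_ge0 // form_sym hc.
exists (fun a => if a \in P then d a else 0); split.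
- by move=> a; case: ifP.
- move=> a; case: ifP => [aP da|_]; last by rewrite eqxx.
  by split => //; apply: h => //; rewrite lt_neqAle eq_sym da d0.
- by apply: eq_lc => a ->.
Qed.

(** For the converse, descend [- z] by the group of [face_of c], which fixes [c]. The image of [z]
    stays orthogonal to [c] and in the cone of the simple roots, so it only involves those
    orthogonal to [c]. *)
Lemma Zc_face c z : Cc setT c -> Zc (face_of c) z <-> Zc setT z /\ B z c = 0.
Proof.
move=> hc; split.
  move=> hz; split; first exact: Zc_sub hz.
  by apply: (form_span0 _ (cone_span (Zc_cone hz))) => a aP [].
move=> [hz zc].
have [w hw hwz] := @Nfin_descent (face_of c) _ (Xc_Nfin (Zc_negX hz)).
have hw' : Wg setT w by exact: Wg_sub hw.
exists w^-1%g, (w z); rewrite GL_invK; split => //; first exact: WgV.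
split.
  apply: cone_face => //; first by apply: Zc_cone; exact: Zc_Wg.
  by rewrite (isom_adjoint _ _ (Wg_isom hw)) face_fix //; exact: WgV.
by move=> a aP Ia; have := hwz a aP Ia; rewrite GL_linN formNl oppr_ge0.
Qed.

Lemma form_lc_off0 I d a : fsupp I d -> a \in P -> ~ I a -> B (lc d) a = 0 ->
  forall b, b \in P -> I b -> B b a = 0.
Proof.
move=> [d0 dI dp] aP na e b bP Ib.
have : B b (- a) = 0.
  apply: (@form_lc_eq0 d) => //; last exact: dp.
    move=> x xP; case: (eqVneq (d x) 0) => [->|/dI Ix]; first by rewrite mul0r.
    rewrite mulr_ge0 // formNr oppr_ge0 form_le0 //.
    by apply/negP => /eqP xa; apply: na; rewrite -xa.
  by rewrite formNr e oppr0.
by rewrite formNr => /eqP; rewrite oppr_eq0 => /eqP.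
Qed.

(** A new first letter [b] adds a nonnegative amount to the product with [lc d], so both summands
    vanish. If [b] is not orthogonal to the vector before it, then [b] lies outside [I] and is
    orthogonal to [lc d], hence to all of [I], and its reflection preserves products with [I]. *)
Lemma Xc_perp_word I d s c : fsupp I d -> Kc I (lc d) -> reduced setT s -> Cc setT c ->
  B (gprod s c) (lc d) = 0 -> forall a, a \in P -> I a -> B (gprod s c) a = 0.
Proof.
move=> fd kd + hc; have [d0 dI dp] := fd.
have kZ : Zc setT (lc d) by apply/Kc_Zc/Kc_sub/kd.
elim: s => [|b s IH] rs.
  rewrite gprod_nil GL_oneE form_sym => e a aP Ia.
  rewrite form_sym; apply: form_lc_eq0 e _ aP (dp a aP Ia) => x xP.
  by rewrite mulr_ge0 // form_sym hc.
have [_ rs'] : reduced setT [:: b] /\ reduced setT s by apply: reduced_cat.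
have [bP _] : b \in P /\ setT b by apply: rs.1; rewrite mem_head.
have hb0 : 0 <= B (gprod s c) b.
  rewrite (isom_adjoint _ _ (@isom_gprod s)) -gprod_rev; apply: Cc_cone => //.
  apply: (@reduced_prefix_pos setT (rev s) b [::]).
  by rewrite cats1 -rev_cons; exact: reduced_rev.
have hk0 : 0 <= B (gprod s c) (lc d).
  rewrite form_sym; apply: ZX_ge0 => //; apply: Xc_Wg; last exact: Cc_Xc.
  by exists s => //; exact: rs'.1.
have kb := Kc_le0 kd bP.
rewrite gprod_cons GL_mulE reflE unit_root // divr1.
set y := gprod s c; rewrite formDl formNl formZl -/y in hb0 hk0 * => e.
rewrite (form_sym b) in e.
have z1 : B y (lc d) = 0 by nra.
have z2 : B y b * B (lc d) b = 0 by nra.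
have yI := IH rs' z1.
have [yb|yb] := eqVneq (B y b) 0.
  by rewrite yb mulr0 scale0r subr0; exact: yI.
have [Ib|Ib] := pselect (I b); first by move: yb; rewrite yI // eqxx.
move: z2 => /eqP; rewrite mulf_eq0 (negbTE yb) /= => /eqP z2 a aP Ia.
rewrite formDl formNl formZl yI // (form_sym b).
by rewrite (form_lc_off0 fd bP Ib z2 aP Ia) mulr0 subr0.
Qed.

Lemma Xc_perp I d x : fsupp I d -> Kc I (lc d) -> Xc x ->
  B x (lc d) = 0 <-> forall a, a \in P -> I a -> B x a = 0.
Proof.
move=> fd kd hx; split.
  move: hx => [w [c [hw hc ->]]]; have [s rs ->] := reduced_ex hw.
  exact: Xc_perp_word.
move=> h; rewrite form_sym; apply: (@form_span0 I).
  by move=> a aP Ia; rewrite form_sym h.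
by exists d => //; case: fd.
Qed.

Definition special (I : set V) := exists2 d, fsupp I d & Kc I (lc d).

(** Averaging coefficient families gives one with the largest support [J]. For each [j] outside [J],
    Farkas' lemma yields a vector of the chamber orthogonal to [k] and positive on [j]; the sum of
    these vectors cuts out exactly [J]. *)
Lemma max_supp k : Kc setT k -> exists c d,
  [/\ Cc setT c, fsupp (face_of c) d, k = lc d & Kc (face_of c) k].
Proof.
move=> hk; have [[d0 [d00 _ kd0]] _] := hk.
pose J := [set a | a \in P /\ exists d, [/\ nonneg d, k = lc d & 0 < d a]].
have full (L : seq V) : (forall a, a \in L -> J a) ->
    exists d, [/\ nonneg d, k = lc d & forall a, a \in L -> 0 < d a].
  elim: L => [|a L IH] hL; first by exists d0.
  have [b bL|d [dn kd dL]] := IH; first by apply: hL; rewrite inE bL orbT.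
  have [_ [d' [dn' kd' da]]] := hL a (mem_head _ _).
  exists (fun x => 2^-1 * (d x + d' x)); split.
  - by move=> x; rewrite mulr_ge0 // addr_ge0.
  - rewrite -lcZ -lcD -kd -kd' scalerDr -scalerDl.
    have -> : 2^-1 + 2^-1 = 1 :> R by field.
    by rewrite scale1r.
  - move=> x xL; apply: mulr_gt0 => //; move: xL.
    rewrite inE => /orP[/eqP ->|/dL]; first by rewrite ltr_wpDl.
    by move=> dx; rewrite ltr_pwDl.
pose LJ := [seq a <- P | `[< J a >]].
have [a|d' [dn' kd' dL']] := full LJ; first by rewrite mem_filter => /andP[/asboolP].
pose d x := if x \in P then d' x else 0.
have dn : nonneg d by move=> x; rewrite /d; case: ifP.
have kd : k = lc d by rewrite kd'; apply: eq_lc => x xP; rewrite /d xP.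
pose N := [seq a <- P | ~~ `[< J a >]].
pose Q c := Cc setT c /\ B k c = 0.
have kge c : Cc setT c -> 0 <= B k c.
  by move=> hc; rewrite form_sym; apply: Cc_cone => //; case: hk.
have [|||||c [hc kc] cN] := @combine V V N Q B.
- by split; [move=> a _ _|]; rewrite ?form0l ?form0r.
- move=> u v [u1 u2] [v1 v2]; split; last by rewrite formDr u2 v2 addr0.
  by move=> a aP _; rewrite formDl addr_ge0 ?u1 ?v1.
- by move=> a u v; rewrite formDr.
- by move=> a u; rewrite mem_filter => /andP[_ aP] [h _]; rewrite form_sym h.
- move=> j; rewrite mem_filter => /andP[/asboolPn nJ jP].
  (* [None] stands for [- k], which together with the chamber forces orthogonality to [k]. A
     certificate would write a positive multiple of [k] with [j] in its support. *)
  pose aa (t : option V) := if t is Some x then B x else B (- k).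
  have haa t : linform (aa t) by case: t => [x|]; exact: linform_form.
  have us : uniq (None :: map Some P).
    by rewrite /= map_inj_uniq ?uP; [rewrite andbT; apply/mapP => -[]|move=> x y []].
  case: (farkas us haa (linform_form (- j))) => [[q [q0 hq]]|[f [f0 fj]]].
    exfalso; apply: nJ.
    pose g x := if x \in P then q (Some x) + dlt j x else 0.
    have gn : nonneg g.
      move=> x; rewrite /g; case: ifP => // xP; rewrite addr_ge0 ?ler0n //.
      by apply: q0; rewrite inE map_f ?orbT.
    have gE : lc g = q None *: k.
      apply/eqP; rewrite -subr_eq0; apply/eqP/form_nondegenerate => y.
      have -> : lc g = lc (fun x => q (Some x)) + j.
        rewrite -[X in _ + X](lc_dlt jP) lcD; apply: eq_lc => x xP.
        by rewrite /g xP.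
      have := hq y; rewrite big_cons big_map /= !formE form_lcl; lra.
    have qN : 0 < q None.
      rewrite lt_neqAle q0 ?mem_head // andbT eq_sym; apply/negP => /eqP qz.
      have := pos_indep gn; rewrite gE qz scale0r => /(_ erefl j jP).
      rewrite /g jP /dlt eqxx => /eqP; rewrite paddr_eq0 ?oner_eq0 ?andbF //.
      by apply: q0; rewrite inE map_f ?orbT.
    split => //; exists (fun x => (q None)^-1 * g x); split.
    - by move=> x; rewrite mulr_ge0 // invr_ge0 ltW.
    - by rewrite -lcZ gE scalerA mulVf ?scale1r // gt_eqF.
    - rewrite mulr_gt0 ?invr_gt0 // /g jP /dlt eqxx ltr_wpDl //.
      by apply: q0; rewrite inE map_f ?orbT.
  have hf : Cc setT f.
    move=> x xP _; rewrite form_sym; apply: (f0 (Some x)).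
    by rewrite inE map_f ?orbT.
  exists f; last by move: fj; rewrite formNl oppr_lt0.
  split => //; apply/eqP; rewrite eq_le kge // andbT.
  by have := f0 None (mem_head _ _); rewrite /= formNl oppr_ge0.
have JE a : face_of c a <-> J a.
  split; last first.
    move=> [aP [e [e0 ke ea]]]; split => //.
    rewrite ke in kc; apply: form_lc_eq0 kc _ aP ea => x xP.
    by rewrite mulr_ge0 // form_sym hc.
  move=> [aP ac]; apply: contrapT => nJ.
  by have := cN a; rewrite mem_filter aP andbT ac ltxx => /(_ (introN (asboolP _) nJ)).
exists c, d; split => //; last first.
  split; last by move=> a aP _; case: hk => _; exact.
  by apply: cone_face => //; case: hk.
split => //.
  move=> a; rewrite /d; case: ifP => [aP da|]; last by rewrite eqxx.
  apply/JE; split => //; exists d'; split => //.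
  by rewrite lt_neqAle eq_sym da dn'.
move=> a aP /JE Ja; rewrite /d aP; apply: dL'; rewrite mem_filter aP andbT.
exact/asboolP.
Qed.

(** Only products with the roots of [L], those of [I] orthogonal to [k], can fail for small [e]. The
    infinite part of [L] is orthogonal to [z]; the rest generates a finite group that fixes [k] and
    can make the remaining products of [z] nonnegative. *)
Lemma Zc_interior I d z : fsupp I d -> Kc I (lc d) -> Zc I z ->
  exists2 e, 0 < e & Zc setT (lc d - e *: z).
Proof.
move=> fd kd hz; have [d0 dI dp] := fd; pose k := lc d.
pose L := [set a | I a /\ B k a = 0].
have [c fc kc] := infI_full L; have [c0 cJ cp] := fc.
have JL : infI L `<=` L by exact: infI_sub.
have kL a : a \in P -> L a -> B k a = 0 by move=> _ [].
(* The product of [k] and [lc c] is zero, while [k] has positive coefficients on [I] and [lc c] has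
   nonpositive products; so each product vanishes. *)
have IB i : i \in P -> I i -> B i (lc c) = 0.
  move=> iP Ii; have kb : B (lc d) (- lc c) = 0.
    rewrite formNr form_sym (@form_span0 L) ?oppr0 //.
      by move=> a aP La; rewrite form_sym kL.
    by exists c => // a /cJ /JL.
  have : B i (- lc c) = 0.
    apply: form_lc_eq0 kb _ iP (dp i iP Ii) => x xP.
    by rewrite mulr_ge0 // formNr oppr_ge0 form_sym; exact: Kc_le0 kc xP.
  by rewrite formNr => /eqP; rewrite oppr_eq0 => /eqP.
have Jperp i j : i \in P -> I i -> ~ infI L i -> j \in P -> infI L j -> B i j = 0.
  move=> iP Ii ni jP Jj; rewrite form_sym; apply: (form_lc_off0 fc iP ni) => //.
  by rewrite form_sym IB.
(* The null vector [lc c] makes the K-part [k'] orthogonal to [infI L]. Each letter of [u] then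
   fixes the vector or is itself orthogonal to [infI L]. *)
have zJ j : j \in P -> infI L j -> B z j = 0.
  move: hz => [u [k' [[s ws ->] hk' ->]]].
  have kJ' x : x \in P -> infI L x -> B k' x = 0.
    move=> xP Jx; have kb : B (lc c) (- k') = 0.
      rewrite formNr form_sym (@form_span0 I) ?oppr0 //.
      by apply: cone_span; case: hk'.
    have : B x (- k') = 0.
      apply: form_lc_eq0 kb _ xP (cp x xP Jx) => y yP.
      by rewrite mulr_ge0 // formNr oppr_ge0 form_sym; exact: Kc_le0 hk' yP.
    by rewrite formNr form_sym => /eqP; rewrite oppr_eq0 => /eqP.
  elim: s ws j => [|a s IH] ws j jP Jj; first by rewrite gprod_nil GL_oneE kJ'.
  move: ws => /word_consP[aP Ia ws]; rewrite gprod_cons GL_mulE.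
  have [Ja|Ja] := pselect (infI L a); first by rewrite refl_id (IH ws).
  rewrite reflE formDl formNl formZl (IH ws j jP Jj) (Jperp a j) //.
  by rewrite mulr0 subr0.
have [w hw hwz] := Wfin_descent (- z) (Wfin_compl L).
have LI : L `\` infI L `<=` I by move=> a [[]].
have hwI : Wg I w by exact: Wg_sub hw.
have wk : w k = k by apply: (Wg_fix hw) => a aP [La _]; exact: kL.
have [x xI wzE] : spanI I (w z) by apply: spanI_Wg => //; apply/cone_span/Zc_cone.
have [e1 e10 he1] := @finite_small _ [seq a <- P | `[< I a >]] d x
  (fun a => ltac:(by rewrite mem_filter => /andP[/asboolP Ia aP]; exact: dp)).
have [e2 e20 he2] := @finite_small _ [seq a <- P | B k a < 0] (fun a => - B k a)
  (fun a => - B (w z) a)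
  (fun a => ltac:(by rewrite mem_filter oppr_gt0 => /andP[])).
pose e := Num.min e1 e2.
have e0 : 0 < e by rewrite lt_min e10 e20.
have ee1 : e <= e1 by rewrite ge_min lexx.
have ee2 : e <= e2 by rewrite ge_min lexx orbT.
have small u p q : 0 < u -> e <= u -> 0 <= q -> u * p <= q -> e * p <= q.
  by move=> u0 eu q0 h; nra.
exists e => //.
have yE : w (k - e *: z) = k - e *: w z by rewrite !GL_linE wk.
have cy : cone I (k - e *: w z).
  rewrite wzE lcZ lcB; exists (fun a => if a \in P then d a - e * x a else 0); split.
  - move=> a; case: ifP => // aP; rewrite subr_ge0.
    have [Ia|Ia] := pselect (I a).
      apply: (small e1) => //; apply: he1; rewrite mem_filter aP andbT; exact/asboolP.
    have -> : x a = 0 by apply/eqP/negPn/negP => /xI.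
    by rewrite mulr0.
  - move=> a; case: ifP => [aP|]; last by rewrite eqxx.
    move=> h; apply: contrapT => Ia; move: h.
    have -> : x a = 0 by apply/eqP/negPn/negP => /xI.
    have -> : d a = 0 by apply/eqP/negPn/negP => /dI.
    by rewrite mulr0 subrr eqxx.
  - by apply: eq_lc => a ->.
have ky : Kc I (k - e *: w z).
  split => // a aP Ia; rewrite formDl formNl formZl.
  have [Ba|Ba] := ltP (B k a) 0.
    have : e * (- B (w z) a) <= - B k a.
      apply: (small e2) => //; first by rewrite oppr_ge0 ltW.
      by apply: he2; rewrite mem_filter Ba.
    by lra.
  have ka : B k a = 0 by apply/eqP; rewrite eq_le Ba (Kc_le0 kd aP).
  rewrite ka add0r; have [Ja|Ja] := pselect (infI L a).
    rewrite (isom_adjoint _ _ (Wg_isom hw)).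
    have -> : w^-1%g a = a.
      apply: (Wg_fix (WgV hw)) => b bP [Lb nb].
      by rewrite form_sym; apply: (infI_perp (I := L)).
    by rewrite zJ // mulr0 oppr0.
  have := hwz a aP (conj (conj Ia ka) Ja); rewrite GL_linN formNl => h.
  by nra.
have -> : lc d - e *: z = w^-1%g (k - e *: w z) by rewrite -yE GL_invK.
apply: Zc_Wg; first by apply: WgV; exact: Wg_sub hwI.
exact/Kc_Zc/Kc_sub/ky.
Qed.

(** Products where [c] is positive tolerate a small [e]; the hypothesis covers the infinite part of
    the stabilizer; the finite part can make its products with [x] nonpositive while fixing [c]. *)
Lemma Xc_interior c x : Cc setT c -> Xc x ->
  (forall a, a \in P -> infI (face_of c) a -> B x a = 0) ->
  exists2 e, 0 < e & Xc (c - e *: x).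
Proof.
move=> hc hx hJ; set I := face_of c in hJ *.
have [w hw hwx] := Wfin_descent x (Wfin_compl I).
have hwI : Wg I w by apply: Wg_sub hw => a [].
have [e e0 he] := @finite_small _ [seq a <- P | 0 < B c a] (fun a => B c a)
  (fun a => B (w x) a) (fun a => ltac:(by rewrite mem_filter => /andP[])).
exists e => //.
have -> : c - e *: x = w^-1%g (c - e *: w x).
  by rewrite -{2}(face_fix hwI) -GL_linZ -GL_linB GL_invK.
apply: Xc_Wg; first by apply: WgV; exact: Wg_sub hwI.
apply: Cc_Xc => a aP _; rewrite formDl formNl formZl subr_ge0.
have [ca|ca] := ltP 0 (B c a); first by apply: he; rewrite mem_filter ca.
have ca0 : B c a = 0 by apply/eqP; rewrite eq_le ca hc.
have Ia : I a by split => //; rewrite form_sym.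
rewrite ca0; have [Ja|Ja] := pselect (infI I a); last first.
  by rewrite mulr_ge0_le0 ?(ltW e0) // hwx.
rewrite (isom_adjoint _ _ (Wg_isom hw)).
have -> : w^-1%g a = a.
  apply: (Wg_fix (WgV hw)) => b bP [Lb nb].
  by rewrite form_sym; apply: (infI_perp (I := I)).
by rewrite hJ // mulr0.
Qed.

Lemma special_infI I : special (infI I).
Proof.
have [d fd kd] := infI_full I; exists d => //.
split; first by exists d; case: fd.
by move=> a aP /infI_sub Ia; case: kd => _; exact.
Qed.

(** A small multiple of the vector from [infI_compl], added to [c], makes the products with the
    finite components positive, leaves those with the infinite ones zero and keeps positive products
    positive. *)
Lemma facial_infI c : Cc setT c ->
  exists2 c', Cc setT c' & infI (face_of c) = face_of c'.
Proof.
move=> hc; set I := face_of c.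
have [d [d0 dI dp] hd] := infI_compl I.
have [e e0 he] := @finite_small _ [seq a <- P | 0 < B c a] (fun a => B c a / 2)
  (fun a => - B (lc d) a)
  (fun a => ltac:(by rewrite mem_filter => /andP[h _]; rewrite divr_gt0)).
have J0 a : a \in P -> infI I a -> B (c + e *: lc d) a = 0.
  move=> aP Ja; have [_ ca] := infI_sub Ja.
  rewrite formDl formZl (form_sym c) ca add0r (@form_span0 (I `\` infI I)) ?mulr0 //.
    by move=> b bP [Ib nb]; apply: (infI_perp (I := I)).
  by exists d.
have N0 a : a \in P -> ~ infI I a -> 0 < B (c + e *: lc d) a.
  move=> aP Ja; rewrite formDl formZl.
  have [ca|ca] := ltP 0 (B c a).
    by have := he a; rewrite mem_filter ca => /(_ aP); lra.
  have ca0 : B c a = 0 by apply/eqP; rewrite eq_le ca hc.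
  by rewrite ca0 add0r mulr_gt0 // hd //; split => //; rewrite form_sym.
exists (c + e *: lc d).
  move=> a aP _; have [Ja|Ja] := pselect (infI I a); first by rewrite J0.
  exact/ltW/N0.
rewrite eqEsubset; split => a.
  by move=> Ja; have [aP _] := infI_sub Ja; split => //; rewrite form_sym J0.
move=> [aP]; rewrite form_sym => z; apply: contrapT => Ja.
by have := N0 a aP Ja; rewrite z ltxx.
Qed.

(** * Faces of convex cones *)

Lemma convexP (A : set V) : @convex_set R V A <->
  (forall x y t, A x -> A y -> 0 <= t -> t <= 1 -> A (t *: x + (1 - t) *: y)).
Proof.
split=> h.
  move=> x y t Ax Ay t0 t1; have := h x y (Itv01 t0 t1); rewrite !inE.
  by apply.
move=> x y l; rewrite !inE => Ax Ay; exact: h.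
Qed.

Definition ccone (Y : set V) := [/\ Y 0, forall u v, Y u -> Y v -> Y (u + v) &
  forall k v, 0 <= k -> Y v -> Y (k *: v)].

Lemma pointed_coneP Y : pointed_cone Y <-> ccone Y.
Proof.
split.
  move=> [/convexP hc hs h0]; split => //.
    move=> u v hu hv.
    have -> : u + v = 2 *: (2^-1 *: u + (1 - 2^-1) *: v).
      rewrite scalerDr !scalerA; congr (_ + _).
        by rewrite divff ?scale1r.
      have -> : 2 * (1 - 2^-1) = 1 :> R by field.
      by rewrite scale1r.
    by apply: hs => //; apply: hc => //; rewrite ?invr_ge0 // invf_le1 // ler1n.
  move=> k v; rewrite le_eqVlt => /orP[/eqP <- _|k0 hv]; first by rewrite scale0r.
  exact: hs.
move=> [h0 hD hZ]; split => //.
  apply/convexP => x y t hx hy t0 t1; apply: hD; apply: hZ => //.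
  by rewrite subr_ge0.
by move=> c v c0; apply: hZ; exact: ltW.
Qed.

Lemma face_ccone Y F : ccone Y -> is_face Y F -> F !=set0 -> ccone F.
Proof.
move=> [Y0 YD YZ] [FY /convexP Fc Fe] [f Ff].
have F2 x : F x -> F (2 *: x) /\ F 0.
  move=> Fx; apply: (Fe _ _ 2^-1) => //.
  - by apply: YZ => //; exact: FY.
  - by rewrite invr_gt0 ltr0n invf_lt1 // ltr1n.
  - by rewrite scaler0 addr0 scalerA mulVf // scale1r.
have F0 : F 0 by have [] := F2 f Ff.
have F1 k x : 0 <= k -> k <= 1 -> F x -> F (k *: x).
  by move=> k0 k1 Fx; rewrite -[_ *: x]addr0 -(scaler0 _ (1 - k)); exact: Fc.
split => //.
  move=> u v hu hv.
  have -> : u + v = 2 *: (2^-1 *: u + (1 - 2^-1) *: v).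
    rewrite scalerDr !scalerA; congr (_ + _).
      by rewrite divff ?scale1r.
    have -> : 2 * (1 - 2^-1) = 1 :> R by field.
    by rewrite scale1r.
  apply: (F2 _ _).1.
  by apply: Fc => //; rewrite ?invr_ge0 // invf_le1 // ler1n.
move=> k v k0 Fv; have [k1|k1] := leP k 1; first exact: F1.
have kp : 0 < k by exact: lt_trans k1.
have [] // := Fe (k *: v) 0 k^-1.
- by apply: YZ => //; exact: FY.
- by rewrite invr_gt0 kp invf_lt1.
- by rewrite scaler0 addr0 scalerA mulVf ?gt_eqF // scale1r.
Qed.

Lemma face_summand Y F u v : ccone Y -> is_face Y F -> Y u -> Y v -> F (u + v) ->
  F u /\ F v.
Proof.
move=> cY fF Yu Yv Fuv; have cF : ccone F.
  by apply: face_ccone fF _ => //; exists (u + v).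
have [_ _ YZ] := cY; have [_ _ FZ] := cF; have [_ _ Fe] := fF.
have [||||h1 h2] := Fe (2 *: u) (2 *: v) 2^-1.
- exact: YZ.
- exact: YZ.
- by rewrite invr_gt0 ltr0n invf_lt1 // ltr1n.
- have -> : 1 - 2^-1 = 2^-1 :> R by field.
  by rewrite !scalerA mulVf // !scale1r.
have half x : F (2 *: x) -> F x.
  by move=> h; rewrite -[x]scale1r -(@mulVf R 2) // -scalerA; apply: FZ.
by split; exact: half.
Qed.

Lemma span_finite (F : set V) : exists s : seq V,
  (forall x, x \in s -> F x) /\ (forall v, F v -> v \in (span s)).
Proof.
pose D n := `[< exists s : seq V, (forall x, x \in s -> F x) /\ \dim (span s) = n >].
have D0 : D 0%N by apply/asboolP; exists [::]; rewrite span_nil dimv0.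
have Db n : D n -> (n <= \dim (fullv : {vspace V}))%N.
  by move=> /asboolP[s [_ <-]]; apply: dimvS; exact: subvf.
case: (ex_maxnP (ex_intro _ 0%N D0) Db) => n /asboolP[s [sF sn]] nmax.
exists s; split => // v Fv; apply/negPn/negP => vs.
have : D (\dim (span (v :: s))).
  apply/asboolP; exists (v :: s); split => // x.
  by rewrite inE => /orP[/eqP ->|/sF].
move=> /nmax; rewrite -sn leqNgt => /negP; apply.
rewrite span_cons ltn_neqAle dimvS ?addvSr // andbT.
apply/negP => /eqP e; move/negP: vs; apply.
have /eqP -> : (span s == <[v]> + span s)%VS by rewrite eqEdim addvSr -e leqnn.
exact: (subvP (addvSl _ _) v (memv_line v)).
Qed.

(** [p] is the sum of finitely many points spanning [F]. A point of [F] has coordinates of any sign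
    in them, but [1 - e * x i] is nonnegative for small [e]. Conversely [p] is the sum of
    [p - e *: z] and [e *: z], so the face contains both. *)
Lemma face_interior Y F : ccone Y -> is_face Y F -> F !=set0 ->
  exists2 p, F p & forall z, F z <-> Y z /\ exists2 e, 0 < e & Y (p - e *: z).
Proof.
move=> cY fF nF; have cF := face_ccone cY fF nF.
have [F0 FD FZ] := cF; have [FY _ _] := fF.
have [s [sF sp]] := span_finite F.
pose p := \sum_(x <- s) x.
have Fsum (c : 'I_(size s) -> R) : (forall i, 0 <= c i) -> F (\sum_i c i *: s`_i).
  move=> c0; apply: (big_ind F) => // i _; apply: FZ => //.
  by apply: sF; exact: mem_nth.
have pE : p = \sum_(i < size s) 1 *: s`_i.
  rewrite /p (big_nth 0) big_mkord; apply: eq_bigr => i _; by rewrite scale1r.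
exists p; first by rewrite pE; apply: (Fsum (fun=> 1)) => i; exact: ler01.
move=> z; split.
  move=> Fz; split; first exact: FY.
  pose x i := coord (in_tuple s) i z.
  have zE : z = \sum_(i < size s) x i *: s`_i by exact: (coord_span (X := in_tuple s) (sp z Fz)).
  have [e e0 he] := @finite_small _ (enum 'I_(size s)) (fun=> 1) x (fun _ _ => ltr01).
  exists e => //; apply: FY.
  rewrite zE pE scaler_sumr -sumrB.
  have -> : \sum_(i < size s) (1 *: s`_i - e *: (x i *: s`_i)) =
      \sum_(i < size s) (1 - e * x i) *: s`_i.
    by apply: eq_bigr => i _; rewrite scalerA scalerBl.
  by apply: Fsum => i; rewrite subr_ge0 he // mem_enum.
move=> [Yz [e e0 Ye]]; have [_ _ YZ] := cY.
have Fp : F (p - e *: z + e *: z) by rewrite subrK pE; apply: (Fsum (fun=> 1)) => i; exact: ler01.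
have [_ h] := face_summand cY fF Ye (YZ e z (ltW e0) Yz) Fp.
rewrite -[z]scale1r -(@mulVf R e) ?gt_eqF // -scalerA; apply: FZ => //.
by rewrite invr_ge0 ltW.
Qed.

Lemma perp1 z v : perp B [set z] v <-> B v z = 0.
Proof. by split=> [h|h a ->//]; apply: h. Qed.

Lemma exposed_face Y z : ccone Y -> (forall y, Y y -> 0 <= B y z) ->
  nonempty_faces Y (Y `&` perp B [set z]).
Proof.
move=> [Y0 YD YZ] h; split; last by exists 0; split => //; apply/perp1; rewrite form0l.
split; first by move=> y [].
  apply/convexP => x y t [Yx /perp1 xz] [Yy /perp1 yz] t0 t1; split.
    by apply: YD; apply: YZ => //; rewrite subr_ge0.
  by apply/perp1; rewrite formDl !formZl xz yz !mulr0 addr0.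
move=> y1 y2 t Y1 Y2 /andP[t0 t1] [_ /perp1]; rewrite formDl !formZl => e.
have h1 := h _ Y1; have h2 := h _ Y2.
split; split => //; apply/perp1; nra.
Qed.

(** By finite dimension, finitely many of the defining vectors span all of them. Products are
    nonnegative, so orthogonality to their sum means orthogonality to each. The empty sum accounts
    for [Y] itself. *)
Lemma semi_exposedE Y Y' : ccone Y -> ccone Y' ->
  (forall y y', Y y -> Y' y' -> 0 <= B y y') ->
  semi_exposed_faces B Y Y' = [set F | exists2 z, Y' z & F = Y `&` perp B [set z]].
Proof.
move=> cY [Y'0 Y'D Y'Z] h; rewrite eqEsubset; split=> F; last first.
  move=> [z Yz ->]; exists [set Y `&` perp B [set z]].
    by move=> _ ->; right; exists z.
  rewrite bigcap_set1 eqEsubset; split; first by move=> y [].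
  by move=> y [_].
move=> [E hE ->].
pose D := [set z | Y' z /\ E (Y `&` perp B [set z])].
have [s [sD sp]] := span_finite D.
exists (\sum_(x <- s) x).
  rewrite big_seq; apply: (big_ind Y') => // z /sD[]//.
rewrite eqEsubset; split=> y [Yy hy]; split => //.
  apply/perp1; rewrite form_sumr big_seq big1 // => x /sD[Yx Ex].
  by have [_ /perp1] := hy _ Ex.
have hs x : x \in s -> B y x = 0.
  move: hy => /perp1/eqP; rewrite form_sumr big_seq psumr_eq0.
    by move=> /allP h0 xs; have := h0 x xs; rewrite xs => /eqP.
  by move=> z /sD[Yz _]; exact: h.
move=> G EG; case: (hE _ EG) => [->//|[z Yz GE]]; rewrite GE in EG *.
split => //; apply/perp1.
have /sp zs : D z by [].
rewrite (coord_span (X := in_tuple s) zs) form_sym.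
have -> : B (\sum_(i < size s) coord (in_tuple s) i z *: (in_tuple s)`_i) y =
   \sum_(i < size s) B (coord (in_tuple s) i z *: (in_tuple s)`_i) y.
  by apply: (big_morph (fun x => B x y)) => [u v|]; [exact: formDl|exact: form0l].
by apply: big1 => i _; rewrite formZl form_sym hs ?mulr0 // mem_nth.
Qed.

Lemma face0 Y F : ccone Y -> nonempty_faces Y F -> F 0.
Proof. by move=> cY [fF nF]; have [] := face_ccone cY fF nF. Qed.

Lemma faces_complete Y : ccone Y -> complete_lattice (nonempty_faces Y) (fun F G => F `<=` G).
Proof.
move=> cY; have cYs := cY; case: cYs => [Y0 YD YZ].
have glb A : A `<=` nonempty_faces Y ->
    is_glb (nonempty_faces Y) (fun F G => F `<=` G) A (Y `&` \bigcap_(G in A) G).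
  move=> hA; split; last first.
  - move=> G [[GY _ _] _] hG y Gy; split; first exact: GY.
    by move=> H AH; exact: (hG H AH).
  - by move=> G AG y [_]; apply.
  split; last by exists 0; split => // G /hA; exact: face0.
  split; first by move=> y [].
    apply/convexP => x y t [Yx hx] [Yy hy] t0 t1; split.
      by apply: YD; apply: YZ => //; rewrite subr_ge0.
    move=> G AG; have [[_ /convexP Gc _] _] := hA _ AG.
    by apply: Gc => //; [exact: hx|exact: hy].
  move=> y1 y2 t h1 h2 t01 [_ hG].
  have key G : A G -> G y1 /\ G y2.
    by move=> AG; have [[_ _ Ge] _] := hA _ AG; apply: (Ge _ _ t) => //; exact: hG.
  by split; split => // G AG; have [] := key G AG.
split => //.
- by move=> F _; exact: subset_refl.
- by move=> F G _ _ FG GF; apply/seteqP; split.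
- by move=> F G H _ _ _ FG GH; exact: subset_trans GH.
move=> A hA; split; last by exists (Y `&` \bigcap_(G in A) G); exact: glb.
pose U := [set G | nonempty_faces Y G /\ forall H, A H -> H `<=` G].
have [h1 h2 h3] := glb U (fun G => @proj1 _ _).
exists (Y `&` \bigcap_(G in U) G); split => //.
- by move=> H AH; apply: h3; [exact: hA|move=> G [_]; apply].
- by move=> G hG hGA; apply: h2; split.
Qed.

Lemma complete_lattice_op T (Q : set T) le : complete_lattice Q le ->
  complete_lattice Q (fun x y => le y x).
Proof.
move=> [r a t c]; split => //.
- by move=> x y Qx Qy h1 h2; exact: a.
- by move=> x y z Qx Qy Qz h1 h2; exact: t h2 h1.
- by move=> A /c[].
Qed.

(** * Order isomorphisms of complete lattices *)

Section OrderIsomorphism.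
Variables (T U : Type) (D : set T) (leD : T -> T -> Prop) (Q : set U) (leQ : U -> U -> Prop).
Variable f : T -> U.
Hypothesis bij : set_bij D Q f.
Hypothesis mono : forall x y, D x -> D y -> (leD x y <-> leQ (f x) (f y)).

Lemma iso_lub A x : A `<=` D -> D x ->
  is_lub D leD A x <-> is_lub Q leQ (f @` A) (f x).
Proof.
have [fD _ fs] := bij; move=> AD Dx; split=> -[_ h1 h2].
  split; first exact: fD.
  - by move=> _ [a Aa <-]; apply/mono => //; [exact: AD|exact: h1].
  - move=> y Qy hy; have [z Dz zy] := fs y Qy; rewrite -zy in Qy hy *.
    apply/mono => //; apply: h2 => // a Aa; apply/mono => //; first exact: AD.
    by apply: hy; exists a.
split => //.
- by move=> a Aa; apply/mono => //; [exact: AD|apply: h1; exists a].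
- move=> y Dy hy; apply/mono => //; apply: h2; first exact: fD.
  by move=> _ [a Aa <-]; apply/mono => //; [exact: AD|exact: hy].
Qed.

End OrderIsomorphism.

(** Completeness is pulled back from [Q], so special facial subgroups need no lattice operations of
    their own. *)
Lemma order_iso T U (D : set T) leD (Q : set U) leQ f : complete_lattice Q leQ ->
  set_bij D Q f -> (forall x y, D x -> D y -> (leD x y <-> leQ (f x) (f y))) ->
  complete_lattice_iso D leD Q leQ f.
Proof.
move=> cQ bij mono; have [r a t c] := cQ; have [fD fi fs] := bij.
have mono' x y : D x -> D y -> (leD y x <-> leQ (f y) (f x)).
  by move=> Dx Dy; exact: mono.
have imD A : A `<=` D -> f @` A `<=` Q by move=> AD _ [x /AD Dx <-]; exact: fD.
split => //; last first.
  move=> A x AD; split=> h; have [Dx _ _] := h.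
    exact: (iso_lub bij mono AD Dx).1.
  exact: (iso_lub bij mono' AD Dx).1.
split.
- by move=> x Dx; apply/mono => //; exact/r/fD.
- move=> x y Dx Dy /mono xy /mono yx; apply: fi; rewrite ?inE //.
  by apply: a; [exact: fD|exact: fD|exact: xy|exact: yx].
- move=> x y z Dx Dy Dz /mono xy /mono yz; apply/mono => //.
  by apply: (t _ (f y)); [exact: fD|exact: fD|exact: fD|exact: xy|exact: yz].
move=> A AD; have [[y hy] [z hz]] := c _ (imD A AD).
split.
  have [Qy _ _] := hy; have [x Dx xy] := fs y Qy; exists x; rewrite -xy in hy.
  exact: (iso_lub bij mono AD Dx).2.
have [Qz _ _] := hz; have [x Dx xz] := fs z Qz; exists x; rewrite -xz in hz.
exact: (@iso_lub _ _ D (fun x y => leD y x) Q (fun x y => leQ y x) f bij mono' A x AD Dx).2 hz.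
Qed.

(** * Facial reflection subgroups *)

Lemma generatedE I : I `<=` [set` P] -> generated (refl B @` I) = [set w | Wg I w].
Proof.
move=> IP; have {1}-> : I = I `&` [set` P] by apply/esym/setIidl.
by apply/seteqP; split => w /Wg_weyl.
Qed.

Lemma weyl_groupE : weyl_group B [set` P] = [set w | Wg setT w].
Proof.
have -> : weyl_group B [set` P] = generated (refl B @` (setT `&` [set` P])).
  by rewrite setTI.
by apply/seteqP; split => w /Wg_weyl.
Qed.

Lemma positive_rootsE g : positive_roots B [set` P] g <-> root setT g /\ cone setT g.
Proof.
rewrite /positive_roots /Defs.roots weyl_groupE -[X in cone_hull X](setTI [set` P]) cone_hullE.
split; last first.
  by move=> [[w [a [hw aP _ ->]]] hc]; split => //; exists w => //; exists a.
by move=> [[w hw [a aP <-]] hc]; split => //; exists w, a.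
Qed.

Lemma refl_opp g : refl B (- g) = refl B g.
Proof.
apply: GL_ext => v; rewrite !reflE !formNr formNl opprK scalerN mulrN mulNr scaleNr.
by rewrite opprK.
Qed.

Lemma refl_eq g h : B g g = 1 -> B h h = 1 -> refl B g = refl B h -> g = h \/ g = - h.
Proof.
move=> g1 h1 e; have : refl B g g = refl B h g by rewrite e.
rewrite !reflE g1 h1 !divr1 mulr1 => /eqP; rewrite -subr_eq0 opprD opprK addrACA subrr add0r.
rewrite addrC subr_eq0 => /eqP gh.
have gE : g = B g h *: h.
  have := congr1 (fun x => 2^-1 *: x) gh; rewrite !scalerA mulrA mulVf // mul1r.
  by rewrite scale1r => ->.
move: g1; rewrite gE formZl formZr h1 mulr1 -expr2 => /eqP; rewrite sqrf_eq1.
by case/orP => /eqP ->; [left|right]; rewrite ?scale1r ?scaleN1r.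
Qed.

Lemma refl_inj g h : root setT g -> cone setT g -> root setT h -> cone setT h ->
  refl B g = refl B h -> g = h.
Proof.
move=> rg pg rh ph /(refl_eq (root_unit rg) (root_unit rh))[//|e].
by rewrite e in pg; case: (root_sign_excl (root_unit rh) ph pg).
Qed.

Lemma root_opp I g : root I g -> root I (- g).
Proof.
move=> [w [a [hw aP Ia ->]]]; exists (w * refl B a)%g, a; split => //.
  by apply: WgM => //; exact: Wg_refl.
by rewrite GL_mulE refl_self // GL_linN.
Qed.

Lemma refl_rootV g : B g g = 1 -> refl B g g = - g.
Proof.
move=> g1; rewrite reflE g1 divr1 mulr1 scaler_nat mulr2n opprD addrA subrr.
by rewrite add0r.
Qed.

Lemma root_Wg_refl I g : root I g -> Wg I (refl B g).
Proof.
move=> [u [a [hu aP Ia ->]]]; rewrite refl_conj; last exact: Wg_isom hu.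
by apply: WgM; [apply: WgM => //; exact: Wg_refl|exact: WgV].
Qed.

Lemma reflectionsE t : reflections S t <->
  exists g, [/\ root setT g, cone setT g & t = refl B g].
Proof.
have gE : generated S = [set w | Wg setT w] := weyl_groupE.
split.
  move=> [w + [_ [a aP <-] <-]]; rewrite gE => hw.
  have rg : root setT (w a) by exists w, a.
  rewrite -refl_conj; last exact: Wg_isom hw.
  case: (root_sign rg) => h; first by exists (w a).
  by exists (- w a); split; [exact: root_opp| |rewrite refl_opp].
move=> [g [[w [a [hw aP _ ->]]] _ ->]]; exists w; first by rewrite gE.
by exists (refl B a); [exists a|rewrite refl_conj //; exact: Wg_isom hw].
Qed.

Lemma inversions_refl g h : root setT g -> root setT h -> cone setT h ->
  inversions S (refl B g) (refl B h) <-> cone setT (- refl B g h).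
Proof.
move=> rg rh ph; split.
  by move=> [_ /(len_reflE (root_Wg_refl rg) rh ph)]; rewrite reflV.
move=> n; split; first by apply/reflectionsE; exists h.
by apply/len_reflE => //; [exact: root_Wg_refl|rewrite reflV].
Qed.

(** A reflection negates its root, so [crossing] finds this root along a word of the reflection with
    letters in [I]. *)
Lemma root_in_Wg I g : root setT g -> Wg I (refl B g) -> root I g.
Proof.
have pos h : root setT h -> cone setT h -> Wg I (refl B h) -> root I h.
  move=> rh ph [s ws e].
  have n : cone setT (- (gprod s)^-1%g h).
    by rewrite -e reflV refl_rootV ?opprK //; exact: root_unit rh.
  have [u [a [v [sE ->]]]] := crossing ws rh ph n.
  move: ws; rewrite sE => /word_catP[wu /word_consP[aP Ia _]].
  by exists (gprod u), a; split => //; exists u.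
move=> rg hg; case: (root_sign rg) => h; first exact: pos.
by rewrite -[g]opprK; apply: root_opp; apply: pos; rewrite ?refl_opp //; exact: root_opp.
Qed.

Lemma cone_extreme f a : nonneg f -> a \in P -> lc f = a ->
  forall b, b \in P -> b != a -> f b = 0.
Proof.
move=> f0 aP fa.
have e : lc (fun x => f x - dlt a x) = 0 by rewrite -lcB fa lc_dlt // subrr.
have [f1|f1] := leP 1 (f a).
  have n : nonneg (fun x => f x - dlt a x).
    move=> x; rewrite /dlt; have [->|xa] := eqVneq x a; first by rewrite subr_ge0.
    by rewrite subr0.
  by move=> b bP ba; have := pos_indep n e bP; rewrite /dlt (negbTE ba) subr0.
exfalso; have := form_lcl (fun x => f x - dlt a x) a; rewrite e form0l => /esym.
have daa : dlt a a = 1 by rewrite /dlt eqxx.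
rewrite (bigD1_seq a) ?uP //= daa unit_root // mulr1.
have : \sum_(i <- P | i != a) (f i - dlt a i) * B i a <= 0.
  rewrite big_seq_cond sumr_le0 // => b /andP[bP ba].
  by rewrite mulr_ge0_le0 // ?form_le0 // /dlt (negbTE ba) subr0.
by move: f1; lra.
Qed.

(** A shortest element of the coset is not shortened by a reflection of [I], so [reduced_pos]
    applies to it. *)
Lemma min_coset I w : Wg setT w -> exists w' u,
  [/\ Wg setT w', Wg I u, w = (w' * u)%g & forall a, a \in P -> I a -> cone setT (w' a)].
Proof.
move=> hw.
pose D n := `[< exists s u, [/\ reduced setT s, Wg I u, gprod s = (w * u)%g & size s = n] >].
have ex : exists n, D n.
  have [s rs ws] := reduced_ex hw; exists (size s); apply/asboolP; exists s, 1%g.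
  by split => //; [exact: Wg1|rewrite mulg1].
case: (ex_minnP ex) => n /asboolP[s [u [rs hu su sn]]] nmin.
exists (gprod s), u^-1%g; split.
- by exists s => //; exact: rs.1.
- exact: WgV.
- by rewrite su mulgK.
move=> a aP Ia; apply: reduced_pos => // t wt e.
have [t' rt' e'] := reduced_ex (ex_intro2 _ _ t wt erefl : Wg setT (gprod t)).
apply: leq_trans (rt'.2 t wt e'); rewrite sn; apply: nmin; apply/asboolP.
exists t', (u * refl B a)%g; split => //; last by rewrite -e' e su mulgA.
by apply: WgM => //; exact: Wg_refl.
Qed.

(** * Canonical generators and cones of conjugate parabolic subgroups *)

Section Conjugate.
Variables (w : GL V) (I : set V).
Hypotheses (hw : Wg setT w) (IP : I `<=` [set` P]).
Hypothesis wI : forall a, I a -> cone setT (w a).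

Let H : set (GL V) := conjugate_subgroup w [set u | Wg I u].

Let isow : isom w. Proof. exact: Wg_isom hw. Qed.

Lemma conj_cone v : cone I v -> cone setT (w v).
Proof.
move=> [d [d0 dI ->]]; rewrite /lc.
apply: (big_ind (fun v => cone setT (w v))).
- by rewrite GL_lin0; exact: cone0.
- by move=> x y hx hy; rewrite GL_linD; exact: coneD.
- move=> a _; rewrite GL_linZ; case: (eqVneq (d a) 0) => [->|/dI Ia].
    by rewrite scale0r; exact: cone0.
  by apply: coneZ => //; exact: wI.
Qed.

Lemma conj_mem g : root setT g -> cone setT g -> H (refl B g) ->
  exists d, [/\ root I d, cone I d & g = w d].
Proof.
move=> rg pg [u hu e].
have rd : root setT (w^-1%g g) by apply: root_Wg rg; exact: WgV.
have dE : refl B (w^-1%g g) = u.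
  by rewrite refl_conj ?invgK -?e; [rewrite !mulgA mulVg mul1g mulgVK|exact: isomV].
have rI : root I (w^-1%g g) by apply: root_in_Wg rd _; rewrite dE.
exists (w^-1%g g); split => //; last by rewrite GL_Kinv.
case: (root_sign rI) => // /conj_cone; rewrite GL_linN GL_Kinv => n.
by case: (root_sign_excl (root_unit rg) pg n).
Qed.

Lemma conj_refl_mem d : root I d -> H (refl B (w d)).
Proof. by move=> rd; exists (refl B d); [exact: root_Wg_refl|rewrite refl_conj]. Qed.

Lemma conj_root d : root I d -> root setT (w d).
Proof. by move=> rd; apply: root_Wg => //; apply: root_sub rd. Qed.

Lemma conj_refl_act d e : isom w -> refl B (w d) (w e) = w (refl B d e).
Proof. by move=> iw; rewrite refl_conj // !GL_mulE GL_invK. Qed.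

(** Let [w d] be the root of a generator; as [B d d = 1], some [a] in [I] has [0 < B d a]. If the
    reflection in [d] keeps [a] positive, extremality of [a] gives [d = a]; otherwise the reflection
    in [w a] is an inversion in [H], hence the generator itself. Conversely, [refl_neg_simple]
    leaves a single inversion in [H]. *)
Lemma canonical_generatorsE :
  canonical_generators S H = (fun a => refl B (w a)) @` I.
Proof.
apply/seteqP; split => t.
  move=> [/reflectionsE[g [rg pg ->]] e].
  have [_ Hg] : (inversions S (refl B g) `&` H) (refl B g) by rewrite e.
  have [d [rd pd gE]] := conj_mem rg pg Hg.
  have d1 := root_unit rd.
  have [a [aP Ia da]] : exists a, [/\ a \in P, I a & 0 < B d a].
    apply: contrapT => no; have : B d d <= 0.
      apply: form_cone_le0 pd => a aP Ia; rewrite form_sym leNgt; apply/negP => lt.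
      by apply: no; exists a.
    by rewrite d1 ler10.
  suff ad : a = d by exists a; rewrite ?gE ?ad -?ad.
  have ra : root I a by exact: root_gen.
  case: (root_sign (root_Wg (root_Wg_refl rd) ra)) => h.
    have [p [p0 pI pE]] := h; have [q [q0 qI dE]] := pd.
    rewrite reflE d1 divr1 in pE.
    pose x := 2 * B a d; have x0 : 0 < x by rewrite mulr_gt0 // form_sym.
    have aE : lc (fun y => p y + x * q y) = a.
      by rewrite -lcD -lcZ -pE -dE subrK.
    have fn : nonneg (fun y => p y + x * q y).
      by move=> y; apply: addr_ge0 => //; apply: mulr_ge0 (q0 y); exact: ltW.
    have q0' b : b \in P -> b != a -> q b = 0.
      move=> bP ba; have /eqP := cone_extreme fn aP aE bP ba.
      have xq : 0 <= x * q b by apply: mulr_ge0 (q0 b); exact: ltW.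
      rewrite paddr_eq0 // => /andP[_].
      by rewrite mulf_eq0 (gt_eqF x0) => /eqP.
    have dqa : d = q a *: a.
      rewrite dE -[X in _ *: X](lc_dlt aP) lcZ; apply: eq_lc => b bP; rewrite /dlt.
      have [->|ba] := eqVneq b a; first by rewrite mulr1.
      by rewrite mulr0 q0'.
    move: d1; rewrite dqa formZl formZr unit_root // mulr1 -expr2 => /eqP.
    rewrite sqrf_eq1 => /orP[/eqP ->|/eqP e1]; first by rewrite scale1r.
    by have := q0 a; rewrite e1 oppr_ge0 ler10.
  have inv : inversions S (refl B g) (refl B (w a)).
    apply/inversions_refl => //; [exact: conj_root|exact: wI|].
    by rewrite gE conj_refl_act // -GL_linN; exact: conj_cone.
  have : (inversions S (refl B g) `&` H) (refl B (w a)).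
    by split => //; exact: conj_refl_mem.
  rewrite e /= gE => /refl_inj h'.
  have wad : w a = w d.
    by apply: h'; [exact: conj_root|exact: wI|exact: conj_root|rewrite -gE].
  by rewrite -(GL_invK w a) wad GL_invK.
move=> [a Ia <-]; have aP : a \in P := IP Ia.
have ra : root I a by exact: root_gen.
have rwa := conj_root ra; have pwa := wI Ia.
split; first by apply/reflectionsE; exists (w a).
apply/seteqP; split => t1; last first.
  move=> ->; split; last exact: conj_refl_mem.
  by apply/inversions_refl => //; rewrite refl_rootV ?opprK //; exact: root_unit rwa.
move=> [inv Ht]; have [/reflectionsE[h [rh ph t1E]] _] := inv.
rewrite t1E in inv Ht *; have [d [rd pd hE]] := conj_mem rh ph Ht.
move: inv => /(inversions_refl rwa rh ph); rewrite hE conj_refl_act // => n.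
have rad : root I (refl B a d) by apply: root_Wg rd; exact: Wg_refl.
suff -> : d = a by [].
case: (root_sign rad) => c.
  case: (root_sign_excl (root_unit (conj_root rad)) (conj_cone c) n).
apply: refl_neg_simple => //; first exact: root_unit rd.
  by apply: cone_sub pd.
by apply: cone_sub c.
Qed.

Lemma simple_rootsE : simple_roots B [set` P] H = [set w a | a in I].
Proof.
apply/seteqP; split => g.
  move=> [/positive_rootsE[rg pg]]; rewrite /simple_reflections canonical_generatorsE.
  move=> [a Ia e]; exists a => //.
  have ra : root I a by apply: root_gen => //; exact: IP.
  by apply: refl_inj => //; [exact: conj_root|exact: wI].
move=> [a Ia <-]; split.
  apply/positive_rootsE; split; last exact: wI.
  by apply: conj_root; apply: root_gen => //; exact: IP.
by rewrite /simple_reflections canonical_generatorsE; exists a.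
Qed.

Lemma cone_hull_conj v : cone_hull [set w a | a in I] v <-> cone I (w^-1%g v).
Proof.
split.
  move=> [F [c [FI c0 ->]]].
  rewrite big_seq; apply: (big_ind (fun x => cone I (w^-1%g x))).
  - by rewrite GL_lin0; exact: cone0.
  - by move=> x y hx hy; rewrite GL_linD; exact: coneD.
  - move=> x xF; rewrite GL_linZ; apply: coneZ; first exact: c0.
    have [a Ia <-] := FI x xF; rewrite GL_invK; apply: cone_gen => //; exact: IP.
move=> [d [d0 dI vE]].
pose L := [seq w a | a <- P & d a != 0].
have wK : injective w by move=> x y e; rewrite -(GL_invK w x) e GL_invK.
have uL : uniq L by rewrite map_inj_uniq ?filter_uniq ?uP.
exists [fset x in L]%fset, (fun x => d (w^-1%g x)); split.
- move=> x /=; rewrite !inE /= => /mapP[a]; rewrite mem_filter => /andP[da _] ->.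
  by exists a => //; exact: dI.
- by move=> x _; exact: d0.
have -> : v = \sum_(a <- P) d a *: w a.
  rewrite -(GL_Kinv w v) vE /lc (big_morph w (@GL_linD w) (GL_lin0 w)).
  by apply: eq_bigr => a _; rewrite GL_linZ.
rewrite [LHS](bigID (fun a => d a != 0)) /= [X in _ + X]big1 ?addr0; last first.
  by move=> a; rewrite negbK => /eqP ->; rewrite scale0r.
transitivity (\sum_(x <- L) d (w^-1%g x) *: x).
  rewrite /L big_map -[LHS]big_filter; apply: eq_bigr => a _.
  by rewrite GL_invK.
apply: perm_big; apply: uniq_perm => //; first exact: fset_uniq.
by move=> x; rewrite !inE.
Qed.

Lemma kconeE : kcone B [set` P] H = [set w k | k in Kc I].
Proof.
apply/seteqP; split => v; rewrite /kcone /chamber simple_rootsE.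
  move=> [/cone_hull_conj h1 h2]; exists (w^-1%g v); last by rewrite GL_Kinv.
  split => // a aP Ia; rewrite -oppr_ge0 -formNl -isow GL_linN GL_Kinv.
  by apply: h2; exists a.
move=> [k [h1 h2] <-]; split; first by apply/cone_hull_conj; rewrite GL_invK.
by move=> _ [a Ia <-]; rewrite formNl isow oppr_ge0 h2 //; exact: IP.
Qed.

Lemma imaginary_coneE : imaginary_cone B [set` P] H = [set w z | z in Zc I].
Proof.
apply/seteqP; split => v; rewrite /imaginary_cone kconeE.
  move=> [_ [u hu <-] [_ [k hk <-] <-]]; exists (u k).
    by exists u, k.
  by rewrite !GL_mulE GL_invK.
move=> [_ [u [k [hu hk ->]]] <-].
exists (w * u * w^-1)%g; first by exists u.
exists (w k); first by exists k.
by rewrite !GL_mulE GL_invK.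
Qed.

Lemma commute_refl a b : a \in P -> b \in P -> I a -> I b ->
  commute (refl B (w a)) (refl B (w b)) <-> a = b \/ B a b = 0.
Proof.
move=> aP bP Ia Ib; split.
  move=> c; have e : refl B (refl B (w a) (w b)) = refl B (w b).
    rewrite refl_conj; last by move=> x y; exact: refl_isom.
    by rewrite c mulgK.
  have a1 := unit_root aP; have b1 := unit_root bP.
  rewrite conj_refl_act // in e.
  have := refl_eq _ _ e; rewrite !isow refl_isom b1 => /(_ erefl erefl).
  have wK : injective w by move=> x y exy; rewrite -(GL_invK w x) exy GL_invK.
  rewrite -GL_linN => -[/wK|/wK]; rewrite reflE a1 divr1.
    move=> /eqP; rewrite -subr_eq0 addrAC subrr add0r oppr_eq0 scaler_eq0.
    case/orP => [/eqP h|/eqP a0]; first by right; rewrite form_sym; lra.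
    by move: a1; rewrite a0 form0l => /esym/eqP; rewrite oner_eq0.
  move=> h; left.
  have bE : b = B b a *: a.
    have : 2 *: b = 2 *: (B b a *: a).
      move/eqP: h; rewrite subr_eq addrC -subr_eq opprK => /eqP h.
      by rewrite scalerA -h scaler_nat mulr2n.
    by move=> /(congr1 (fun x => 2^-1 *: x)); rewrite !scalerA mulrA mulVf // mul1r scale1r.
  have := form_le0 aP bP; have := b1; rewrite {1 2}bE formZl formZr a1 mulr1 -expr2.
  move=> /eqP; rewrite sqrf_eq1 => /orP[/eqP h1|/eqP h1] _.
    by rewrite bE h1 scale1r.
  have : a + b = 0 by rewrite bE h1 scaleN1r subrr.
  move=> ab0; have : a = 0.
    apply: (@cone_antisym setT); first exact: cone_gen.
    by have -> : - a = b; [apply/eqP; rewrite eq_sym -addr_eq0 addrC ab0|exact: cone_gen].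
  by move=> a0; move: a1; rewrite a0 form0l => /esym/eqP; rewrite oner_eq0.
move=> [->//|ab]; rewrite /commute.
have fix_b : refl B (w a) (w b) = w b.
  by rewrite refl_id // isow form_sym.
have iwa : isom (refl B (w a)) by move=> x y; exact: refl_isom.
by rewrite -{2}fix_b (refl_conj (w b) iwa) mulgVK.
Qed.

(** By [infI_perp], the Coxeter component of a simple root outside [infI I] stays outside, where the
    group is finite by [Wfin_compl]. So without finite components [infI I] is all of [I]. *)
Lemma special_components :
  (forall J, irreducible_components (canonical_generators S H) J -> ~ finite_set J) <->
  special I.
Proof.
rewrite canonical_generatorsE; set C := (X in irreducible_components X).
have finC (I0 : set V) D : I0 `<=` I -> D = (fun a => refl B (w a)) @` I0 ->
    (finite_set (generated D) <-> Wfin I0).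
  move=> I0I ->.
  have -> : generated ((fun a => refl B (w a)) @` I0) =
            (fun u => w * u * w^-1)%g @` [set u | Wg I0 u].
    apply/seteqP; split.
      apply: smallest_sub.
        split.
          by rewrite inE; exists 1%g; [exact: Wg1|rewrite mulg1 mulgV].
        move=> _ _ /set_mem[x hx <-] /set_mem[y hy <-]; apply/mem_set.
        exists (x * y^-1)%g; first by apply: WgM => //; exact: WgV.
        by rewrite !invgM invgK !mulgA mulgVK.
      move=> _ [a Ia <-]; exists (refl B a); last by rewrite refl_conj.
      by apply: Wg_refl => //; apply/IP/I0I.
    move=> _ [_ [s ws ->] <-] G [[G1 GD] GS].
    have GM x y : G x -> G y -> G (x * y)%g.
      move=> hx hy; have h1 : (1%g : GL V) \in mem G by [].
      have := GD 1%g y h1; rewrite !inE => /(_ hy) hy1.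
      by have := GD x (1 / y)%g; rewrite !inE div1g invgK; apply=> //; rewrite -div1g.
    elim: s ws => [|a s IH] ws.
      by rewrite gprod_nil mulg1 mulgV; move: G1; rewrite inE.
    move: ws => /word_consP[aP Ia ws]; rewrite gprod_cons.
    have -> : (w * (refl B a * gprod s) * w^-1 =
               (w * refl B a * w^-1) * (w * gprod s * w^-1))%g.
      by rewrite !mulgA mulgVK.
    by apply: GM (IH ws); rewrite -refl_conj //; apply: GS; exists a.
  rewrite Wfin_finite; split; last exact: finite_image.
  move=> /(finite_image (fun u => w^-1 * u * w)%g); rewrite image_comp.
  apply: sub_finite_set => u hu; exists u => //=.
  by rewrite !mulgA mulVg mul1g mulgVK.
have edge a b : a \in P -> b \in P -> I a -> I b -> a <> b -> B a b <> 0 ->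
    coxeter_edge C (refl B (w a)) (refl B (w b)).
  move=> aP bP Ia Ib ab Bab; split; [by exists a|by exists b|].
  by move=> /(commute_refl aP bP Ia Ib)[].
have reach a t : I a -> clos_refl_trans _ (coxeter_edge C) (refl B (w a)) t -> C t.
  move=> Ia h; have Ca : C (refl B (w a)) by exists a.
  by elim: h Ca => // [x y []|x y z _ h1 _ h2 /h1 /h2].
split.
  move=> h; have E : infI I = I; last by have := special_infI I; rewrite E.
  apply/seteqP; split => [|a Ia]; first exact: infI_sub.
  apply: contrapT => na; pose D := I `\` infI I.
  pose CC := [set t | clos_refl_trans _ (coxeter_edge C) (refl B (w a)) t].
  pose I0 := [set b | D b /\ CC (refl B (w b))].
  have CD t : CC t -> exists2 b, D b & t = refl B (w b).
    move=> ht; have : exists2 b, D b & refl B (w a) = refl B (w b) by exists a.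
    elim: ht => // [x y [_ [b Ib <-] nc]|x y z _ h1 _ h2 /h1 /h2 //].
    move=> [b' [Ib' nb'] xE]; exists b => //; split => // ib; apply: nc.
    rewrite xE; apply/commute_refl => //; [exact: IP|exact: IP|right].
    by apply: (infI_perp (I := I)) => //; exact: IP.
  apply: (h (generated CC)); first by exists (refl B (w a)) => //; exists a.
  apply/(finC I0).
  - by move=> b [[]].
  - apply/seteqP; split => t.
      by move=> ht; have [b Db tE] := CD t ht; exists b => //; split => //; rewrite -tE.
    by move=> [b [_ hb] <-].
  - have [L hL] := Wfin_compl I; exists L => u hu; apply: hL.
    by apply: Wg_sub hu => b [].
move=> [d fd kd] J [_ [a Ia <-]]; have [d0 dI dp] := fd.
set CC := [set t | _] => <-.
pose I0 := [set b | I b /\ CC (refl B (w b))].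
have I0I : I0 `<=` I by move=> b [].
have CE : CC = (fun a => refl B (w a)) @` I0.
  apply/seteqP; split => t; last by move=> [b [_ hb] <-].
  by move=> ht; have [b Ib tE] := reach a t Ia ht; exists b => //; split => //; rewrite tE.
move=> /(finC I0 CC I0I CE) fin.
have I0a : I0 a by split => //; exact: rt_refl.
have aP : a \in P by exact: IP.
pose d' x := if `[< I0 x >] then d x else 0.
have d'0 : nonneg d' by move=> x; rewrite /d'; case: ifP.
have d'I : supp_in I0 d' by move=> x; rewrite /d'; case: ifP => [/asboolP//|]; rewrite eqxx.
have k0 : Kc I0 (lc d').
  split; first by exists d'.
  move=> b bP I0b; have [Ib cb] := I0b.
  suff -> : B (lc d') b = B (lc d) b by case: kd => _; exact.
  apply/eqP; rewrite -subr_eq0 -formNl -formDl lcB; apply/eqP.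
  apply: (@form_span0 [set x | I x /\ ~ I0 x]); last first.
    exists (fun x => d' x - d x) => // x /= nx.
    have n0 : ~ I0 x by move=> hx; move: nx; rewrite /d' asboolT // subrr eqxx.
    by split => //; move: nx; rewrite /d' asboolF // sub0r oppr_eq0 => /dI.
  move=> x xP [Ix nx]; have bx : b <> x by move=> e; apply: nx; rewrite -e.
  apply: contrapT => Bxb; apply: nx; split => //.
  apply: rt_trans cb _; apply: rt_step; apply: edge => //.
  by rewrite form_sym.
(* On a finite component some [u] makes [rho] nonpositive, so the image of [lc d'] under [u^-1] has
   height at most 0; but this image is at least as high as [lc d'], whose height is positive. *)
have [rho hr] := interior_ex.
have [u hu un] := Wfin_descent rho fin.
have h1 : B rho (u^-1%g (lc d')) <= 0.
  rewrite -(isom_adjoint _ _ (Wg_isom hu)) form_sym.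
  apply: (@form_cone_le0 I0); last by case: k0.
  by move=> b bP Ib; rewrite form_sym un.
have h2 : 0 <= B rho (u^-1%g (lc d') - lc d').
  by apply: (@height_cone_ge0 rho I0) => //; apply: Kc_Wg_cone => //; exact: WgV.
have h3 : 0 < B rho (lc d').
  rewrite form_lcr (bigD1_seq a) ?uP //= ltr_pwDl //.
    rewrite mulr_gt0 //; first by rewrite /d' asboolT //; exact: dp.
    exact: lt_le_trans (hr a aP).
  rewrite big_seq_cond sumr_ge0 // => b /andP[bP _].
  by rewrite mulr_ge0 // (le_trans _ (hr b bP)).
by move: h2; rewrite formDr formNr; lra.
Qed.

End Conjugate.

(** * The cones and facial subgroups of the statement in terms of words *)

Lemma Wg_P : Wg [set` P] = Wg setT.
Proof.
by apply/funext => w; apply/propext; split=> -[s ws ->]; exists s => // a /ws[].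
Qed.

Lemma simple_roots_weyl : simple_roots B [set` P] (weyl_group B [set` P]) = [set` P].
Proof.
have -> : weyl_group B [set` P] = conjugate_subgroup 1%g [set u | Wg [set` P] u].
  rewrite weyl_groupE Wg_P; apply/seteqP; split => w.
    by move=> hw; exists w => //; rewrite mul1g invg1 mulg1.
  by move=> [u hu <-]; rewrite mul1g invg1 mulg1.
rewrite simple_rootsE //; last 2 first.
- exact: Wg1.
- by move=> a aP; rewrite GL_oneE; exact: cone_gen.
apply/seteqP; split => a; first by move=> [b bP <-]; rewrite GL_oneE.
by move=> aP; exists a => //; rewrite GL_oneE.
Qed.

Lemma chamberE : chamber B [set` P] (weyl_group B [set` P]) = Cc setT.
Proof.
rewrite /chamber simple_roots_weyl; apply/seteqP; split => v h.
  by move=> a aP _; exact: h.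
by move=> a aP; exact: h.
Qed.

Lemma tits_coneE : tits_cone B [set` P] = Xc.
Proof.
rewrite /tits_cone chamberE weyl_groupE; apply/seteqP; split => v.
  by move=> [w hw [c hc <-]]; exists w, c.
by move=> [w [c [hw hc ->]]]; exists w => //; exists c.
Qed.

Lemma imaginary_cone_weylE : imaginary_cone B [set` P] (weyl_group B [set` P]) = Zc setT.
Proof.
rewrite /imaginary_cone /kcone chamberE simple_roots_weyl weyl_groupE.
rewrite -[X in cone_hull X](setTI [set` P]) cone_hullE.
have -> : cone setT `&` [set v | Cc setT (- v)] = Kc setT.
  apply/seteqP; split => v [h1 h2]; split => // a aP aT.
    by rewrite -oppr_ge0 -formNl h2.
  by rewrite formNl oppr_ge0 h2.
apply/seteqP; split => v; first by move=> [w hw [k hk <-]]; exists w, k.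
by move=> [w [k [hw hk ->]]]; exists w => //; exists k.
Qed.

Lemma face_of_sub c : face_of c `<=` [set` P].
Proof. by move=> a []. Qed.

(** The conjugator is normalized to keep [face_of c] positive. Then [w c] exposes the face of Z that
    belongs to [H], and [w (lc d)] the face of X. *)
Definition special_data (H : set (GL V)) (w : GL V) (c : V) (d : V -> R) :=
  [/\ Wg setT w, Cc setT c, (forall a, face_of c a -> cone setT (w a)),
      fsupp (face_of c) d /\ Kc (face_of c) (lc d) &
      H = conjugate_subgroup w [set u | Wg (face_of c) u]].

Lemma special_facialE H : special_facial B [set` P] H <->
  exists w c d, special_data H w c d.
Proof.
split.
  move=> [[w [W1 [+ [Pi' [c + ->] ->] +]]] hJ].
  rewrite chamberE weyl_groupE => hw hc HE.
  have faceE : [set` P] `&` perp B [set c] = face_of c.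
    apply/seteqP; split => a [aP h]; split => //; first exact: h.
    by move=> _ ->.
  rewrite faceE generatedE in HE; last exact: face_of_sub.
  have [w' [u [hw' hu wE pos]]] := min_coset (face_of c) hw.
  have HE' : H = conjugate_subgroup w' [set u | Wg (face_of c) u].
    rewrite HE wE; apply/seteqP; split => _ [v hv <-].
      exists (u * v * u^-1)%g; last by rewrite invgM !mulgA.
      by apply: WgM; [exact: WgM|exact: WgV].
    exists (u^-1 * v * u)%g; last by rewrite invgM !mulgA !mulgK.
    by apply: WgM => //; apply: WgM => //; exact: WgV.
  have pos' a : face_of c a -> cone setT (w' a) by move=> fa; apply: pos => //; case: fa.
  have [d fd kd] : special (face_of c).
    apply/(special_components hw' (@face_of_sub c) pos').
    by rewrite -HE'; exact: hJ.
  by exists w', c, d.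
move=> [w [c [d [hw hc pos [fd kd] HE]]]]; split; last first.
  rewrite HE; apply/(special_components hw (@face_of_sub c) pos).
  by exists d.
exists w, [set u | Wg (face_of c) u]; split => //; first by rewrite weyl_groupE.
exists (face_of c); last by rewrite generatedE //; exact: face_of_sub.
exists c; first by rewrite chamberE.
apply/seteqP; split => a [aP h]; split => //; last exact: h.
by move=> _ ->.
Qed.

Lemma special_data_ex w c : Wg setT w -> Cc setT c -> special (face_of c) ->
  exists H w' d, special_data H w' c d /\
    exists2 u, Wg (face_of c) u & w = (w' * u)%g.
Proof.
move=> hw hc [d fd kd].
have [w' [u [hw' hu wE pos]]] := min_coset (face_of c) hw.
exists (conjugate_subgroup w' [set u | Wg (face_of c) u]), w', d; split; last by exists u.
by split => // a fa; apply: pos => //; case: fa.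
Qed.

Section Data.
Variables (H : set (GL V)) (w : GL V) (c : V) (d : V -> R).
Hypothesis hD : special_data H w c d.

Let hw : Wg setT w. Proof. by case: hD. Qed.
Let hc : Cc setT c. Proof. by case: hD. Qed.
Let iw : isom w. Proof. exact: Wg_isom hw. Qed.

Lemma data_Zc : Zc setT (w (lc d)).
Proof.
by case: hD => _ _ _ [_ kd] _; apply: Zc_Wg => //; apply/Kc_Zc/Kc_sub/kd.
Qed.

Lemma data_Xc : Xc (w c).
Proof. by apply: Xc_Wg => //; exact: Cc_Xc. Qed.

Lemma data_imaginary_cone :
  imaginary_cone B [set` P] H = Zc setT `&` perp B [set w c].
Proof.
have [_ _ pos _ ->] := hD; rewrite imaginary_coneE //; last exact: face_of_sub.
apply/seteqP; split => z.
  move=> [y /(Zc_face _ hc)[hy yc] <-]; split; first exact: Zc_Wg.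
  by apply/perp1; rewrite iw.
move=> [hz /perp1 zc]; exists (w^-1%g z); last by rewrite GL_Kinv.
apply/(Zc_face _ hc); split; first by apply: Zc_Wg => //; exact: WgV.
by rewrite -iw GL_Kinv.
Qed.

Lemma data_tits_part x : tits_part B [set` P] H x <->
  Xc x /\ forall a, face_of c a -> B x (w a) = 0.
Proof.
have [_ _ pos _ ->] := hD; rewrite /tits_part tits_coneE simple_rootsE //; last first.
  exact: face_of_sub.
split; first by move=> [hx h]; split => // a fa; apply: h; exists a.
by move=> [hx h]; split => // _ [a fa <-]; exact: h.
Qed.

Lemma data_tits_partE : tits_part B [set` P] H = Xc `&` perp B [set w (lc d)].
Proof.
have [_ _ _ [fd kd] _] := hD.
have adj x y : B x (w y) = B (w^-1%g x) y by rewrite -[in RHS]iw GL_Kinv.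
have hX x : Xc x -> Xc (w^-1%g x) by move=> hx; apply: Xc_Wg => //; exact: WgV.
apply/seteqP; split => x.
  move=> /data_tits_part[hx h]; split => //; apply/perp1; rewrite adj.
  apply/(Xc_perp fd kd (hX x hx)) => a aP fa; rewrite -adj; exact: h.
move=> [hx /perp1]; rewrite adj => /(Xc_perp fd kd (hX x hx)) h.
by apply/data_tits_part; split => // a fa; rewrite adj h //; case: fa.
Qed.

Lemma data_perp z x : imaginary_cone B [set` P] H z -> tits_part B [set` P] H x ->
  B x z = 0.
Proof.
have [_ _ pos _ HE] := hD; rewrite {1}HE imaginary_coneE //; last exact: face_of_sub.
move=> [y hy <-] /data_tits_part[_ h].
have -> : B x (w y) = B (w^-1%g x) y by rewrite -[in RHS]iw GL_Kinv.
rewrite form_sym; apply: (form_span0 _ (cone_span (Zc_cone hy))) => a aP fa.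
by rewrite form_sym -iw GL_Kinv h.
Qed.

Lemma data_tits_part_c : tits_part B [set` P] H (w c).
Proof.
apply/data_tits_part; split; first exact: data_Xc.
by move=> a [_]; rewrite iw form_sym.
Qed.

Lemma data_imaginary_cone_d : imaginary_cone B [set` P] H (w (lc d)).
Proof.
have [_ _ _ [[d0 dI _] _] _] := hD.
rewrite data_imaginary_cone; split; first exact: data_Zc.
apply/perp1; rewrite iw; apply: (@form_span0 (face_of c)); last by exists d.
by move=> a _ [].
Qed.

Lemma data_dagger :
  dagger B [set` P] (imaginary_cone B [set` P] H) = tits_part B [set` P] H.
Proof.
rewrite /dagger tits_coneE; apply/seteqP; split => x.
  move=> [hx h]; rewrite data_tits_partE; split => //; apply/perp1/h.
  exact: data_imaginary_cone_d.
move=> hx; split; first by have /data_tits_part[] := hx.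
by move=> z hz; exact: data_perp.
Qed.

Lemma data_sharp :
  sharp B [set` P] (tits_part B [set` P] H) = imaginary_cone B [set` P] H.
Proof.
rewrite /sharp imaginary_cone_weylE; apply/seteqP; split => z.
  move=> [hz h]; rewrite data_imaginary_cone; split => //; apply/perp1/h.
  exact: data_tits_part_c.
move=> hz; split; first by move: hz; rewrite data_imaginary_cone => -[].
by move=> x hx; rewrite form_sym; exact: data_perp.
Qed.

Lemma data_fix h x : H h -> tits_part B [set` P] H x -> h x = x.
Proof.
have [_ _ _ _ HE] := hD; rewrite {1}HE => -[u hu <-] /data_tits_part[_ hx].
rewrite !GL_mulE (Wg_fix hu) ?GL_Kinv // => a aP fa.
by rewrite -iw GL_Kinv hx.
Qed.

Lemma data_stabilizer h : Wg setT h -> h (w c) = w c -> H h.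
Proof.
have [_ _ _ _ ->] := hD => hh e.
exists (w^-1 * h * w)%g; last by rewrite !mulgA mulgV mul1g mulgK.
apply: stabilizer => //; last by rewrite !GL_mulE e GL_invK.
by apply: WgM => //; apply: WgM => //; exact: WgV.
Qed.

Lemma data_sub h : H h -> Wg setT h.
Proof.
have [_ _ _ _ ->] := hD => -[u hu <-].
apply: WgM; last exact: WgV.
by apply: WgM => //; exact: Wg_sub hu.
Qed.

End Data.

(** A vector fixed by a reflection of [H1] is orthogonal to its root. Conversely, [H2] contains
    every Weyl group element fixing [w2 c2], which [H1] fixes if the inclusion of the parts of X
    holds. *)
Lemma special_tits_mono H1 H2 : special_facial B [set` P] H1 ->
  special_facial B [set` P] H2 ->
  H1 `<=` H2 <-> tits_part B [set` P] H2 `<=` tits_part B [set` P] H1.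
Proof.
move=> /special_facialE[w1 [c1 [d1 D1]]] /special_facialE[w2 [c2 [d2 D2]]]; split.
  move=> H12 x hx; apply/(data_tits_part D1); split.
    by have /(data_tits_part D2)[] := hx.
  move=> a fa; have [aP _] := fa.
  have [hw1 _ _ _ HE1] := D1.
  have ra : root (face_of c1) a by exact: root_gen.
  have : H1 (refl B (w1 a)) by rewrite HE1; exact: conj_refl_mem.
  move=> /H12 /(data_fix D2) /(_ hx).
  have u : B (w1 a) (w1 a) = 1 by rewrite (Wg_isom hw1) unit_root.
  rewrite reflE u divr1 => /eqP; rewrite -subr_eq0 addrAC subrr add0r oppr_eq0.
  rewrite scaler_eq0 => /orP[|/eqP a0]; first by rewrite mulf_eq0 pnatr_eq0 /= => /eqP.
  by move: u; rewrite a0 form0l => /esym/eqP; rewrite oner_eq0.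
move=> X21 h hh; apply: (data_stabilizer D2); first exact: data_sub D1 h hh.
exact: data_fix D1 _ _ hh (X21 _ (data_tits_part_c D2)).
Qed.

Lemma special_imaginary_mono H1 H2 : special_facial B [set` P] H1 ->
  special_facial B [set` P] H2 ->
  H1 `<=` H2 <-> imaginary_cone B [set` P] H1 `<=` imaginary_cone B [set` P] H2.
Proof.
move=> S1 S2; rewrite special_tits_mono //.
move: S1 S2 => /special_facialE[w1 [c1 [d1 D1]]] /special_facialE[w2 [c2 [d2 D2]]].
split=> h.
  rewrite -(data_sharp D1) -(data_sharp D2) => z [hz hx]; split => // x hx2.
  exact/hx/h.
rewrite -(data_dagger D1) -(data_dagger D2) => x [hx hz]; split => // z hz2.
exact/hz/h.
Qed.

(** * Non-empty faces and the lattice isomorphisms *)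

Lemma ccone_Z : ccone (Zc setT).
Proof. by split; [exact: Zc0|exact: ZcD|move=> k v k0; exact: ZcZ]. Qed.

Lemma ccone_X : ccone Xc.
Proof. by split; [exact: Xc0|exact: XcD|move=> k v k0; exact: XcZ]. Qed.

Lemma face_Z F : nonempty_faces (Zc setT) F -> exists H w c d,
  special_data H w c d /\ F = Zc setT `&` perp B [set w c].
Proof.
move=> [fF nF]; have [p Fp hF] := face_interior ccone_Z fF nF.
have [FZ _ _] := fF; have [w [k [hw hk pE]]] := FZ _ Fp.
have [c [d [hc fd kE kd]]] := max_supp hk; rewrite kE in kd.
have [H [w' [d' [D [u hu wE]]]]] := special_data_ex hw hc (ex_intro2 _ _ d fd kd).
have wc : w c = w' c by rewrite wE GL_mulE (face_fix hu).
exists H, w', c, d'; split => //; rewrite -wc.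
have iw := Wg_isom hw.
have pc : B p (w c) = 0.
  rewrite pE iw kE; apply: (@form_span0 (face_of c)); first by move=> a _ [].
  by exists d => //; case: fd.
have hwc : Xc (w c) by apply: Xc_Wg => //; exact: Cc_Xc.
apply/seteqP; split => z.
  move=> /hF[hz [e e0 he]]; split => //; apply/perp1.
  have := ZX_ge0 he hwc; rewrite formDl formNl formZl pc.
  have := ZX_ge0 hz hwc; by move=> h1 h2; nra.
move=> [hz /perp1 zc]; apply/hF; split => //.
have hy : Zc (face_of c) (w^-1%g z).
  apply/Zc_face => //; split; first by apply: Zc_Wg => //; exact: WgV.
  by rewrite -iw GL_Kinv.
have [e e0 he] := Zc_interior fd kd hy; exists e => //.
have -> : p - e *: z = w (lc d - e *: w^-1%g z).
  by rewrite GL_linB GL_linZ GL_Kinv -kE pE.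
exact: Zc_Wg.
Qed.

Lemma face_X F : nonempty_faces Xc F -> exists H w c d,
  special_data H w c d /\ F = tits_part B [set` P] H.
Proof.
move=> [fF nF]; have [p Fp hF] := face_interior ccone_X fF nF.
have [FX _ _] := fF; have [w [c0 [hw hc0 pE]]] := FX _ Fp.
have [c hc JE] := facial_infI hc0.
have sJ : special (face_of c) by rewrite -JE; exact: special_infI.
have [H [w' [d [D [u hu wE]]]]] := special_data_ex hw hc sJ.
exists H, w', c, d; split => //.
have [hw' _ _ [fd kd] _] := D.
have Jsub : face_of c `<=` face_of c0 by rewrite -JE; exact: infI_sub.
(* The correction [u] lies in the group of the smaller set [face_of c], so it also fixes [c0]. *)
have {}pE : p = w' c0.
  by rewrite pE wE GL_mulE (face_fix (Wg_sub Jsub hu)).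
have iw := Wg_isom hw'.
have pd : B (w' (lc d)) p = 0.
  rewrite pE iw; apply: (@form_span0 (face_of c)); last by exists d => //; case: fd.
  by move=> a _ /Jsub[].
apply/seteqP; split => x.
  move=> /hF[hx [e e0 he]]; rewrite (data_tits_partE D); split => //.
  apply/perp1; rewrite form_sym.
  have := ZX_ge0 (data_Zc D) he; rewrite formDr formNr formZr pd.
  have := ZX_ge0 (data_Zc D) hx; by move=> h1 h2; nra.
move=> /(data_tits_part D)[hx h]; apply/hF; split => //.
have [||e e0 he] := @Xc_interior c0 (w'^-1%g x) hc0.
- by apply: Xc_Wg => //; exact: WgV.
- by move=> a aP; rewrite JE => fa; rewrite -iw GL_Kinv h.
exists e => //.
have -> : p - e *: x = w' (c0 - e *: w'^-1%g x).
  by rewrite GL_linB GL_linZ GL_Kinv pE.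
exact: Xc_Wg.
Qed.

Lemma semi_exposed_Z :
  nonempty_faces (Zc setT) = semi_exposed_faces B (Zc setT) Xc.
Proof.
rewrite semi_exposedE; [|exact: ccone_Z|exact: ccone_X|exact: ZX_ge0].
apply/seteqP; split => F.
  move=> /face_Z[H [w [c [d [D ->]]]]]; exists (w c) => //; exact: data_Xc D.
by move=> [x hx ->]; apply: exposed_face; [exact: ccone_Z|move=> z hz; exact: ZX_ge0].
Qed.

Lemma XZ_ge0 x z : Xc x -> Zc setT z -> 0 <= B x z.
Proof. by move=> hx hz; rewrite form_sym; exact: ZX_ge0. Qed.

Lemma semi_exposed_X :
  nonempty_faces Xc = semi_exposed_faces B Xc (Zc setT).
Proof.
rewrite semi_exposedE; [|exact: ccone_X|exact: ccone_Z|exact: XZ_ge0].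
apply/seteqP; split => F.
  move=> /face_X[H [w [c [d [D ->]]]]]; exists (w (lc d)); first exact: data_Zc D.
  exact: data_tits_partE D.
by move=> [x hx ->]; apply: exposed_face; [exact: ccone_X|move=> z hz; exact: XZ_ge0].
Qed.

Lemma dual_pair_ZX : dual_pair B (Zc setT) Xc.
Proof.
split.
- split; [|exact/pointed_coneP/ccone_X|exact: ZX_ge0].
  exact/pointed_coneP/ccone_Z.
- apply/seteqP; split => v h.
    by move=> y hy; exact: ZX_dual.
  by move=> z hz; apply: h => x hx; exact: ZX_ge0.
- exact: semi_exposed_Z.
- exact: semi_exposed_X.
Qed.

Lemma iso_Z : complete_lattice_iso
  (special_facial B [set` P]) (fun W1 W2 => W1 `<=` W2)
  (nonempty_faces (Zc setT)) (fun F1 F2 => F1 `<=` F2)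
  (fun W' => imaginary_cone B [set` P] W').
Proof.
apply: order_iso; [exact/faces_complete/ccone_Z| |exact: special_imaginary_mono].
split.
- move=> H /special_facialE[w [c [d D]]]; rewrite (data_imaginary_cone D).
  apply: exposed_face; first exact: ccone_Z.
  by move=> z hz; apply: ZX_ge0 => //; exact: data_Xc D.
- move=> H1 H2 /set_mem S1 /set_mem S2 e; apply/seteqP; split.
    by apply/special_imaginary_mono => //; rewrite e.
  by apply/special_imaginary_mono => //; rewrite e.
- move=> F /face_Z[H [w [c [d [D FE]]]]]; exists H.
    by apply/special_facialE; exists w, c, d.
  by rewrite (data_imaginary_cone D).
Qed.

Lemma iso_X : complete_lattice_iso
  (special_facial B [set` P]) (fun W1 W2 => W1 `<=` W2)
  (nonempty_faces Xc) (fun F1 F2 => F2 `<=` F1)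
  (fun W' => tits_part B [set` P] W').
Proof.
apply: order_iso; [|split|exact: special_tits_mono].
- exact/complete_lattice_op/faces_complete/ccone_X.
- move=> H /special_facialE[w [c [d D]]]; rewrite (data_tits_partE D).
  apply: exposed_face; first exact: ccone_X.
  by move=> z hz; apply: XZ_ge0 => //; exact: data_Zc D.
- move=> H1 H2 /set_mem S1 /set_mem S2 e; apply/seteqP; split.
    by apply/special_tits_mono => //; rewrite e.
  by apply/special_tits_mono => //; rewrite e.
- move=> F /face_X[H [w [c [d [D FE]]]]]; exists H => //.
  by apply/special_facialE; exists w, c, d.
Qed.

End FiniteRootSystem.

Theorem theorem10p3 (R : realType) (V : vectType R) (B : {symmetric V})
    (Pi : set V) (hB : nondegenerate B) (hfin : finite_set Pi)
    (hPi : based_root_system B Pi) :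
  let Z := imaginary_cone B Pi (weyl_group B Pi) in
  let X := tits_cone B Pi in
  [/\ dual_pair B Z X,
      complete_lattice_iso
        (special_facial B Pi) (fun W1 W2 => W1 `<=` W2)
        (nonempty_faces Z) (fun F1 F2 => F1 `<=` F2)
        (fun W' => imaginary_cone B Pi W'),
      complete_lattice_iso
        (special_facial B Pi) (fun W1 W2 => W1 `<=` W2)
        (nonempty_faces X) (fun F1 F2 => F2 `<=` F1)
        (fun W' => tits_part B Pi W') &
      forall W', special_facial B Pi W' ->
        dagger B Pi (imaginary_cone B Pi W') = tits_part B Pi W' /\
        sharp B Pi (tits_part B Pi W') = imaginary_cone B Pi W'].
Proof.
move=> Z X; have /finite_seqP[s PiE] := hfin.
(* Sums over the list must count each simple root once. *)
have {}PiE : Pi = [set` undup s].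
  by rewrite PiE; apply/seteqP; split => a /=; rewrite mem_undup.
rewrite /Z /X PiE in hPi *; have us := undup_uniq s.
rewrite (tits_coneE us hPi hB) (imaginary_cone_weylE us hPi hB).
split.
- exact: dual_pair_ZX.
- exact: iso_Z.
- exact: iso_X.
- move=> W' /(special_facialE us hPi hB)[w [c [d D]]]; split.
    exact: data_dagger D.
  exact: data_sharp D.
Qed.
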